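(* A graph $G$ is the square of a connected odd-sun-free split graph if and only if $G$ is balanced and $\left|\bigcap\mathcal C(G)\right|\ge|\mathcal C(G)|$. In particular, there is a polynomial time algorithm to recognize graphs that admit an odd-sun-free split square root.
   Context: All graphs are finite and simple. The square $H^2$ of a graph $H$ is obtained from $H$ by adding an edge between any two distinct vertices at distance exactly two in $H$; $H$ is a square root of $H^2$. A split graph is a graph whose vertex set can be partitioned into a clique and an independent set. For $\ell\ge3$, the $\ell$-sun consists of an independent set $\{u_1,\dots,u_\ell\}$ and a clique $\{v_1,\dots,v_\ell\}$ with $u_i$ adjacent exactly to $v_i$ and $v_{i+1}$ (indices mod $\ell$); an odd sun is an $\ell$-sun with $\ell$ odd; odd-sun-free means no induced odd sun. $\mathcal C(G)$ is the set of inclusion-maximal cliques of $G$ and $\bigcap\mathcal C(G)$ their common intersection. A $0/1$ matrix is balanced if it has no square submatrix of odd order with exactly two 1's in each row and each column; a hypergraph is balanced if its vertex–hyperedge incidence matrix is balanced, equivalently if its bipartite vertex–hyperedge incidence graph has no induced cycle of length $2k$ for odd $k$. A graph $G$ is balanced if the hypergraph on $V(G)$ whose hyperedges are the maximal cliques of $G$ is balanced. *)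

(* Defs.v *)
From mathcomp Require Import all_boot all_order all_algebra.
Set Implicit Arguments.
Unset Strict Implicit.
Unset Printing Implicit Defensive.

Section Graphs.
Variable T : finType.
Implicit Types (e h : rel T) (K S : {set T}).

Definition simple_graph e : Prop := symmetric e /\ irreflexive e.

Definition has_walk e (x y : T) (k : nat) : bool :=
  [exists p : k.-tuple T, path e x p && (last x p == y)].

Definition at_distance e (x y : T) (k : nat) : bool :=
  has_walk e x y k && [forall j : 'I_k, ~~ has_walk e x y j].

Definition square h : rel T :=
  fun x y => h x y || (x != y) && at_distance h x y 2.

(* The graph without vertices does not count as connected. *)
Definition connected e : Prop := 0 < #|T| /\ forall x y, connect e x y.

Definition clique e K : bool :=
  [forall x in K, forall y in K, (x != y) ==> e x y].

Definition independent e S : bool :=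
  [forall x in S, forall y in S, ~~ e x y].

Definition split_graph e : Prop :=
  exists K, clique e K /\ independent e (~: K).

Definition max_cliques e : {set {set T}} := [set K | maxset (clique e) K].

End Graphs.

(* [inl i] is the vertex u_i and [inr j] is the vertex v_j; [ordS] is the
   cyclic successor. *)
Definition sun_adj (l : nat) : rel ('I_l + 'I_l) := fun a b =>
  match a, b with
  | inl _, inl _ => false
  | inr i, inr j => i != j
  | inl i, inr j | inr j, inl i => (j == i) || (j == ordS i)
  end.

Definition induced_subgraph (U T : finType) (f : rel U) (e : rel T) : Prop :=
  exists phi : U -> T, injective phi /\ forall a b, e (phi a) (phi b) = f a b.

Definition odd_sun_free (T : finType) (e : rel T) : Prop :=
  forall l, 3 <= l -> odd l -> ~ induced_subgraph (@sun_adj l) e.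

Definition two_ones_mx (k : nat) (B : 'M[bool]_k) : Prop :=
  (forall i, #|[set j | B i j]| = 2) /\ (forall j, #|[set i | B i j]| = 2).

Definition balanced_mx (m n : nat) (A : 'M[bool]_(m, n)) : Prop :=
  forall (k : nat) (f : 'I_k -> 'I_m) (g : 'I_k -> 'I_n),
    odd k -> injective f -> injective g -> ~ two_ones_mx (mxsub f g A).

Definition incidence_mx (T : finType) (E : {set {set T}}) :
    'M[bool]_(#|T|, #|E|) :=
  \matrix_(i, j) (@enum_val T T i \in @enum_val _ (mem E) j).

Definition balanced_hypergraph (T : finType) (E : {set {set T}}) : Prop :=
  balanced_mx (incidence_mx E).

Definition balanced_graph (T : finType) (e : rel T) : Prop :=
  balanced_hypergraph (max_cliques e).

Definition has_osf_split_root (T : finType) (e : rel T) : Prop :=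
  exists h : rel T,
    [/\ simple_graph h, split_graph h, odd_sun_free h & e =2 square h].

Definition has_connected_osf_split_root (T : finType) (e : rel T) : Prop :=
  exists h : rel T,
    [/\ simple_graph h, connected h, split_graph h, odd_sun_free h
      & e =2 square h].

(* Machine model: the WHILE language on binary trees (N. D. Jones,
   Computability and Complexity from a Programming Perspective), except that
   evaluating an expression is charged the sizes of the values of all its
   subexpressions instead of unit cost. A run of cost t therefore only handles
   data of size at most t, and the model is polynomially equivalent to Turing
   machines. *)
Inductive tree := Leaf | Node of tree & tree.

Fixpoint tree_size (d : tree) : nat :=
  if d is Node a b then (tree_size a + tree_size b).+1 else 1.

Definition hd_tree (d : tree) : tree := if d is Node a _ then a else Leaf.
Definition tl_tree (d : tree) : tree := if d is Node _ b then b else Leaf.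

Inductive expr :=
  | EVar of nat
  | ELeaf
  | ENode of expr & expr
  | EHd of expr
  | ETl of expr.

Inductive cmd :=
  | CAssign of nat & expr
  | CSeq of cmd & cmd
  | CIf of expr & cmd & cmd
  | CWhile of expr & cmd.

Definition store := nat -> tree.

Definition update (s : store) (x : nat) (d : tree) : store :=
  fun y => if y == x then d else s y.

Fixpoint eval (s : store) (a : expr) : tree :=
  match a with
  | EVar x => s x
  | ELeaf => Leaf
  | ENode a1 a2 => Node (eval s a1) (eval s a2)
  | EHd a1 => hd_tree (eval s a1)
  | ETl a1 => tl_tree (eval s a1)
  end.

Fixpoint eval_cost (s : store) (a : expr) : nat :=
  tree_size (eval s a) +
  match a with
  | EVar _ | ELeaf => 0
  | ENode a1 a2 => eval_cost s a1 + eval_cost s a2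
  | EHd a1 | ETl a1 => eval_cost s a1
  end.

(* [exec s c t s']: run from store s, command c halts in store s' at cost t.
   A test succeeds when its value is not [Leaf]. *)
Inductive exec : store -> cmd -> nat -> store -> Prop :=
  | ExecAssign s x a :
      exec s (CAssign x a) (eval_cost s a) (update s x (eval s a))
  | ExecSeq s s1 s2 c1 c2 t1 t2 :
      exec s c1 t1 s1 -> exec s1 c2 t2 s2 ->
      exec s (CSeq c1 c2) (t1 + t2) s2
  | ExecIfTrue s s1 a c1 c2 t :
      eval s a <> Leaf -> exec s c1 t s1 ->
      exec s (CIf a c1 c2) (eval_cost s a + t) s1
  | ExecIfFalse s s1 a c1 c2 t :
      eval s a = Leaf -> exec s c2 t s1 ->
      exec s (CIf a c1 c2) (eval_cost s a + t) s1
  | ExecWhileTrue s s1 s2 a c t1 t2 :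
      eval s a <> Leaf -> exec s c t1 s1 -> exec s1 (CWhile a c) t2 s2 ->
      exec s (CWhile a c) (eval_cost s a + t1 + t2) s2
  | ExecWhileFalse s a c :
      eval s a = Leaf -> exec s (CWhile a c) (eval_cost s a) s.

Definition enc_bool (b : bool) : tree := if b then Node Leaf Leaf else Leaf.

Definition enc_seq (ds : seq tree) : tree := foldr Node Leaf ds.

(* The adjacency matrix as a list of rows. *)
Definition enc_graph (n : nat) (e : rel 'I_n) : tree :=
  enc_seq [seq enc_seq [seq enc_bool (e i j) | j <- enum 'I_n]
          | i <- enum 'I_n].

Definition init_store (d : tree) : store := update (fun=> Leaf) 0 d.

(* Input and answer are in variable 0; any value but [Leaf] means "yes". *)
Definition poly_time_recognizable (P : forall n, rel 'I_n -> Prop) : Prop :=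
  exists (c : cmd) (a k : nat), forall (n : nat) (e : rel 'I_n),
    simple_graph e ->
    exists (t : nat) (s : store),
      [/\ exec (init_store (enc_graph e)) c t s,
          t <= a * n ^ k + a
        & s 0 <> Leaf <-> P n e].

(* Main.v *)
From Stdlib Require Import FunctionalExtensionality.
Require Import Defs.
From mathcomp Require Import all_boot all_order all_algebra zify.
Set Implicit Arguments.
Unset Strict Implicit.
Unset Printing Implicit Defensive.

(* The characterization.  Let h be an odd-sun-free split graph with clique K0, and let
   G = h^2.  As h has no 3-sun, a Helly argument shows that every maximal clique of G with
   at least two vertices is a closed neighbourhood N_h[v] with v in K0.  Hence K0 lies in
   all these cliques, their number is at most |K0|, and an odd sun formed by vertices and
   maximal cliques of G is an induced odd sun of h.  Conversely, assign to the maximal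
   cliques of G distinct vertices of their common intersection U, make U a clique, and join
   every vertex outside U to the vertices assigned to the cliques containing it.  A matrix
   is unbalanced if and only if it contains an odd sun, because a submatrix with two ones
   in each row and column decomposes into cycles.

   The algorithm.  If G has a root, no triangle xyz has vertices a, b, c whose closed
   neighbourhoods contain exactly {x,y}, {y,z}, {x,z} of it, and then the maximal cliques are
   the cliques of the form N[x] meet N[y] with xy an edge.  It remains to find a hole of
   length 2 mod 4 in their bipartite incidence graph.  A smallest such hole C either has
   length 6, or the graph contains a theta (three internally disjoint and nonadjacent
   paths between two nonadjacent vertices of different sides), or it contains a tent (two
   adjacent vertices that clone two vertices of C at odd distance at least 3, with the rest
   of C), or C is found as follows: all vertices with three far apart neighbours on C have a common
   neighbour on C, for each side, so guessing two vertices of C and their neighbours deletes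
   these major vertices, after which C is isometric and is recovered from five equidistant
   vertices by shortest paths.  Each of the four configurations is described by guessing
   a bounded number of vertices and numbers together with reachability conditions that
   already force an unbalanced hole.  Such descriptions are formulas with bounded
   quantifiers and walk predicates, which WHILE programs evaluate in polynomial time. *)

(** The obstacle in the detection is that a guess must certify an unbalanced hole in an arbitrary
    bipartite graph, while only extremal configurations are well behaved. Hence every description is
    sound with no assumption on the graph, and only its completeness uses minimality or the absence
    of the configurations tested before it. Parity does the work throughout: sides fix lengths
    modulo 2, and when several holes share their paths, their lengths cannot all be 0 modulo 4.
    Shortest paths are usable because, in an extremal configuration, any path of the right length
    may replace the original one.

    Maximal cliques may be exponentially many; excluding extended triangles first leaves at most one
    clique for each pair of adjacent vertices. The recognition problem admits disconnected roots, so
    maximal cliques consisting of an isolated vertex are left out there. *)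

Ltac arith_bool b :=
  lazymatch b with
  | leq _ _ => idtac
  | odd _ => idtac
  | true => idtac
  | false => idtac
  | andb ?x ?y => arith_bool x; arith_bool y
  | orb ?x ?y => arith_bool x; arith_bool y
  | negb ?x => arith_bool x
  | @eq_op _ ?x _ => let t := type of x in unify t nat
  | _ => fail
  end.

Ltac arith_prop P :=
  lazymatch P with
  | nat => idtac
  | False => idtac
  | is_true ?b => arith_bool b
  | @eq _ (odd _) _ => idtac
  | @eq _ (leq _ _) _ => idtac
  | @eq bool ?a ?b => arith_bool a; arith_bool b
  | @eq ?T _ _ => unify T nat
  | ~ ?P => arith_prop P
  | ?P -> ?Q => arith_prop P; arith_prop Q
  | ?P \/ ?Q => arith_prop P; arith_prop Q
  | ?P /\ ?Q => arith_prop P; arith_prop Q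
  | _ => fail
  end.

(* lia after discarding the hypotheses that zify would otherwise preprocess in vain. *)
Ltac slia :=
  intros;
  repeat match goal with
  | H : ?P |- _ => tryif arith_prop P then fail else clear H
  end; lia.

(** * Induced paths and holes *)

Section Holes.
Variables (T : finType) (adj : rel T).
Hypothesis adjC : symmetric adj.

(** Paths and holes are functions on [nat]: of a path only the values up to its length matter, and a
    hole is periodic, so every window of [n] consecutive indices describes it and a rotation is a
    shift of the index. *)
Definition ipath (x : nat -> T) (l : nat) : Prop :=
  forall i j, i < j <= l -> x i != x j /\ adj (x i) (x j) = (j == i.+1).

Definition phole (c : nat -> T) (n : nat) : Prop :=
  (forall i, c (i + n) = c i) /\
  forall i j, i < j < i + n ->
    c i != c j /\ adj (c i) (c j) = (j == i.+1) || (j.+1 == i + n).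

Lemma ipathW x l k m : ipath x l -> k + m <= l -> ipath (fun i => x (k + i)) m.
Proof.
move=> Hx km i j ij; have [|-> ->] := Hx (k + i) (k + j); first by slia.
by split=> //; slia.
Qed.

Lemma ipath_rev x l : ipath x l -> ipath (fun i => x (l - i)) l.
Proof.
move=> Hx i j ij; have [|N A] := Hx (l - j) (l - i); first by slia.
by rewrite adjC A; split; [by rewrite eq_sym | slia].
Qed.

Lemma ipath_cat x l y m :
  ipath x l -> ipath y m -> x l = y 0 ->
  (forall i j, i < l -> 0 < j <= m -> x i != y j /\ ~~ adj (x i) (y j)) ->
  ipath (fun i => if i <= l then x i else y (i - l)) (l + m).
Proof.
move=> Hx Hy E X i j ij.
have [jl|lj] := leqP j l.
  have -> : i <= l by slia.
  by apply: Hx; slia.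
have [il|li] := leqP i l; last first.
  have [|-> ->] := Hy (i - l) (j - l); first by slia.
  by split=> //; slia.
have [{}il|{}li] := ltnP i l.
  have [//||-> /negbTE ->] := X i (j - l); first by slia.
  by split=> //; slia.
have -> : i = l by slia.
rewrite E; have [|-> ->] := Hy 0 (j - l); first by slia.
by split=> //; slia.
Qed.

Lemma ipath2 a v b : a != b -> a != v -> v != b -> ~~ adj a b ->
  adj a v -> adj v b ->
  ipath (fun i => if i is j.+1 then (if j is _.+1 then b else v) else a) 2.
Proof.
move=> ab av vb /negbTE Nab Aav Avb [|[|[|i]]] [|[|[|j]]] //= ij;
  by first [slia | rewrite Aav | rewrite Nab | rewrite Avb].
Qed.

Lemma modn_shift n i d : 0 < d < n ->
  (i + d) %% n = (if i %% n + d < n then i %% n + d else i %% n + d - n).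
Proof.
move=> dn; have n0 : 0 < n by slia.
rewrite -modnDml; have rn := ltn_pmod i n0.
case: ifP => H; first by rewrite modn_small.
have H' : n <= i %% n + d by slia.
by rewrite -[in LHS](subnK H') modnDr modn_small //; slia.
Qed.

Lemma phole_fin f n : 0 < n ->
  (forall i j, i < j < n ->
     f i != f j /\ adj (f i) (f j) = (j == i.+1) || ((i == 0) && (j.+1 == n))) ->
  phole (fun i => f (i %% n)) n.
Proof.
move=> n0 H; split=> [i|i j ij]; first by rewrite modnDr.
have [d dn ->] : exists2 d, 0 < d < n & j = i + d by exists (j - i); slia.
rewrite modn_shift // {ij j}.
have rn := ltn_pmod i n0; move: (i %% n) rn => r rn.
case: ltnP => C.
  have [|-> ->] := H r (r + d); first by slia.
  by split=> //; slia.
have [|N A] := H (r + d - n) r; first by slia.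
by rewrite adjC A; split; [by rewrite eq_sym | slia].
Qed.

(** Walk along [x] and return along [y], hence the index [l + m - i]. Only the interiors have to be
    kept apart: contacts with the common ends are excluded because both paths are induced and have
    length at least two. *)
Lemma glue x l y m :
  ipath x l -> ipath y m -> x 0 = y 0 -> x l = y m -> 1 < l -> 1 < m ->
  (forall i j, 0 < i < l -> 0 < j < m -> x i != y j /\ ~~ adj (x i) (y j)) ->
  exists c, [/\ phole c (l + m), forall i, i <= l -> c i = x i
              & forall i, i <= m -> c (l + m - i) = y i].
Proof.
move=> Hx Hy E0 El l1 m1 X.
pose f k := if k <= l then x k else y (l + m - k).
exists (fun i => f (i %% (l + m))); split; last first.
- move=> [|i] Hi; first by rewrite subn0 modnn /f.
  rewrite modn_small /f; last by slia.
  case: leqP => C; last by congr y; slia.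
  have -> : i.+1 = m by slia.
  by rewrite -El; congr x; slia.
- by move=> i Hi; rewrite modn_small /f ?Hi //; slia.
apply: phole_fin; first by slia.
rewrite /f => i j ij; have [jl|lj] := leqP j l.
  have -> : i <= l by slia.
  by have [|-> ->] := Hx i j; [slia | split=> //; slia].
have [il|li] := leqP i l; last first.
  have [|N A] := Hy (l + m - j) (l + m - i); first by slia.
  by rewrite adjC A; split; [by rewrite eq_sym | slia].
have [->|i0] := posnP i.
  rewrite E0; have [|-> ->] := Hy 0 (l + m - j); first by slia.
  by split=> //; slia.
have [{}il|{}li] := ltnP i l.
  by have [||-> /negbTE ->] := X i (l + m - j); slia.
have -> : i = l by slia.
rewrite El; have [|N A] := Hy (l + m - j) m; first by slia.
by rewrite adjC A; split; [by rewrite eq_sym | slia].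
Qed.

Lemma phole_shift c n k : phole c n -> phole (fun i => c (k + i)) n.
Proof.
move=> [P H]; split=> [i|i j ij]; first by rewrite addnA P.
have [|-> ->] := H (k + i) (k + j); first by slia.
by split=> //; slia.
Qed.

Lemma phole_modn c n i : phole c n -> c (i %% n) = c i.
Proof.
move=> [P _]; rewrite [in RHS](divn_eq i n).
elim: (i %/ n) => [|k IH]; first by rewrite add0n.
by rewrite mulSn -addnA addnC P.
Qed.

Lemma phole_arc c n k l : phole c n -> l + 2 <= n -> ipath (fun i => c (k + i)) l.
Proof.
move=> [P H] ln i j ij; have [|-> ->] := H (k + i) (k + j); first by slia.
by split=> //; slia.
Qed.

Lemma phole_rep c n k i : phole c n -> 0 < n -> exists j, k <= j < k + n /\ c j = c i.
Proof.
move=> Hc n0; have kn := ltn_pmod k n0.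
exists (k + (i + (n - k %% n)) %% n); split.
  by have := ltn_pmod (i + (n - k %% n)) n0; slia.
rewrite -(phole_modn _ Hc) modnDmr -(phole_modn i Hc); congr c.
rewrite addnCA -modnDmr -(modnDml k).
have -> : k %% n + (n - k %% n) = n by slia.
by rewrite modnn addn0.
Qed.

Lemma phole_neq c n i j : phole c n -> i < j < i + n -> c i != c j.
Proof. by move=> [_ H] /H[]. Qed.

Lemma phole_idx c n k m : phole c n -> c k = c m -> k < n -> m < n.*2 -> m = k \/ m = k + n.
Proof.
move=> Hc E kn mn; have E' : m < n \/ n <= m /\ c k = c (m - n).
  have [lt|ge] := ltnP m n; [by left | right; split=> //].
  by rewrite E -[in LHS](subnK ge); case: Hc.
have ne i j : i < n -> j < n -> c i = c j -> i = j.
  by move=> i_n jn Eij; have [lt|lt|//] := ltngtP i j; [have := phole_neq Hc (ltac:(slia) : i < j < i + n)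
    | have := phole_neq Hc (ltac:(slia) : j < i < j + n)]; rewrite Eij eqxx.
case: E' => [mn'|[nm E']]; first by left; rewrite (ne k m).
by right; have := ne k (m - n) kn ltac:(slia) E'; slia.
Qed.

Lemma phole_adj c n i j : phole c n -> i < j < i + n ->
  adj (c i) (c j) = (j == i.+1) || (j.+1 == i + n).
Proof. by move=> [_ H] /H[]. Qed.

Lemma phole_adjS c n i : phole c n -> 2 < n -> adj (c i) (c i.+1).
Proof. by move=> H n2; rewrite (phole_adj H); slia. Qed.

End Holes.

(** * Links through vertex sets and induced paths extracted from walks *)

Section Links.
Variables (T : finType) (adj : rel T).
Hypothesis adjC : symmetric adj.

Definition restr (X : {set T}) : rel T := fun u v => [&& adj u v, u \in X & v \in X].

(** Equivalently, some walk of length at least two from [a] to [b] has its interior in [X]. Working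
    with sets allows a theta to be stated by separations between sets; induced paths are extracted
    only when they are needed. *)
Definition lnk (X : {set T}) (a b : T) : Prop :=
  exists u v, [/\ u \in X, v \in X, adj a u, adj v b & connect (restr X) u v].

Definition walk (P : pred T) (x : nat -> T) (l : nat) : Prop :=
  (forall i, i < l -> adj (x i) (x i.+1)) /\ (forall i, 0 < i < l -> P (x i)).

Definition acomp (X Y : {set T}) : Prop :=
  forall x y, x \in X -> y \in Y -> x != y /\ ~~ adj x y.

Lemma acompC X Y : acomp X Y -> acomp Y X.
Proof. by move=> H x y Hx Hy; rewrite eq_sym adjC; apply: H. Qed.

Lemma connect_restrC X u v : connect (restr X) u v = connect (restr X) v u.
Proof.
by apply: sym_connect_sym => {u v} u v; rewrite /restr adjC [(u \in X) && _]andbC.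
Qed.

Lemma connect_restrS (X Y : {set T}) u v : X \subset Y -> connect (restr X) u v -> connect (restr Y) u v.
Proof.
move=> /subsetP XY; apply: connect_sub => x y /and3P[A Hx Hy].
by apply: connect1; rewrite /restr A !XY.
Qed.

Lemma lnkC X a b : lnk X a b -> lnk X b a.
Proof.
by move=> [u [v [Hu Hv A B C]]]; exists v, u; split; rewrite // 1?adjC // connect_restrC.
Qed.

Lemma seg_connect (X : {set T}) x i j : i <= j ->
  (forall k, i <= k < j -> adj (x k) (x k.+1)) ->
  (forall k, i <= k <= j -> x k \in X) -> connect (restr X) (x i) (x j).
Proof.
elim: j => [|j IH] ij A H; first by have -> : i = 0 by slia.
have [E|ij'] := eqVneq i j.+1; first by rewrite E.
apply: (@connect_trans _ _ (x j)).
  by apply: IH => [|k Hk|k Hk]; [slia|apply: A; slia|apply: H; slia].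
by apply: connect1; rewrite /restr A ?H //; slia.
Qed.

Definition arc (x : nat -> T) lo m : {set T} := [set x (lo + i) | i : 'I_m].

Lemma arcP x lo m y : reflect (exists i, lo <= i < lo + m /\ y = x i) (y \in arc x lo m).
Proof.
apply: (iffP imsetP) => [[i _ ->]|[i [Hi ->]]].
  by exists (lo + i); split=> //; have := ltn_ord i; slia.
have Hi' : i - lo < m by slia.
by exists (Ordinal Hi') => //=; congr x; slia.
Qed.

Lemma mem_arc x lo m i : lo <= i < lo + m -> x i \in arc x lo m.
Proof. by move=> Hi; apply/arcP; exists i. Qed.

Lemma card_arc x lo m : #|arc x lo m| <= m.
Proof. by apply: leq_trans (leq_imset_card _ _) _; rewrite card_ord. Qed.

Lemma lnk_arc x lo m a b : 0 < m -> (forall k, lo <= k -> k.+1 < lo + m -> adj (x k) (x k.+1)) ->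
  adj a (x lo) -> adj (x (lo + m).-1) b -> lnk (arc x lo m) a b.
Proof.
move=> m0 A Ha Hb; exists (x lo), (x (lo + m).-1).
split; rewrite ?mem_arc //; try slia.
by apply: seg_connect => [|k Hk|k Hk]; [slia|apply: A; slia|apply: mem_arc; slia].
Qed.

Lemma connect_walk (X : {set T}) u v : u \in X -> connect (restr X) u v ->
  exists x l, [/\ x 0 = u, x l = v, forall i, i < l -> adj (x i) (x i.+1)
                & forall i, i <= l -> x i \in X].
Proof.
move=> Hu /connectP[p Hp ->]; exists (nth u (u :: p)), (size p); split=> //=.
- by rewrite -[size p]/((size (u :: p)).-1) nth_last.
- by move=> i Hi; have /pathP := Hp => /(_ u i Hi) /and3P[].
- case=> [|i] Hi //=; have /pathP := Hp => /(_ u i Hi) /and3P[] //.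
Qed.

Lemma lnk_walk (X : {set T}) a b : lnk X a b -> exists x l, [/\ 1 < l, x 0 = a, x l = b & walk [in X] x l].
Proof.
move=> [u [v [Hu Hv A B /(connect_walk Hu)[x [l [x0 xl H1 H2]]]]]].
exists (fun i => if i is j.+1 then (if j <= l then x j else b) else a), l.+2; split=> //=.
  by rewrite ltnn.
split=> [[|i] Hi|[|i] Hi] //=; first by rewrite x0.
  have -> : i <= l by slia.
  case: ltnP => H; first exact: H1.
  have -> : i = l by slia.
  by rewrite xl.
have -> : i <= l by slia.
by apply: H2; slia.
Qed.

(** Induction on the length: a repetition or a chord allows the walk to be shortened, and the
    interior of the shorter walk still satisfies [P]. *)
Lemma walk_ipath (P : pred T) x l : walk P x l -> x 0 != x l ->
  exists y m, [/\ m <= l, y 0 = x 0, y m = x l, ipath adj y m & walk P y m].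
Proof.
have [N] := ubnP l; elim: N l x => // N IH l x lN Wx ne.
have [A H] := Wx.
case: (boolP [forall i : 'I_l.+1, forall j : 'I_l.+1, (i < j) ==>
         (x i != x j) && (adj (x i) (x j) == (j == i.+1 :> nat))]) => [/'forall_forallP Hi|].
  exists x, l; split=> // i j ij; have Hj : j < l.+1 by slia.
  have Hi' : i < l.+1 by slia.
  have /= := Hi (Ordinal Hi') (Ordinal Hj); have -> : i < j by slia.
  by move=> /andP[-> /eqP].
rewrite negb_forall => /existsP[[i Hi]]; rewrite negb_forall => /existsP[[j Hj]] /=.
rewrite negb_imply => /andP[ij].
(* [step] removes the [d] vertices after position [i]; a repetition uses [d = j - i], a chord
   [d = j - i - 1]. *)
have step d : 0 < d -> i + d <= l -> (i + d == l -> x i = x l) ->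
    (i + d < l -> adj (x i) (x (i + d).+1)) ->
  exists y m, [/\ m <= l, y 0 = x 0, y m = x l, ipath adj y m & walk P y m].
  move=> d0 dl E1 E2; pose y k := if k <= i then x k else x (k + d).
  have yl : y (l - d) = x l.
    rewrite /y; case: leqP => C; last by congr x; slia.
    have -> : l - d = i by slia.
    by apply: E1; slia.
  have [|||z [m [ml z0 zm Hz Wz]]] := IH (l - d) y; first by slia.
  - split=> k Hk; rewrite /y.
      have [ki|ik] := ltnP k i; first by rewrite ltnW //; apply: A; slia.
      case: leqP => C; last by rewrite addSn; apply: A; slia.
      by (have -> : k = i by slia); rewrite addSn; apply: E2; slia.
    by case: leqP => C; apply: H; slia.
  - by rewrite yl.
  by exists z, m; split=> //; [slia|rewrite zm].
case: eqVneq => [xx _|_ /=].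
  have E : i + (j - i) = j by slia.
  apply: (step (j - i)); rewrite ?E; try slia.
    by move=> /eqP <-.
  by move=> jl; rewrite xx; apply: A.
have [->|ji] := eqVneq j i.+1; first by rewrite A //; slia.
rewrite eqbF_neg negbK => Aij.
have E : i + (j - i.+1) = j.-1 by slia.
apply: (step (j - i.+1)); rewrite ?E ?prednK //; slia.
Qed.

Lemma lnk_ipath (X : {set T}) a b : lnk X a b -> a != b -> ~~ adj a b ->
  exists x l, [/\ 1 < l, x 0 = a, x l = b, ipath adj x l & forall i, 0 < i < l -> x i \in X].
Proof.
move=> /lnk_walk[x [l [l1 x0 xl W]]] ab Nab.
have [|y [m [ml y0 ym Hy [A H]]]] := walk_ipath W; first by rewrite x0 xl.
exists y, m; split=> //; rewrite ?y0 ?ym //.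
case: m {ml Hy H} ym A => [|[|m]] ym A //.
  by move: ab; rewrite -x0 -xl -y0 ym eqxx.
by move: (A 0 isT); rewrite y0 ym x0 xl (negbTE Nab).
Qed.

End Links.

(** * Thetas, and how a vertex attached to a hole creates them *)

Section Thetas.
Variables (T : finType) (adj : rel T) (side : T -> bool).
Hypothesis adjC : symmetric adj.
Hypothesis bip : forall x y, adj x y -> side x != side y.

Lemma side_walk x l : (forall i, i < l -> adj (x i) (x i.+1)) ->
  forall i, i <= l -> side (x i) = side (x 0) (+) odd i.
Proof.
move=> A; elim=> [|i IH] il; first by rewrite addbF.
by have := bip (A i il); rewrite IH 1?ltnW //=; case: (side _) (side _) (odd i) => [] [] [].
Qed.

Lemma ipath_side x l i : ipath adj x l -> i <= l -> side (x i) = side (x 0) (+) odd i.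
Proof.
move=> H; apply: side_walk => {}i il; have [|_ ->] := H i i.+1; first by slia.
by rewrite eqxx.
Qed.

Lemma phole_side c n i : phole adj c n -> 2 < n -> side (c i) = side (c 0) (+) odd i.
Proof. by move=> H n2; apply: (@side_walk _ i) => // j _; apply: phole_adjS H n2. Qed.

Lemma phole_even c n : phole adj c n -> 2 < n -> ~~ odd n.
Proof.
move=> H n2; have := phole_side n H n2; case: H => /(_ 0) /=; rewrite add0n => -> _.
by case: (side _) (odd n) => [] [].
Qed.

Lemma side_irr x : ~~ adj x x.
Proof. by apply/negP => /bip; rewrite eqxx. Qed.

Definition unb : Prop := exists n c, [/\ 5 < n, n %% 4 = 2 & phole adj c n].

Definition theta a b (X Y Z : {set T}) : Prop :=
  [/\ side a != side b, ~~ adj a b,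
      [/\ lnk adj X a b, lnk adj Y a b & lnk adj Z a b],
      [/\ acomp adj X Y, acomp adj X Z & acomp adj Y Z]
    & a \notin X :|: Y :|: Z /\ b \notin X :|: Y :|: Z].

(** The ends lie on different sides, so all three paths have odd length. Two of these lengths agree
    modulo 4, and the corresponding paths form a hole of length 2 modulo 4. *)
Lemma theta_unb a b X Y Z : theta a b X Y Z -> unb.
Proof.
move=> [sab Nab [LX LY LZ] [XY XZ YZ] _].
have ab : a != b by apply: contraNneq sab => ->.
have [x [l [l1 x0 xl Hx Xx]]] := lnk_ipath LX ab Nab.
have [y [m [m1 y0 ym Hy Yy]]] := lnk_ipath LY ab Nab.
have [z [p [p1 z0 zp Hz Zz]]] := lnk_ipath LZ ab Nab.
have ol : odd l by move: sab; rewrite -xl -x0 (ipath_side Hx (leqnn l)); case: (side _) (odd l) => [] [].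
have om : odd m by move: sab; rewrite -ym -y0 (ipath_side Hy (leqnn m)); case: (side _) (odd m) => [] [].
have op : odd p by move: sab; rewrite -zp -z0 (ipath_side Hz (leqnn p)); case: (side _) (odd p) => [] [].
have [lm|lm] := eqVneq ((l + m) %% 4) 2.
  have [||||i j Hi Hj|c [Hc _ _]] := glue adjC Hx Hy; rewrite ?x0 ?xl //.
    by apply: XY; [apply: Xx|apply: Yy].
  by exists (l + m), c; split=> //; slia.
have [lp|lp] := eqVneq ((l + p) %% 4) 2.
  have [||||i j Hi Hj|c [Hc _ _]] := glue adjC Hx Hz; rewrite ?x0 ?xl //.
    by apply: XZ; [apply: Xx|apply: Zz].
  by exists (l + p), c; split=> //; slia.
have mp : (m + p) %% 4 = 2 by slia.
have [||||i j Hi Hj|c [Hc _ _]] := glue adjC Hy Hz; rewrite ?y0 ?ym //.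
  by apply: YZ; [apply: Yy|apply: Zz].
by exists (m + p), c; split=> //; slia.
Qed.

(* If q has one neighbour h k on the hole, the theta joins h 0 and h k; if it has several,
   it joins h 0 and q.  The hypothesis on sides makes these ends opposite. *)
Lemma attach_theta h n q (Z : {set T}) k : phole adj h n -> 3 < n ->
  (forall i, q != h i) -> adj q (h k) -> k < n ->
  ~~ adj q (h 0) -> ~~ adj q (h 1) -> ~~ adj q (h n.-1) ->
  q \notin Z -> h 0 \notin Z ->
  (forall z i, z \in Z -> 0 < i < n -> z != h i /\ ~~ adj z (h i)) ->
  lnk adj Z q (h 0) ->
  ((exists k', [/\ k' < n, k' != k & adj q (h k')]) <-> side q != side (h 0)) ->
  exists a b X Y W, theta a b X Y W /\ #|X| + #|Y| + #|W| < n + #|Z|.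
Proof.
move=> Hh n3 qh qk kn q0 q1 qn qZ hZ Zh L E.
have hA i : adj (h i) (h i.+1) by apply: phole_adjS Hh _; slia.
have hN i j : i < j < n -> h i != h j by move=> ij; apply: (phole_neq Hh); slia.
have hadj i j : i < j < n -> adj (h i) (h j) = (j == i.+1) || (j.+1 == i + n).
  by move=> ij; rewrite (phole_adj Hh) //; slia.
have ev := phole_even Hh (ltnW n3).
have sq i : adj q (h i) -> side q = ~~ (side (h 0) (+) odd i).
  by move=> /bip; rewrite (phole_side i Hh (ltnW n3)); case: (side q); case: (_ (+) _).
have k2 : 1 < k < n.-1.
  have : [/\ k != 0, k != 1 & k != n.-1]; last by case; slia.
  by split; apply: contraTneq qk => ->.
have qE (i : nat) : i < n -> adj q (h i) -> 1 < i < n.-1.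
  move=> i_n qi; have : [/\ i != 0, i != 1 & i != n.-1]; last by case; slia.
  by split; apply: contraTneq qi => ->.
case: (boolP (side q == side (h 0))) => [/eqP sq0|sq0].
  have uniq_k i : i < n -> adj q (h i) -> i = k.
    move=> i_n qi; apply/eqP; apply/negPn/negP => ik; have : side q != side (h 0).
      by apply/E; exists i.
    by rewrite sq0 eqxx.
  have ok : odd k by have := sq k qk; rewrite sq0; case: (side _); case: (odd k).
  exists (h 0), (h k), (arc h 1 k.-1), (arc h k.+1 (n.-1 - k)), (q |: Z); split; last first.
    rewrite cardsU1 qZ; have := card_arc h 1 k.-1; have := card_arc h k.+1 (n.-1 - k); slia.
  have qZh z i : z \in q |: Z -> 0 < i < n -> i != k -> z != h i /\ ~~ adj z (h i).
    move=> /setU1P[->|Hz] Hi ik; last exact: Zh.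
    by split=> //; apply: contraNN ik => /uniq_k -> //; slia.
  split.
  - by rewrite (phole_side k Hh (ltnW n3)) ok; case: (side _).
  - by rewrite hadj //; slia.
  - split.
    + apply: lnk_arc => //; first by slia.
      by have := hA k.-1; rewrite prednK //; slia.
    + apply: lnkC => //; apply: lnk_arc => //; first by slia.
      have -> : (k.+1 + (n.-1 - k)).-1 = n.-1 by slia.
    by have := hA n.-1; have [/(_ 0) H _] := Hh; rewrite prednK ?H //; slia.
    + have [u [v [Hu Hv A B C]]] := L; exists v, q.
      split; rewrite // 1?adjC // ?setU11 // ?setU1r // connect_restrC //.
      apply: (@connect_trans _ _ u); last by apply: connect_restrS C; apply: subsetUr.
      by apply: connect1; rewrite /restr A setU11 setU1r.
  - split.
    + move=> x y /arcP[i [Hi ->]] /arcP[j [Hj ->]]; rewrite hN ?hadj; slia.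
    + by move=> x y /arcP[i [Hi ->]] Hy; rewrite eq_sym adjC; apply: qZh => //; slia.
    + by move=> x y /arcP[i [Hi ->]] Hy; rewrite eq_sym adjC; apply: qZh => //; slia.
  - split; rewrite !inE !negb_or.
    + rewrite eq_sym qh hZ !andbT; apply/andP; split.
        by apply/arcP => -[i [Hi] /eqP]; apply/negP; apply: hN; slia.
      by apply/arcP => -[i [Hi] /eqP]; apply/negP; apply: hN; slia.
    + rewrite [h k == q]eq_sym qh /= -andbA; apply/and3P; split.
      * by apply/arcP => -[i [Hi] /eqP]; apply/negP; rewrite eq_sym; apply: hN; slia.
      * by apply/arcP => -[i [Hi] /eqP]; apply/negP; apply: hN; slia.
      * by apply/negP => /(Zh _ k) []; [slia | rewrite eqxx].
have [k' [k'n k'k qk']] := (proj2 E) sq0.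
(* The arcs from [h 0] to the first and, in the other direction, to the last neighbour of [q] are
   two of the three paths. These neighbours have the same parity, so the arcs do not touch. *)
pose P i := (i < n) && adj q (h i).
have exP : exists i, P i by exists k; rewrite /P kn.
have ubP i : P i -> i <= n by move=> /andP[/ltnW].
case: (ex_minnP exP) => k1 /andP[k1n qk1] mn.
case: (ex_maxnP exP ubP) => k3 /andP[k3n qk3] mx.
have k13 : k1 < k3.
  have := mn k; have := mn k'; have := mx k; have := mx k'; rewrite /P kn k'n qk qk' => /(_ isT) a1 /(_ isT) a2 /(_ isT) a3 /(_ isT) a4.
  by move: k'k a1 a2 a3 a4; slia.
have par : odd k1 = odd k3.
  by have := sq _ qk1; rewrite (sq _ qk3); case: (side _); case: (odd k1); case: (odd k3).
have b1 := qE _ k1n qk1; have b3 := qE _ k3n qk3.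
exists (h 0), q, (arc h 1 k1), (arc h k3 (n - k3)), Z; split; last first.
  by have := card_arc h 1 k1; have := card_arc h k3 (n - k3); slia.
split.
- by rewrite eq_sym.
- by rewrite adjC.
- split.
  + by apply: lnk_arc => //; [slia | rewrite add1n adjC].
  + apply: lnkC => //; apply: lnk_arc => //; first by slia.
    have -> : (k3 + (n - k3)).-1 = n.-1 by slia.
    by have := hA n.-1; have [/(_ 0) H _] := Hh; rewrite prednK ?H //; slia.
  + by apply: lnkC.
- split.
  + move=> x y /arcP[i [Hi ->]] /arcP[j [Hj ->]]; rewrite hN ?hadj; slia.
  + by move=> x y /arcP[i [Hi ->]] Hy; rewrite eq_sym adjC; apply: Zh => //; slia.
  + by move=> x y /arcP[i [Hi ->]] Hy; rewrite eq_sym adjC; apply: Zh => //; slia.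
- split; rewrite !inE !negb_or.
  + rewrite hZ !andbT; apply/andP; split.
      by apply/arcP => -[i [Hi] /eqP]; apply/negP; apply: hN; slia.
    by apply/arcP => -[i [Hi] /eqP]; apply/negP; apply: hN; slia.
  + rewrite qZ andbT; apply/andP; split; apply/arcP => -[i [Hi] /eqP]; exact/negP.
Qed.

End Thetas.

(** * Detecting thetas *)

Section Walks.
Variables (T : finType) (R : rel T).

Fixpoint wkb (k : nat) (s t : T) : bool :=
  if k is k'.+1 then [exists v, R s v && wkb k' v t] else s == t.

Lemma wkbP k s t :
  reflect (exists x, [/\ x 0 = s, x k = t & forall i, i < k -> R (x i) (x i.+1)]) (wkb k s t).
Proof.
elim: k s => [|k IH] s /=.
  by apply: (iffP eqP) => [->|[x [<- <- _]]] //; exists (fun=> t).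
apply: (iffP existsP) => [[v /andP[Rv /IH[x [x0 xk H]]]]|[x [x0 xk H]]].
  exists (fun i => if i is j.+1 then x j else s); split=> // -[|i] Hi /=; first by rewrite x0.
  exact: H.
exists (x 1); rewrite -x0 H //=; apply/IH.
by exists (fun i => x i.+1); split=> // i Hi; apply: H.
Qed.

Lemma wkb_connect j s t : wkb j s t -> connect R s t.
Proof.
elim: j s => [|j IH] s /=; first by move=> /eqP ->.
by move=> /existsP[v /andP[Rv /IH Hv]]; apply: connect_trans (connect1 Rv) Hv.
Qed.

Lemma connect_wkb s t : connect R s t -> exists2 j, j < #|T| & wkb j s t.
Proof.
move=> /connectP[p0 Hp0 ->]; case/shortenP: Hp0 => p Hp Up _.
exists (size p); first by have /card_uniqP := Up; have := max_card (mem (s :: p)) => + E; rewrite E.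
elim: p s Hp {Up} => [|v p IH] s //= /andP[Rv Hp].
by apply/existsP; exists v; rewrite Rv IH.
Qed.

End Walks.

Section Detect.
Variables (T : finType) (adj : rel T) (side : T -> bool).
Hypothesis adjC : symmetric adj.
Hypothesis bip : forall x y, adj x y -> side x != side y.

Notation phole := (phole adj).
Notation theta := (theta adj side).
Notation lnk := (lnk adj).
Notation restr := (restr adj).
Notation acomp := (acomp adj).

(** [attach_theta] requires the sides of [q] and of the chosen end to differ exactly when [q] has
    several neighbours on the hole. Since [tau] is odd, [h 0] and [h tau] lie on different sides, so
    one of them is suitable. *)
Lemma attach2_theta h n tau q (Za Zb : {set T}) m k : phole h n -> 3 < n ->
  odd tau -> tau < n -> (forall i, q != h i) -> adj q (h k) ->
  (forall i, h i = h 0 \/ adj (h i) (h 0) \/ h i = h tau \/ adj (h i) (h tau) -> ~~ adj q (h i)) ->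
  q \notin Za -> q \notin Zb -> h 0 \notin Za -> h tau \notin Zb ->
  (forall z i, z \in Za -> h i != h 0 -> z != h i /\ ~~ adj z (h i)) ->
  (forall z i, z \in Zb -> h i != h tau -> z != h i /\ ~~ adj z (h i)) ->
  lnk Za q (h 0) -> lnk Zb q (h tau) -> #|Za| <= m -> #|Zb| <= m ->
  exists a b X Y W, theta a b X Y W /\ #|X| + #|Y| + #|W| < n + m.
Proof.
move=> Hh n3 ot tn qh qk qN qZa qZb hZa hZb Ha Hb La Lb ma mb.
have n2 : 2 < n by slia.
have hA i : adj (h i) (h i.+1) by apply: phole_adjS Hh _.
have hP i : h (i + n) = h i by case: Hh.
pose mult := [exists i : 'I_n, adj q (h i) && (h i != h k)].
have gen r (Z : {set T}) : r < n -> r = 0 \/ r = tau -> q \notin Z -> h r \notin Z ->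
    (forall z i, z \in Z -> h i != h r -> z != h i /\ ~~ adj z (h i)) ->
    lnk Z q (h r) -> #|Z| <= m -> mult = (side q != side (h r)) ->
    exists a b X Y W, theta a b X Y W /\ #|X| + #|Y| + #|W| < n + m.
  move=> rn Er qZ hZ HZ L Zm Em.
  have Hr := phole_shift r Hh.
  have [k' [Hk' Ek']] := phole_rep r k Hh ltac:(slia).
  have rr : r + (k' - r) = k' by slia.
  have [|||||||||||a [b [X [Y [W [H1 H2]]]]]] :=
      @attach_theta _ _ _ adjC bip _ _ q Z (k' - r) Hr n3; rewrite ?addn0 ?rr ?Ek' //.
  - by slia.
  - by apply: qN; case: Er => ->; [left | right; right; left].
  - apply: qN; have : adj (h (r + 1)) (h r) by rewrite addn1 adjC hA.
    by case: Er => ->; [right; left | do 3 right].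
  - apply: qN; have : adj (h (r + n.-1)) (h r).
      by have := hA (r + n.-1); rewrite (_ : (r + n.-1).+1 = r + n) ?hP //; slia.
    by case: Er => ->; [right; left | do 3 right].
  - by move=> z i zZ Hi; apply: HZ => //; rewrite eq_sym; apply: (phole_neq Hh); slia.
  - rewrite -Em /mult; split.
      move=> [j [jn jk qj]]; apply/existsP; have jn' := ltn_pmod (r + j) (_ : 0 < n).
      exists (Ordinal (jn' ltac:(slia))) => /=; rewrite (phole_modn _ Hh) qj /= -Ek'.
      have [lt|ge] := ltnP (r + j) k'; first by apply: (phole_neq Hh); slia.
      by rewrite eq_sym; apply: (phole_neq Hh); slia.
    move=> /existsP[i /andP[qi ik]]; have [j [Hj Ej]] := phole_rep r i Hh ltac:(slia).
    exists (j - r); have -> : r + (j - r) = j by slia.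
    rewrite Ej; split=> //; first by slia.
    by apply: contraNneq ik => E; rewrite -Ej -Ek'; apply/eqP; congr h; slia.
  by exists a, b, X, Y, W; split=> //; slia.
have [E|E] := boolP (mult == (side q != side (h 0))).
  have n0 : 0 < n by slia.
  exact: (gen 0 Za n0 (or_introl erefl) qZa hZa Ha La ma (eqP E)).
apply: (gen tau Zb) => //; first by right.
move: E; rewrite (phole_side bip tau Hh n2) ot.
by move: (mult); clear; case; case: (side q); case: (side (h 0)).
Qed.

Lemma in_setU3 (A B C : {set T}) x :
  (x \in A :|: B :|: C) = [|| x \in A, x \in B | x \in C].
Proof. by rewrite !inE orbA. Qed.

(* A theta cut at the middle edges of its three paths: [r] are the two ends, [w i b] is the
   half of the i-th path starting next to [r b]. *)
Definition ftheta (r : bool -> T) (k : 'I_3 -> nat) (w : 'I_3 -> bool -> nat -> T) : Prop :=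
  [/\ [/\ side (r false) != side (r true), ~~ adj (r false) (r true)
        & forall i b, adj (r b) (w i b 0)],
      forall i b j, j < k i -> adj (w i b j) (w i b j.+1),
      forall i, adj (w i false (k i)) (w i true (k i)),
      forall i i' b b' j j', i != i' -> j <= k i -> j' <= k i' ->
        w i b j != w i' b' j' /\ ~~ adj (w i b j) (w i' b' j')
    & forall i b c j, j <= k i -> w i b j != r c /\ (adj (w i b j) (r c) -> j = 0 /\ b = c)].

Definition body (k : 'I_3 -> nat) (w : 'I_3 -> bool -> nat -> T) i : {set T} :=
  arc (w i false) 0 (k i).+1 :|: arc (w i true) 0 (k i).+1.

Lemma bodyP k w i x : reflect (exists b j, j <= k i /\ x = w i b j) (x \in body k w i).
Proof.
rewrite inE; apply: (iffP orP) => [[] /arcP[j [Hj ->]]|[b [j [Hj ->]]]].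
- by exists false, j; split=> //; slia.
- by exists true, j; split=> //; slia.
- by case: b; [right|left]; apply: mem_arc; slia.
Qed.

Lemma card_body k w i : #|body k w i| <= (k i).+1.*2.
Proof.
rewrite cardsU; have := card_arc (w i false) 0 (k i).+1; have := card_arc (w i true) 0 (k i).+1.
move: #|_| #|_| #|_| => a b c; slia.
Qed.

Definition o1 (i : 'I_3) : 'I_3 := ordS i.
Definition o2 (i : 'I_3) : 'I_3 := ordS (ordS i).

Lemma ord3P (i j : 'I_3) : [\/ j = i, j = o1 i | j = o2 i].
Proof.
have [->|ji] := eqVneq j i; first by constructor 1.
have [->|ji1] := eqVneq j (o1 i); first by constructor 2.
constructor 3; apply/val_inj; move: ji ji1.
by case: i j => [[|[|[|i]]] Hi] // [[|[|[|j]]] Hj].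
Qed.

Lemma ord3_neq (i : 'I_3) : [/\ i != o1 i, i != o2 i & o1 i != o2 i].
Proof. by case: i => [[|[|[|i]]] Hi]. Qed.

Definition tsize (k : 'I_3 -> nat) : nat := \sum_i (k i).+1.*2.

Lemma tsizeE k i : tsize k = (k i).+1.*2 + (k (o1 i)).+1.*2 + (k (o2 i)).+1.*2.
Proof.
rewrite /tsize (bigD1 i) //= (bigD1 (o1 i)) /=; last by have [] := ord3_neq i; rewrite eq_sym.
rewrite (bigD1 (o2 i)) /=; last by have [a b c] := ord3_neq i; rewrite eq_sym b eq_sym c.
rewrite big1 ?addn0 ?addnA // => j; have [->|->|->] := ord3P i j; rewrite ?eqxx ?andbF //.
Qed.

Definition tmin (m : nat) : Prop :=
  forall a b X Y Z, theta a b X Y Z -> m <= #|X| + #|Y| + #|Z|.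

Lemma body_connect r k w i b : ftheta r k w -> lnk (body k w i) (r b) (r (~~ b)).
Proof.
move=> [[_ _ rA] wA wM _ _].
have bd c j : j <= k i -> w i c j \in body k w i by move=> H; apply/bodyP; exists c, j.
have cn c : connect (restr (body k w i)) (w i c 0) (w i c (k i)).
  by apply: seg_connect => // j Hj; [apply: wA|apply: bd; slia].
exists (w i b 0), (w i (~~ b) 0); split; rewrite ?bd //; first by rewrite adjC.
apply: connect_trans (cn b) _; rewrite connect_restrC //.
apply: connect_trans (cn (~~ b)) _; apply: connect1.
by rewrite /restr !bd //; case: b => /=; rewrite ?wM // adjC wM.
Qed.

Lemma body_theta r k w i : ftheta r k w ->
  theta (r false) (r true) (body k w i) (body k w (o1 i)) (body k w (o2 i)).
Proof.
move=> F; have [[sr Nr rA] wA wM wN wr] := F; have [n1 n2 n3] := ord3_neq i.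
split=> //; first by split; apply: body_connect.
  by split=> x y /bodyP[b [j [Hj ->]]] /bodyP[b' [j' [Hj' ->]]]; apply: wN.
have N c : r c \notin body k w i :|: body k w (o1 i) :|: body k w (o2 i).
  apply/negP; rewrite in_setU3.
  by move=> /or3P[] /bodyP[b [j [/wr Hj E]]]; have [] := Hj b c; rewrite E eqxx.
by split.
Qed.

Lemma card_arc_inj (x : nat -> T) lo m : (forall i j, i < j < m -> x (lo + i) != x (lo + j)) ->
  #|arc x lo m| = m.
Proof.
move=> H; rewrite card_imset ?card_ord // => i j E; apply/val_inj => /=.
by have [lt|lt|//] := ltngtP i j; have := ltn_ord i; have := ltn_ord j => aj ai;
  [have := H i j | have := H j i]; rewrite lt ?aj ?ai E eqxx => /(_ isT).
Qed.

(** An induced path through the body that left out a vertex of it would give a smaller theta. So it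
    uses the whole body, and the body has no coincidences. *)
Lemma tmin_ipath r k w i b : ftheta r k w -> tmin (tsize k) ->
  exists x, [/\ ipath adj x (k i).+1.*2.+1, x 0 = r b, x (k i).+1.*2.+1 = r (~~ b),
    forall j, 0 < j <= (k i).+1.*2 -> x j \in body k w i
  & forall y, y \in body k w i -> exists j, 0 < j <= (k i).+1.*2 /\ y = x j].
Proof.
move=> F M; have Th := body_theta i F; have [sr Nr [L0 L1 L2] [N1 N2 N3] [A0 A1]] := Th.
have [[_ _ rA] wA wM wN wr] := F.
have rb c : r c != r (~~ c).
  by case: c => /=; [rewrite eq_sym|]; apply: contraNneq sr => ->.
have Nb c : ~~ adj (r c) (r (~~ c)) by case: c; rewrite // adjC.
have [x [l [l1 x0 xl Hx Xx]]] := lnk_ipath (body_connect i b F) (rb b) (Nb b).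
have sub : arc x 1 l.-1 \subset body k w i.
  by apply/subsetP => _ /arcP[j [Hj ->]]; apply: Xx; slia.
have LY : lnk (arc x 1 l.-1) (r false) (r true).
  have L : lnk (arc x 1 l.-1) (r b) (r (~~ b)).
    have xA j : j < l -> adj (x j) (x j.+1).
      by move=> Hj; have [|_ ->] := Hx j j.+1; rewrite ?eqxx //; slia.
    apply: lnk_arc; first by slia.
    - by move=> j _ Hj; apply: xA; slia.
    - by rewrite -x0; apply: xA; slia.
    - by rewrite -xl; have := xA l.-1; rewrite add1n /= prednK; [apply; slia|slia].
  by case: (b) L => L //; apply: lnkC.
have Th' : theta (r false) (r true) (arc x 1 l.-1) (body k w (o1 i)) (body k w (o2 i)).
  split=> //.
  - by split=> // y z /(subsetP sub); [apply: N1 | apply: N2].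
  - split; [move: A0 | move: A1]; apply: contra; rewrite !in_setU3;
      by move=> /or3P[/(subsetP sub) ->|->|->]; rewrite ?orbT.
have := M _ _ _ _ _ Th'; rewrite (tsizeE k i).
have cx : #|arc x 1 l.-1| = l.-1.
  by apply: card_arc_inj => p q Hpq; have [|-> _] := Hx (1 + p) (1 + q); slia.
have := card_body k w (o1 i); have := card_body k w (o2 i); have := card_body k w i.
rewrite cx => B0 B1 B2 Hm; have cl := subset_leq_card sub; rewrite cx in cl.
have ll : l = (k i).+1.*2.+1 by slia.
exists x; rewrite -ll; split=> //.
  by move=> j Hj; apply: Xx; slia.
have /eqP E : arc x 1 l.-1 == body k w i by rewrite eqEcard sub cx; slia.
by move=> y; rewrite -E => /arcP[j [Hj ->]]; exists j; split=> //; slia.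
Qed.

Definition upd3 (w : 'I_3 -> bool -> nat -> T) i b (u : nat -> T) :=
  fun i' b' => if (i' == i) && (b' == b) then u else w i' b'.

(** If the new walk touched the other two paths, which form a hole, its last contact [q] would be
    linked to both roots through the remainder of the walk and the old halves, and [attach2_theta]
    would give a smaller theta. This exchange is why guessing the ends of the halves suffices. *)
Lemma ftheta_replace r k w i b u : ftheta r k w -> tmin (tsize k) ->
  u 0 = w i b 0 -> u (k i) = w i b (k i) ->
  (forall j, j < k i -> adj (u j) (u j.+1)) ->
  (forall j c, 0 < j <= k i -> ~~ adj (u j) (r c)) ->
  (forall j c i', 0 < j <= k i -> i' != i -> ~~ adj (u j) (w i' c 0)) ->
  ftheta r k (upd3 w i b u).
Proof.
move=> F M u0 uk uA ur us; have [[sr Nr rA] wA wM wN wr] := F.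
have [n1 n2 n3] := ord3_neq i.
have [x [Hx x0 xl xb bx]] := tmin_ipath (o1 i) b F M.
have [y [Hy y0 yl yb by']] := tmin_ipath (o2 i) b F M.
have uroot j c : j <= k i -> u j != r c.
  case: j => [|j] Hj; first by rewrite u0; have [] := wr i b c 0.
  apply: contraTneq (rA (o1 i) c) => <-; apply: us => //; first by rewrite eq_sym.
set B := body k w (o1 i) :|: body k w (o2 i).
have BP z : reflect (exists i' c j, [/\ i' != i, j <= k i' & z = w i' c j]) (z \in B).
  apply: (iffP setUP) => [[] /bodyP[c [j [Hj ->]]]|[i' [c [j [Hi Hj ->]]]]].
  - by exists (o1 i), c, j; rewrite eq_sym.
  - by exists (o2 i), c, j; rewrite eq_sym.
  have [E|E|E] := ord3P i i'; first by rewrite E eqxx in Hi.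
    by left; apply/bodyP; exists c, j; rewrite -E.
  by right; apply/bodyP; exists c, j; rewrite -E.
pose bad v := [exists z in B, (v == z) || adj v z].
have nbad v z : ~~ bad v -> z \in B -> v != z /\ ~~ adj v z.
  move=> H zB; apply/andP; rewrite -negb_or; apply: contra H => H.
  by apply/existsP; exists z; rewrite zB.
have wbad c j : j <= k i -> ~~ bad (w i c j).
  move=> Hj; apply/existsP => -[z /andP[/BP[i' [c' [j' [Hi Hj' ->]]]]]].
  by have [||//|/negbTE -> /negbTE ->] := wN i i' c c' j j'; rewrite 1?eq_sym.
have key j : j <= k i -> ~~ bad (u j).
  move=> Hj; apply/negP => bj.
  pose P j := (j <= k i) && bad (u j).
  have exP : exists j, P j by exists j; rewrite /P Hj.
  have ubP j' : P j' -> j' <= k i by case/andP.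
  case: (ex_maxnP exP ubP) => {}j /andP[{}Hj {}bj] mx {exP ubP}.
  have j0 : 0 < j by case: (j) bj => //; rewrite u0 (negbTE (wbad _ _ _)).
  have jk : j < k i.
    rewrite ltn_neqAle Hj andbT; apply: contraTneq bj => ->; rewrite uk; exact: wbad.
  have after j' : j < j' <= k i -> ~~ bad (u j').
    move=> /andP[jj' Hj']; apply/negP => H; have := mx j'; rewrite /P Hj' H => /(_ isT).
    by slia.
  set q := u j in bj *.
  have qB : q \notin B.
    have [/nbad H] : ~~ bad (u j.+1) by apply: after; slia.
    by apply/negP => /H[_]; rewrite adjC uA.
  have /existsP[z /andP[zB]] := bj; have [zq|_ /= qz] := eqVneq q z; first by rewrite -zq (negbTE qB) in zB.
  have [||||a c Ha Hc|h [Hh hx hy]] := glue adjC Hx Hy; rewrite ?x0 ?y0 ?xl ?yl //.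
    have /xb /bodyP[c1 [j1 [Hj1 ->]]] : 0 < a <= (k (o1 i)).+1.*2 by slia.
    have /yb /bodyP[c2 [j2 [Hj2 ->]]] : 0 < c <= (k (o2 i)).+1.*2 by slia.
    exact: wN.
  set l := (k (o1 i)).+1.*2.+1 in Hx xl Hh hx hy *.
  set m := (k (o2 i)).+1.*2.+1 in Hy yl Hh hx hy *.
  have n0 : 0 < l + m by slia.
  have h0 : h 0 = r b by rewrite hx.
  have hl : h l = r (~~ b) by rewrite hx.
  have hB t : [\/ h t = r b, h t = r (~~ b) | h t \in B].
    rewrite -(phole_modn t Hh); have := ltn_pmod t n0; move: (t %% _) => {}t tn.
    have [tl|lt] := leqP t l.
      rewrite hx //; case: (posnP t) => [->|t0]; first by rewrite x0; constructor 1.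
      have [->|tl'] := eqVneq t l; first by rewrite xl; constructor 2.
      by constructor 3; rewrite inE xb //; slia.
    have -> : t = l + m - (l + m - t) by slia.
    by rewrite hy; [constructor 3; rewrite inE yb ?orbT //; slia | slia].
  have [t ht] : exists t, h t = z.
    case/setUP: zB => [/bx|/by'] [t [Ht ->]]; first by exists t; rewrite hx //; slia.
    by exists (l + m - t); rewrite hy //; slia.
  have n3' : 3 < l + m by slia.
  have ol : odd l by rewrite /l /= odd_double.
  pose Z c := arc u j.+1 (k i - j) :|: arc (w i c) 0 (k i).+1.
  have ZP v c : v \in Z c -> [/\ ~~ bad v, forall c', v != r c' & forall c', adj v (r c') -> c' = c].
    case/setUP => /arcP[j' [Hj' ->]].
      split=> [|c'|c']; first by apply: after; slia.
        by apply: uroot; slia.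
      by rewrite (negbTE (ur _ _ _)) //; slia.
    split=> [|c'|c' A]; first by apply: wbad; slia.
      by have [] := wr i c c' j' ltac:(slia).
    by have [_ /(_ A)[]] := wr i c c' j' ltac:(slia).
  (* At most [k i - j] new and [k i + 1] old vertices remain, with [j > 0]; the total [2 * k i] is
     exactly what the comparison with [tsize k] allows. *)
  have cZ c : #|Z c| <= (k i).*2.
    rewrite cardsU; have := card_arc u j.+1 (k i - j); have := card_arc (w i c) 0 (k i).+1.
    by move: #|_| #|_| #|_| => a1 a2 a3; slia.
  have qZ c : q \notin Z c by apply/negP => /ZP[]; rewrite bj.
  have rZ c c' : r c \notin Z c' by apply/negP => /ZP[_ /(_ c)]; rewrite eqxx.
  have ZH c v t' : v \in Z c -> h t' != r c -> v != h t' /\ ~~ adj v (h t').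
    move=> /ZP[v1 v2 v3]; have root c' : r c' != r c -> v != r c' /\ ~~ adj v (r c').
      by move=> ne; split=> //; apply: contraNN ne => /v3 ->.
    by have [->|->|tB] := hB t'; [exact: root | exact: root | move=> _; exact: nbad].
  have LZ c : lnk (Z c) q (r c).
    have uZ j' : j < j' <= k i -> u j' \in Z c by move=> H; rewrite inE mem_arc //; slia.
    have wZ j' : j' <= k i -> w i c j' \in Z c by move=> H; rewrite inE orbC mem_arc //; slia.
    exists (u j.+1), (w i c 0); split; rewrite ?uZ ?wZ ?uA // 1?adjC //; first by slia.
    apply: (@connect_trans _ _ (u (k i))).
      by apply: seg_connect => [|j' Hj'|j' Hj']; [slia | apply: uA; slia | apply: uZ; slia].
    apply: (@connect_trans _ _ (w i c (k i))); last first.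
      rewrite connect_restrC //.
      by apply: seg_connect => [|j' Hj'|j' Hj']; [slia | apply: wA; slia | apply: wZ; slia].
    have [->|cb] := eqVneq c b; first by rewrite uk.
    apply: connect1; rewrite /restr uZ ?wZ //; last by slia.
    rewrite uk !andbT; case: (c) (b) cb => [] [] // _; rewrite ?wM //.
    by rewrite adjC wM.
  suff [a [c [X [Y [W [Th sz]]]]]] :
      exists a c X Y W, theta a c X Y W /\ #|X| + #|Y| + #|W| < l + m + (k i).*2.
    by have := M _ _ _ _ _ Th; rewrite (tsizeE k i); move: sz; rewrite /l /m; slia.
  have qt : adj q (h t) by rewrite ht.
  have tl : l < l + m by slia.
  apply: (@attach2_theta h _ l q (Z b) (Z (~~ b)) _ t Hh n3' ol tl); rewrite ?h0 ?hl //.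
  - move=> t'; have [->|->|tB] := hB t'; [exact: uroot | exact: uroot |].
    by apply: contraNneq qB => ->.
  - move=> t'; have [->|->|/BP[i' [c [j' [Hi' Hj' ->]]]]] := hB t' => H; try by apply: ur; slia.
    have wrr c' := wr i' c c' j' Hj'.
    have j'0 : j' = 0.
      case: H => [E|[A|[E|A]]].
      * by have [] := wrr b; rewrite E eqxx.
      * by have [_ /(_ A)[]] := wrr b.
      * by have [] := wrr (~~ b); rewrite E eqxx.
      * by have [_ /(_ A)[]] := wrr (~~ b).
    by rewrite j'0; apply: us => //; slia.
  - by move=> v t' /ZH H /H.
  - by move=> v t' /ZH H /H.
have upd0 i' c : upd3 w i b u i' c 0 = w i' c 0.
  by rewrite /upd3; case: andP => [[/eqP -> /eqP ->]|].
have updk i' c : upd3 w i b u i' c (k i') = w i' c (k i').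
  by rewrite /upd3; case: andP => [[/eqP -> /eqP ->]|].
have uN i' c j j' : i' != i -> j <= k i -> j' <= k i' -> u j != w i' c j' /\ ~~ adj (u j) (w i' c j').
  by move=> Hi /key H Hj'; apply: nbad => //; apply/BP; exists i', c, j'.
split.
- by split=> // i' c; rewrite upd0.
- by move=> i' c j; rewrite /upd3; case: andP => [[/eqP -> _]|_]; [exact: uA|exact: wA].
- by move=> i'; rewrite !updk.
- move=> i1 i2 b1 b2 j1 j2 ne H1 H2; rewrite /upd3.
  case: andP => [[/eqP E1 _]|_]; case: andP => [[/eqP E2 _]|_].
  + by rewrite E1 E2 eqxx in ne.
  + by subst i1; apply: uN; rewrite // eq_sym.
  + by subst i2; rewrite eq_sym adjC; apply: uN.
  + exact: wN.
- move=> i' b' c j; rewrite /upd3; case: andP => [[/eqP -> /eqP ->]|_]; last exact: wr.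
  move=> Hj; split; first exact: uroot.
  case: j Hj => [|j] Hj; last by rewrite (negbTE (ur _ _ _)).
  by rewrite u0; have [] := wr i b c 0.
Qed.

Definition free_of (r : bool -> T) (s : 'I_3 -> bool -> T) (i : 'I_3) (v : T) : bool :=
  [forall c, ~~ adj v (r c)] && [forall i', (i' != i) ==> [forall c, ~~ adj v (s i' c)]].

Definition fstep r s i : rel T := fun u v => adj u v && free_of r s i v.

Definition between (r : bool -> T) (s m : 'I_3 -> bool -> T) (k : 'I_3 -> nat) i b v : Prop :=
  exists j1 j2, [/\ j1 + j2 = k i, wkb (fstep r s i) j1 (s i b) v
                  & wkb (fstep r s i) j2 v (m i b)].

(** [between] collects the vertices of all walks of the prescribed length, so the last clause
    separates all candidates for different paths at once and no actual path has to be described. *)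
Definition theta_frame (r : bool -> T) (s m : 'I_3 -> bool -> T) (k : 'I_3 -> nat) : Prop :=
  [/\ ~~ adj (r false) (r true), forall i b, adj (r b) (s i b),
      forall i, adj (m i false) (m i true),
      forall i b, wkb (fstep r s i) (k i) (s i b) (m i b)
    & forall i i' b b' v v', i != i' -> between r s m k i b v -> between r s m k i' b' v' ->
        v != v' /\ ~~ adj v v'].

Lemma theta_frame_sound r s m k : theta_frame r s m k ->
  exists a b X Y Z, theta a b X Y Z.
Proof.
move=> [Nr rs mm W N].
have bE i b v : between r s m k i b v ->
    exists j : 'I_(k i).+1, wkb (fstep r s i) j (s i b) v && wkb (fstep r s i) (k i - j) v (m i b).
  move=> [j1 [j2 [E H1 H2]]]; have Hj : j1 < (k i).+1 by slia.
  by exists (Ordinal Hj); rewrite /= H1 -E addKn.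
pose X i := [set v | [exists b, exists j : 'I_(k i).+1,
   wkb (fstep r s i) j (s i b) v && wkb (fstep r s i) (k i - j) v (m i b)]].
have XP i v : v \in X i -> exists b, between r s m k i b v.
  rewrite inE => /existsP[b /existsP[j /andP[H1 H2]]]; exists b, j, (k i - j); split=> //.
  by have := ltn_ord j; slia.
have inX i b v : between r s m k i b v -> v \in X i.
  by move=> /bE[j H]; rewrite inE; apply/existsP; exists b; apply/existsP; exists j.
have [x xP] : exists x : 'I_3 -> bool -> nat -> T, forall i b,
    [/\ x i b 0 = s i b, x i b (k i) = m i b & forall j, j < k i -> fstep r s i (x i b j) (x i b j.+1)].
  have /fin_all_exists[x H] (ib : 'I_3 * bool) : exists x, [/\ x 0 = s ib.1 ib.2, x (k ib.1) = m ib.1 ib.2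
      & forall j, j < k ib.1 -> fstep r s ib.1 (x j) (x j.+1)].
    exact/wkbP/W.
  by exists (fun i b => x (i, b)) => i b; apply: (H (i, b)).
have xX i b j : j <= k i -> x i b j \in X i.
  move=> Hj; have [x0 xk H] := xP i b; apply: (inX _ b); exists j, (k i - j); split; first by slia.
    by apply/wkbP; exists (x i b); split=> // j' Hj'; apply: H; slia.
  apply/wkbP; exists (fun t => x i b (j + t)); split; rewrite ?addn0 //.
    by rewrite subnKC.
  by move=> t Ht; rewrite addnS; apply: H; slia.
have cn i b : connect (restr (X i)) (s i b) (m i b).
  have [x0 xk H] := xP i b; rewrite -x0 -xk; apply: seg_connect => // j Hj.
    by have /andP[] := H j (ltac:(slia)).
  by apply: xX; slia.
have sX i b : s i b \in X i by have [<- _ _] := xP i b; apply: xX.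
have mX i b : m i b \in X i by have [_ <- _] := xP i b; apply: xX.
have L i : lnk (X i) (r false) (r true).
  exists (s i false), (s i true); split; rewrite // 1?adjC //.
  apply: connect_trans (cn i false) _; rewrite connect_restrC //.
  apply: connect_trans (cn i true) _; apply: connect1.
  by rewrite /restr !mX adjC mm.
have AC i i' : i != i' -> acomp (X i) (X i').
  by move=> ne v v' /XP[b Hb] /XP[b' Hb']; apply: N Hb Hb'.
have rX i c : r c \notin X i.
  apply/negP => H; have [n1 _ _] := ord3_neq i.
  by have [_] := AC i (o1 i) n1 _ (s (o1 i) c) H (sX _ _); rewrite rs.
have [n1 n2 n3] := ord3_neq ord0.
exists (r false), (r true), (X ord0), (X (o1 ord0)), (X (o2 ord0)); split=> //.
(* The two halves of a path have the same length, so the adjacency of the middle vertices forces the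
   roots to opposite sides. *)
- have sm b : side (m ord0 b) = side (r b) (+) ~~ odd (k ord0).
    have [x0 xk H] := xP ord0 b.
    have := @side_walk _ adj side bip (x ord0 b) (k ord0) _ (k ord0) (leqnn _).
    rewrite x0 xk => ->; last by move=> j /H /andP[].
    by have := bip (rs ord0 b); case: (side (r b)); case: (side (s _ b)); case: (odd _).
  have := bip (mm ord0); rewrite !sm; case: (side (r false)); case: (side (r true)); by case: (odd _).
- by split; apply: AC.
- by split; rewrite in_setU3 !(negbTE (rX _ _)).
Qed.

Lemma theta_ftheta a b X Y Z : theta a b X Y Z ->
  exists r k w, ftheta r k w /\ tsize k <= #|X| + #|Y| + #|Z|.
Proof.
move=> [sab Nab [LX LY LZ] [XY XZ YZ] [aN bN]].
have ab : a != b by apply: contraNneq sab => ->.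
pose S (i : 'I_3) := if val i is j.+1 then (if j is _.+1 then Z else Y) else X.
have LS i : lnk (S i) a b by case: i => [[|[|[|i]]] Hi].
have SN i i' : i != i' -> acomp (S i) (S i').
  by case: i i' => [[|[|[|i]]] Hi] // [[|[|[|i']]] Hi'] // _; rewrite /S /=; try exact: acompC.
have /fin_all_exists[x Hx] i : exists x, exists l, [/\ 1 < l, x 0 = a, x l = b, ipath adj x l
    & forall j, 0 < j < l -> x j \in S i].
  exact: lnk_ipath (LS i) ab Nab.
have /fin_all_exists[l Hl] i := Hx i.
have par i : exists k, l i = k.*2.+3.
  have [l1 x0 xl Hi _] := Hl i; have := ipath_side bip Hi (leqnn _).
  rewrite x0 xl => E; have ol : odd (l i) by move: sab; rewrite E; case: (side a); case: (odd _).
  exists ((l i) - 3)./2; have : l i != 1.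
    apply: contraNneq Nab => l1'; have [|_] := Hi 0 1; first by rewrite l1'.
    by rewrite x0 -[in x i 1]l1' xl => ->.
  by slia.
have /fin_all_exists[k kE] i := par i.
pose r (c : bool) := if c then b else a.
pose w i (c : bool) j := if c then x i (l i - j.+1) else x i j.+1.
have wS i c j : j <= k i -> w i c j \in S i.
  by have [_ _ _ _ H] := Hl i; have := kE i; rewrite /w; case: c => E Hj; apply: H; slia.
have wadj i : forall p q, p < q <= l i -> adj (x i p) (x i q) = (q == p.+1).
  by move=> p q pq; have [_ _ _ Hi _] := Hl i; have [] := Hi p q.
have wneq i : forall p q, p < q <= l i -> x i p != x i q.
  by move=> p q pq; have [_ _ _ Hi _] := Hl i; have [] := Hi p q.
have x0 i : x i 0 = a by have [] := Hl i.
have xl i : x i (l i) = b by have [] := Hl i.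
exists r, k, w; split; last first.
  have cS i : (k i).+1.*2 <= #|S i|.
    have [_ _ _ _ H] := Hl i; have E := kE i.
    rewrite -(@card_arc_inj (x i) 1 (k i).+1.*2).
      by apply/subset_leq_card/subsetP => _ /arcP[j [Hj ->]]; apply: H; slia.
    by move=> p q pq; apply: wneq; slia.
  rewrite (tsizeE k ord0); have := cS ord0; have := cS (o1 ord0); have := cS (o2 ord0).
  by rewrite /S /=; slia.
split.
- split=> // i [] /=; rewrite /w -?(x0 i) -?(xl i).
    by rewrite adjC wadj; have := kE i; slia.
  by rewrite wadj ?eqxx //; have := kE i; slia.
- move=> i c j Hj; have E := kE i; rewrite /w; case: c; last by rewrite wadj //; slia.
  by rewrite adjC wadj; slia.
- by move=> i; have E := kE i; rewrite /w wadj; slia.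
- by move=> i i' c c' j j' ne Hj Hj'; apply: (SN i i'); rewrite ?wS.
- move=> i c c' j Hj; have E := kE i; rewrite /r /w; case: c; case: c'; rewrite -?(x0 i) -?(xl i).
  + by rewrite wadj ?wneq; try slia; split=> // /eqP; slia.
  + by rewrite adjC eq_sym wadj ?wneq; try slia; split=> // /eqP; slia.
  + by rewrite wadj ?wneq; try slia; split=> // /eqP; slia.
  + by rewrite adjC eq_sym wadj ?wneq; try slia; split=> // /eqP [->]; slia.
Qed.

(** The negative form lets the proof pass to a smallest theta: a smaller one already gives the
    contradiction by induction. In a smallest theta the separation clause holds because halves may
    be exchanged freely. *)
Lemma theta_frame_complete a b X Y Z : theta a b X Y Z ->
  (forall r s m k, (forall i, k i < #|T|) -> ~ theta_frame r s m k) -> False.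
Proof.
move=> Th H; have [N] := ubnP (#|X| + #|Y| + #|Z|); elim: N a b X Y Z Th => // N IH a b X Y Z Th sz.
have [r [k [w [F tk]]]] := theta_ftheta Th.
have M : tmin (tsize k).
  move=> a' b' X' Y' Z' Th'; rewrite leqNgt; apply/negP => lt.
  by apply: IH Th' _; slia.
apply: (H r (fun i c => w i c 0) (fun i c => w i c (k i)) k).
  move=> i; have [x [Hx _ _ _ _]] := tmin_ipath i false F M.
  have := max_card (mem (arc x 0 (k i).+1)); rewrite card_arc_inj //.
  by move=> p q pq; have [] := Hx (0 + p) (0 + q) ltac:(slia).
have [[sr Nr rA] wA wM wN wr] := F.
have fr i c j : 0 < j <= k i -> free_of r (fun i c => w i c 0) i (w i c j).
  move=> Hj; apply/andP; split; apply/forallP => c'.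
    by apply/negP => A; have [_ /(_ A)[]] := wr i c c' j ltac:(slia); slia.
  by apply/implyP => ne; apply/forallP => d; have [] := wN i c' c d j 0; rewrite // 1?eq_sym //; slia.
split=> // [i c|i i' c c' v v' ne].
  apply/wkbP; exists (w i c); split=> // j Hj; rewrite /fstep wA //.
  by apply: fr; slia.
have btw i0 c0 v0 : between r (fun i c => w i c 0) (fun i c => w i c (k i)) k i0 c0 v0 ->
    exists u j, [/\ j <= k i0, v0 = u j, u 0 = w i0 c0 0, u (k i0) = w i0 c0 (k i0)
      & forall j', j' < k i0 -> fstep r (fun i c => w i c 0) i0 (u j') (u j'.+1)].
  move=> [j1 [j2 [E /wkbP[x [x0 xj Hx]] /wkbP[y [y0 yj Hy]]]]].
  exists (fun t => if t <= j1 then x t else y (t - j1)), j1; rewrite leqnn xj; split=> //; first by slia.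
    rewrite -yj; case: leqP => C; last by congr y; slia.
    have E1 : k i0 = j1 by slia.
    by rewrite E1 xj -y0; congr y; slia.
  move=> j' Hj'; case: (ltnP j' j1) => C; first by rewrite (ltnW C); apply: Hx.
  rewrite (subSn C); case: leqP => C'; last by apply: Hy; slia.
  have -> : j' = j1 by slia.
  by rewrite xj subnn -y0; apply: Hy; slia.
move=> /btw[u [j [Hj -> u0 uk uS]]] /btw[u' [j' [Hj' -> u0' uk' uS']]].
have rep i0 c0 w0 u1 : ftheta r k w0 -> (forall i c, w0 i c 0 = w i c 0) ->
    (forall i c, w0 i c (k i) = w i c (k i)) -> u1 0 = w i0 c0 0 -> u1 (k i0) = w i0 c0 (k i0) ->
    (forall j', j' < k i0 -> fstep r (fun i c => w i c 0) i0 (u1 j') (u1 j'.+1)) ->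
    ftheta r k (upd3 w0 i0 c0 u1).
  move=> F0 E0 Ek v0 vk vS; apply: ftheta_replace => //; rewrite ?E0 ?Ek //.
  - by move=> t /vS /andP[].
  - by case=> // t d Ht; have /andP[_ /andP[/forallP]] := vS t ltac:(slia).
  - case=> // t d i1 Ht ne1; have /andP[_ /andP[_ /forallP /(_ i1)]] := vS t ltac:(slia).
    by rewrite ne1 E0 => /forallP.
(* Exchanging both halves, one after the other, places [u j] and [u' j'] on different paths of a
   single theta. *)
have F1 := rep i c w u F (fun _ _ => erefl) (fun _ _ => erefl) u0 uk uS.
have F2 : ftheta r k (upd3 (upd3 w i c u) i' c' u').
  apply: rep => // i1 c1; rewrite /upd3; by case: andP => [[/eqP -> /eqP ->]|].
have [_ _ _ N2 _] := F2; have := N2 i i' c c' j j' ne Hj Hj'.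
by rewrite /upd3 !eqxx /= (negbTE ne).
Qed.

End Detect.

(** * Detecting tents *)

Section Tents.
Variables (T : finType) (adj : rel T) (side : T -> bool).
Hypothesis adjC : symmetric adj.
Hypothesis bip : forall x y, adj x y -> side x != side y.

Notation ipath := (ipath adj).
Notation phole := (phole adj).
Notation theta := (theta adj side).
Notation lnk := (lnk adj).
Notation restr := (restr adj).
Notation acomp := (acomp adj).
Notation unb := (unb adj).

Lemma ipath_cons y l a : ipath y l -> adj a (y 0) ->
  (forall i, i <= l -> a != y i) -> (forall i, 0 < i <= l -> ~~ adj a (y i)) ->
  ipath (fun i => if i is j.+1 then y j else a) l.+1.
Proof.
move=> Hy A N NA [|i] [|j] //= ij; last by apply: Hy; slia.
by rewrite N //; split=> //; case: j ij => [|j] ij; rewrite ?A ?(negbTE (NA _ _)).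
Qed.

Lemma ipath_ends y l a b : ipath y l -> a != b -> ~~ adj a b -> adj a (y 0) -> adj (y l) b ->
  (forall i, i <= l -> a != y i /\ b != y i) ->
  (forall i, 0 < i <= l -> ~~ adj a (y i)) -> (forall i, i < l -> ~~ adj b (y i)) ->
  exists x, [/\ ipath x l.+2, x 0 = a, x l.+2 = b & forall i, i <= l -> x i.+1 = y i].
Proof.
move=> Hy ab Nab A0 Al N Na Nb.
have H1 : ipath (fun i => if i is j.+1 then y j else a) l.+1.
  by apply: ipath_cons => // i /N[].
have H2 := ipath_rev adjC H1.
have H3 : ipath (fun i => if i is j.+1 then (fun i => (if l.+1 - i is j.+1 then y j else a)) j else b) l.+2.
  apply: ipath_cons => //.
  - by rewrite subn0 adjC.
  - move=> i Hi; case E : (l.+1 - i) => [|j]; first by rewrite eq_sym.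
    by have [] := N j ltac:(slia).
  - move=> i Hi; case E : (l.+1 - i) => [|j]; first by rewrite adjC.
    by apply: Nb; slia.
have H4 := ipath_rev adjC H3; eexists; split; [exact: H4 | | |].
- by move=> /=; rewrite ?subn0 ?subnn.
- by move=> /=; rewrite subnn.
- move=> i Hi /=; have -> : l.+2 - i.+1 = (l - i).+1 by slia.
  by have -> : l.+1 - (l - i) = i.+1 by slia.
Qed.

Definition cstep (F : pred T) : rel T := fun u v => [&& adj u v, F u & F v].
Definition comp (F : pred T) r v : bool := F r && connect (cstep F) r v.
(** [K] is meant to be the component of [r]; then this describes an arc of the hole from [a] to [b]
    without naming its inner vertices. *)
Definition half a b r (K : pred T) : bool := adj a b || (adj a r && [exists v, K v && adj v b]).

Lemma comp_self (F : pred T) r : F r -> comp F r r.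
Proof. by rewrite /comp => ->; apply: connect0. Qed.

Lemma comp_F (F : pred T) r v : comp F r v -> F v.
Proof.
rewrite /comp => /andP[Fr /connectP[p Hp ->]].
by elim: p r Fr Hp => //= u p IH r Fr /andP[/and3P[_ _ Fu] /IH ->].
Qed.

Lemma comp_step (F : pred T) r u v : comp F r u -> adj u v -> F v -> comp F r v.
Proof.
move=> Hu A Fv; have Fu := comp_F Hu; have /andP[Fr C] := Hu; rewrite /comp Fr.
by apply: connect_trans C (connect1 _); rewrite /cstep A Fu.
Qed.

Lemma comp_connect F r v : comp F r v -> connect (restr [set u | comp F r u]) r v.
Proof.
move=> /andP[Fr /connectP[p Hp ->]].
suff H s : comp F r s -> path (cstep F) s p -> connect (restr [set u | comp F r u]) s (last s p).
  by apply: H Hp; apply: comp_self.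
elim: p s {Hp} => //= u p IH s Hs /andP[/and3P[A Fs Fu] Hp].
have Hu := comp_step Hs A Fu.
by apply: connect_trans (IH _ Hu Hp); apply: connect1; rewrite /restr A !inE Hs.
Qed.

Lemma half_ipath a b r F : half a b r (comp F r) -> a != b ->
  exists y l, [/\ 0 < l, ipath y l, y 0 = a, y l = b & forall i, 0 < i < l -> comp F r (y i)].
Proof.
move=> H ab; have [x [l [l0 x0 xl [A W]]]] : exists x l, [/\ 0 < l, x 0 = a, x l = b & walk adj (comp F r) x l].
  case/orP: H => [A|/andP[A /existsP[v /andP[Kv B]]]].
    by exists (fun i => if i is 0 then a else b), 1; split=> //; split=> -[].
  have L : lnk [set u | comp F r u] a b.
    exists r, v; split; rewrite ?inE //; last exact: comp_connect.
    by apply: comp_self; case/andP: Kv.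
  have [x [l [l1 x0 xl [H1 H2]]]] := lnk_walk L.
  by exists x, l; split=> //; [slia | split=> // i Hi; have := H2 i Hi; rewrite inE].
have [|y [m [ml y0 ym Hy [_ H2]]]] := walk_ipath (conj A W); first by rewrite x0 xl.
exists y, m; split; rewrite ?y0 ?ym //.
by case: (m) ym => // E; move: ab; rewrite -x0 -xl -y0 E eqxx.
Qed.

Section Frame.
Variables (p1 p2 c1 c2 a1 b1 r1 a2 b2 r2 : T).

(** [p1] and [p2] are adjacent clones of the hole vertices [c1] and [c2]; [a1], [a2] are the
    neighbours of [c1] on the hole and [b1], [b2] those of [c2]. The interior of the arc from [a1]
    to [b1] is searched within [tentF1], that of the other arc within [tentF2], away from everything
    the first search can reach. *)
Definition tentF1 : pred T := fun v =>
  ~~ [|| adj v p1, adj v p2, adj v c1, adj v c2, adj v a2 | adj v b2].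
Definition tentX1 : pred T := fun v => [|| v == a1, v == b1 | comp tentF1 r1 v].
Definition tentF2 : pred T := fun v =>
  ~~ [|| adj v p1, adj v p2, adj v c1 | adj v c2] &&
  [forall u, tentX1 u ==> (u != v) && ~~ adj u v].

Definition tent_frame : bool :=
  [&& adj p1 p2, [&& adj p1 a1, adj p1 a2, adj c1 a1 & adj c1 a2],
      [&& adj p2 b1, adj p2 b2, adj c2 b1 & adj c2 b2],
      [&& ~~ adj c1 c2, ~~ adj c1 p2 & ~~ adj p1 c2],
      half a1 b1 r1 (comp tentF1 r1), half a2 b2 r2 (comp tentF2 r2)
    & [forall u, tentX1 u ==> [&& u != a2, u != b2, ~~ adj u a2 & ~~ adj u b2]]].

(** The arcs have odd lengths [l] and [m]. There are holes of lengths [l + 3] and [m + 3] through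
    the edge [p1 p2] and one of length [l + m + 4] through [c1] and [c2]. If neither [l] nor [m] is
    3 modulo 4, the last length is 2 modulo 4. *)
Lemma tent_frame_sound : tent_frame -> unb.
Proof.
case/and5P=> p12 /and4P[p1a1 p1a2 c1a1 c1a2] /and4P[p2b1 p2b2 c2b1 c2b2] /and3P[Nc Ncp Npc].
case/and3P=> H1 H2 /forallP H3.
have sd u v : adj u v -> side u = ~~ side v.
  by move=> /bip; case: (side u); case: (side v).
have sne u v : side u != side v -> u != v by apply: contraNneq => ->.
have snadj u v : side u = side v -> ~~ adj u v.
  by move=> E; apply/negP => /bip; rewrite E eqxx.
have X1a v : tentX1 v -> [/\ v != a2, v != b2, ~~ adj v a2 & ~~ adj v b2].
  by move=> Hv; have := H3 v; rewrite Hv => /and4P.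
have a1X : tentX1 a1 by rewrite /tentX1 eqxx.
have b1X : tentX1 b1 by rewrite /tentX1 eqxx orbT.
have sp2 := sd _ _ p12; have sa1 := sd _ _ p1a1; have sa2 := sd _ _ p1a2.
have sc1 := sd _ _ c1a1; have sb1 := sd _ _ p2b1; have sb2 := sd _ _ p2b2; have sc2 := sd _ _ c2b1.
have ab1 : a1 != b1 by apply: sne; move: sp2 sa1 sb1; case: (side p1); case: (side p2); case: (side a1); case: (side b1).
have ab2 : a2 != b2 by apply: sne; move: sp2 sa2 sb2; case: (side p1); case: (side p2); case: (side a2); case: (side b2).
have [y [l [l0 Hy y0 yl yK]]] := half_ipath H1 ab1.
have [z [m [m0 Hz z0 zm zK]]] := half_ipath H2 ab2.
have yX i : i <= l -> tentX1 (y i).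
  move=> il; have [->|i0] := posnP i; first by rewrite y0.
  have [->|il'] := eqVneq i l; first by rewrite yl.
  by rewrite /tentX1 yK ?orbT //; slia.
have ol : odd l.
  have := ipath_side bip Hy (leqnn l); rewrite y0 yl; move: sp2 sa1 sb1.
  by case: (odd l); case: (side p1); case: (side p2); case: (side a1); case: (side b1).
have om : odd m.
  have := ipath_side bip Hz (leqnn m); rewrite z0 zm; move: sp2 sa2 sb2.
  by case: (odd m); case: (side p1); case: (side p2); case: (side a2); case: (side b2).
have yz i j : i <= l -> j <= m -> y i != z j /\ ~~ adj (y i) (z j).
  move=> /yX Hi Hj; have [N1 N2 N3 N4] := X1a _ Hi; have [->|j0] := posnP j; first by rewrite z0.
  have [->|jm] := eqVneq j m; first by rewrite zm.
  have /comp_F/andP[_ /forallP/(_ (y i))] := zK j ltac:(slia).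
  by rewrite Hi => /andP.
have yF i : 0 < i < l -> [/\ ~~ adj (y i) p1, ~~ adj (y i) p2, ~~ adj (y i) c1 & ~~ adj (y i) c2].
  by move=> /yK/comp_F; rewrite /tentF1 !negb_or => /and5P[-> -> -> -> _].
have zF i : 0 < i < m -> [/\ ~~ adj (z i) p1, ~~ adj (z i) p2, ~~ adj (z i) c1 & ~~ adj (z i) c2].
  by move=> /zK/comp_F/andP[]; rewrite !negb_or => /and4P[-> -> -> ->].
have big w k a b : ipath w k -> 0 < k -> w 0 = a -> w k = b -> adj p1 a -> adj p2 b -> k %% 4 = 3 ->
    (forall i, 0 < i < k -> ~~ adj (w i) p1 /\ ~~ adj (w i) p2) ->
    (forall i, i <= k -> p1 != w i /\ p2 != w i) -> unb.
  move=> Hw k0 w0 wk A B k3 N N'.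
  have Hx : ipath (fun i => if i is j.+1 then (if j is j'.+1 then (if j' is _.+1 then b else p2) else p1) else a) 3.
    have aw := N' 0 isT; have bw := N' k (leqnn k); rewrite w0 in aw; rewrite wk in bw.
    have [|wab Nab] := Hw 0 k; first by slia.
    rewrite w0 wk in wab Nab.
    have k1 : (k == 1) = false by slia.
    have S1 := sd _ _ A; have S2 := sd _ _ B.
    have N1 : ~~ adj a p2 by apply: snadj; rewrite -[side a]negbK -S1 sp2 negbK.
    have N2 : ~~ adj p1 b by apply: snadj; rewrite sp2 S2 negbK.
    case: aw => q1 q2; case: bw => q3 q4.
    have Epp : p1 != p2 by apply: sne; rewrite sp2; case: (side p2).
    move=> [|[|[|[|i]]]] [|[|[|[|j]]]] //= ij; first
      [ by rewrite ?Nab ?k1 ?(negbTE N1) ?(negbTE N2) ?p12 ?B ?(adjC a p1) ?A ?wab ?q3 ?q4 ?Epp // 1?eq_sym ?q1 ?q2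
      | by slia ].
  have [||||i j Hi Hj|x [Hh _ _]] := glue adjC Hw Hx; rewrite ?w0 //; first by slia.
    have [N1 N2] := N i Hi; have [N3 N4] := N' i ltac:(slia).
    by case: j Hj => [|[|[|j]]] //= _; rewrite eq_sym.
  by exists (k + 3), x; split=> //; slia.
have p1N i : i <= l -> p1 != y i /\ p2 != y i.
  move=> /yX/X1a[_ _ N3 N4]; split; [apply: contraTneq p1a2 | apply: contraTneq p2b2] => ->; done.
have p1N' i : i <= m -> p1 != z i /\ p2 != z i.
  move=> Hi; split.
    by apply: contraTneq p1a1 => ->; have [_] := yz 0 i isT Hi; rewrite y0 adjC.
  by apply: contraTneq p2b1 => ->; have [_] := yz l i (leqnn l) Hi; rewrite yl adjC.
have [l3|l3] := eqVneq (l %% 4) 3.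
  by apply: (big y l a1 b1) => // i /yF[].
have [m3|m3] := eqVneq (m %% 4) 3.
  by apply: (big z m a2 b2) => // i /zF[].
have cc : c1 != c2 by apply: sne; rewrite sc1 sc2; move: sp2 sa1 sb1; case: (side p1); case: (side p2); case: (side a1); case: (side b1).
have Nb w k a b : w 0 = a -> w k = b -> adj p1 a -> adj p2 b ->
   (forall i, 0 < i < k -> ~~ adj (w i) c1 /\ ~~ adj (w i) c2) ->
   (forall i, 0 < i <= k -> ~~ adj c1 (w i)) /\ (forall i, i < k -> ~~ adj c2 (w i)).
  move=> w0 wk A B H; have S1 := sd _ _ A; have S2 := sd _ _ B; split=> i Hi.
    have [->|ik] := eqVneq i k; last by rewrite adjC; have [] := H i ltac:(slia).
    rewrite wk; apply: snadj; rewrite sc1; move: sp2 sa1 S2.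
    by case: (side p1); case: (side p2); case: (side a1); case: (side b).
  have [->|i0] := posnP i; last by rewrite adjC; have [] := H i ltac:(slia).
  rewrite w0; apply: snadj; rewrite sc2; move: sp2 sb1 S1.
  by case: (side p1); case: (side p2); case: (side b1); case: (side a).
have [N1 N2] : (forall i, 0 < i <= l -> ~~ adj c1 (y i)) /\ (forall i, i < l -> ~~ adj c2 (y i)).
  by apply: (Nb y l a1 b1) => // i /yF[].
have [N3 N4] : (forall i, 0 < i <= m -> ~~ adj c1 (z i)) /\ (forall i, i < m -> ~~ adj c2 (z i)).
  by apply: (Nb z m a2 b2) => // i /zF[].
have [|||||x [Hx x0 xl xy]] := @ipath_ends y l c1 c2 Hy cc Nc; rewrite ?y0 ?yl // 1?adjC //.
  move=> i /yX/X1a[_ _ M3 M4]; split; [apply: contraTneq c1a2 | apply: contraTneq c2b2] => ->; done.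
have [|||||x' [Hx' x0' xm' xz]] := @ipath_ends z m c1 c2 Hz cc Nc; rewrite ?z0 ?zm // 1?adjC //.
  move=> i Hi; split.
    by apply: contraTneq c1a1 => ->; have [_] := yz 0 i isT Hi; rewrite y0 adjC.
  by apply: contraTneq c2b1 => ->; have [_] := yz l i (leqnn l) Hi; rewrite yl adjC.
have [||||i j Hi Hj|h [Hh _ _]] := glue adjC Hx Hx'; rewrite ?x0 ?xl //.
  have -> : i = i.-1.+1 by slia.
  have -> : j = j.-1.+1 by slia.
  by rewrite xy ?xz; try slia; apply: yz; slia.
by exists (l.+2 + m.+2), h; split=> //; slia.
Qed.

End Frame.

Definition theta_free : Prop := forall a b X Y Z, ~ theta a b X Y Z.

Lemma tent_complete c n x y f : phole c n -> 5 < n -> theta_free -> odd f -> 3 <= f <= n - 3 ->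
  (forall j, j < n -> adj x (c j) = (j == 1) || (j == n.-1)) ->
  (forall j, j < n -> adj y (c j) = (j == f.-1) || (j == f.+1)) ->
  (forall j, x != c j) -> (forall j, y != c j) -> adj x y ->
  exists r1 r2, tent_frame x y (c 0) (c f) (c 1) (c f.-1) r1 (c n.-1) (c f.+1) r2.
Proof.
move=> Hc n5 TF oddf fn sxE syE xN yN xy.
have ev := phole_even bip Hc ltac:(slia).
have cA j : adj (c j) (c j.+1) by apply: phole_adjS Hc _; slia.
have cadj i j : i < j < n -> adj (c i) (c j) = (j == i.+1) || (j.+1 == i + n).
  by move=> ij; rewrite (phole_adj Hc) //; slia.
have caj i j : i < n -> j < n -> i != j ->
    adj (c i) (c j) = [|| j == i.+1, i == j.+1, j.+1 == i + n | i.+1 == j + n].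
  move=> i_n jn; have [ij|ij|//] := ltngtP i j => _; first by rewrite cadj; slia.
  by rewrite adjC cadj; slia.
have cneq i j : i < j < n -> c i != c j by move=> ij; apply: (phole_neq Hc); slia.
(* For [f = 3] the arc is the edge from [c 1] to [c 2] and has no interior; the dummy root [x] is
   not in [F1], so its component is empty. The same device serves the other arc. *)
pose r1 := if f == 3 then x else c 2.
pose r2 := if n - f == 3 then x else c n.-2.
set F1 := tentF1 x y (c 0) (c f) (c n.-1) (c f.+1).
have F1P v : F1 v -> [/\ [/\ ~~ adj v x, ~~ adj v y, ~~ adj v (c 0) & ~~ adj v (c f)],
    ~~ adj v (c n.-1), ~~ adj v (c f.+1), v != x & v != y].
  rewrite /F1 /tentF1 !negb_or => /and5P[-> -> -> -> /andP[N1 N2]]; split=> //.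
    by apply: contraNneq N1 => ->; rewrite sxE ?eqxx ?orbT //; slia.
  by apply: contraNneq N2 => ->; rewrite syE ?eqxx ?orbT //; slia.
have F1c j : 2 <= j <= f - 2 -> F1 (c j).
  move=> Hj; rewrite /F1 /tentF1 (adjC _ x) (adjC _ y) sxE ?syE ?caj; slia.
pose A2 := arc c f.+1 (n - f.+1).
pose bad v := [exists z in A2, (v == z) || adj v z].
have nbad v z : ~~ bad v -> z \in A2 -> v != z /\ ~~ adj v z.
  move=> H zB; apply/andP; rewrite -negb_or; apply: contra H => H.
  by apply/existsP; exists z; rewrite zB.
have cbad j : 0 < j < f -> ~~ bad (c j).
  move=> Hj; apply/existsP => -[z /andP[/arcP[i [Hi ->]]]].
  by rewrite (negbTE (cneq _ _ _)) ?cadj; slia.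
(* A first vertex of the component touching the other arc would be attached to the hole formed by
   [x], [y] and that arc. Through the component it is linked to [x] by [c 1] and to [y] by the rest
   of the first arc, so a theta appears. *)
have key v : comp F1 r1 v -> ~~ bad v.
  move=> Cv; have f3 : f != 3.
    apply: contraTneq Cv => f3; rewrite /r1 f3 eqxx /comp; have [H|//] := boolP (F1 x).
    by have [_ _ _] := F1P _ H; rewrite eqxx.
  have r1E : r1 = c 2 by rewrite /r1 (negbTE f3).
  apply/negP => bv; move: Cv; rewrite r1E => /andP[Fr /connect_wkb[l _ /wkbP[z [z0 zl Hz]]]].
  pose P j := (j <= l) && bad (z j).
  have exP : exists j, P j by exists l; rewrite /P leqnn zl.
  case: (ex_minnP exP) => t /andP[tl bt] mn {exP}.
  have before j : j < t -> ~~ bad (z j).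
    move=> jt; apply/negP => H; have := mn j; rewrite /P H; slia.
  have t0 : 0 < t by case: (t) bt => //; rewrite z0 (negbTE (cbad _ _)) //; slia.
  have zF j : j <= l -> F1 (z j).
    by case: j => [|j] Hj; [rewrite z0 | have /and3P[] := Hz j Hj].
  have zA j : j < l -> adj (z j) (z j.+1) by move=> /Hz /and3P[].
  set q := z t in bt *; have qF : F1 q by apply: zF.
  have [[qx qy q0 qf] qn qf1 qnx qny] := F1P _ qF.
  have /existsP[w /andP[wA]] := bt; have [qw|_ /= qw] := eqVneq q w.
    have [_] := nbad _ w (before t.-1 ltac:(slia)) wA.
    by rewrite -qw; have := zA t.-1 ltac:(slia); rewrite prednK // => ->.
  have H1 : ipath (fun i => if i is j.+1 then (if j is _.+1 then c f.+1 else y) else x) 2.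
    apply: ipath2 => //; try by rewrite ?sxE ?syE; slia.
    by apply: contraTneq xy => ->; apply: (side_irr bip).
  have H2 : ipath (fun i => if i is j.+1 then c (n.-1 - j) else x) (n - f.+2).+1.
    apply: (@ipath_cons (fun j => c (n.-1 - j))); last first.
    - by move=> i Hi; rewrite sxE; slia.
    - by [].
    - by rewrite subn0 sxE; slia.
    move=> i j ij; have [|N A] := (proj2 Hc) (n.-1 - j) (n.-1 - i); first by slia.
    by rewrite adjC A eq_sym N; split=> //; slia.
  have [||||i j Hi Hj|h [Hh hx hy]] := glue adjC H1 H2; rewrite //; try slia.
  - by congr c; slia.
  - case: i Hi => [|[|i]] // _; case: j Hj => // j Hj.
    by rewrite yN syE; slia.
  have n3 : 3 < 2 + (n - f.+2).+1 by slia.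
  have h0 : h 0 = x by rewrite hx.
  have h1 : h 1 = y by rewrite hx.
  have hB i : [\/ h i = x, h i = y | exists j, f < j < n /\ h i = c j].
    rewrite -(phole_modn i Hh); have := ltn_pmod i (_ : 0 < 2 + (n - f.+2).+1).
    move=> /(_ isT); move: (i %% _) => [|[|{}i]] Hi; first by rewrite h0; constructor 1.
      by rewrite h1; constructor 2.
    constructor 3; exists (n.-1 - (n - f.+2 - i)); split; first by slia.
    have -> : i.+2 = 2 + (n - f.+2).+1 - ((n - f.+2 - i).+1) by slia.
    by rewrite hy //; slia.
  have [k hk] : exists k, h k = w.
    have /arcP[j [Hj ->]] := wA; exists (2 + (n - f.+2).+1 - (n.-1 - j).+1).
    by rewrite hy; [congr c; slia | slia].
  pose W := arc z 0 t.
  have WP v' : v' \in W -> [/\ ~~ bad v', ~~ adj v' x, ~~ adj v' y, v' != x & v' != y].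
    move=> /arcP[j [Hj ->]]; have [|[]] := F1P (z j); first by apply: zF; slia.
    by move=> -> -> _ _ _ _ -> ->; split=> //; apply: before; slia.
  pose Za := W :|: arc c 1 1; pose Zb := W :|: arc c 2 (f - 2).
  have cP j : 0 < j < f -> [/\ ~~ bad (c j), c j != x & c j != y].
    by move=> Hj; rewrite ![c j == _]eq_sym xN yN; split=> //; apply: cbad; slia.
  have ZaP v' : v' \in Za -> [/\ ~~ bad v', v' != x, v' != y & ~~ adj v' y].
    case/setUP => [/WP[] //|/arcP[j [Hj ->]]]; have [] := cP j ltac:(slia).
    by move=> -> -> ->; split=> //; rewrite adjC syE; slia.
  have ZbP v' : v' \in Zb -> [/\ ~~ bad v', v' != x, v' != y & ~~ adj v' x].
    case/setUP => [/WP[] //|/arcP[j [Hj ->]]]; have [] := cP j ltac:(slia).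
    by move=> -> -> ->; split=> //; rewrite adjC sxE; slia.
  have inA2 j : f < j < n -> c j \in A2 by move=> H; apply: mem_arc; slia.
  have cnW (Z : {set T}) : W \subset Z -> connect (restr Z) (z t.-1) (z 0).
    move=> sZ; rewrite connect_restrC //; apply: seg_connect => // j Hj; first by apply: zA; slia.
    by apply: (subsetP sZ); apply: mem_arc; slia.
  suff [a [b [X [Y [Z [Th _]]]]]] : exists a b X Y Z, theta a b X Y Z /\
      #|X| + #|Y| + #|Z| < 2 + (n - f.+2).+1 + maxn #|Za| #|Zb| by exact: TF Th.
  have qk : adj q (h k) by rewrite hk.
  have t1 : 1 < 2 + (n - f.+2).+1 by [].
  apply: (@attach2_theta _ _ _ adjC bip h _ 1 q Za Zb _ k Hh n3 isT t1 _ qk); rewrite ?h0 ?h1.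
  - move=> i; have [->|->|[j [Hj ->]]] := hB i => //.
    apply/eqP => E; have [_] := nbad _ (c j) (before t.-1 ltac:(slia)) (inA2 _ Hj).
    by rewrite -E; have := zA t.-1 ltac:(slia); rewrite prednK // => ->.
  - move=> i; have [->|->|[j [Hj ->]]] := hB i => // -[E|[E|[E|E]]].
    + by have := xN j; rewrite E eqxx.
    + by move: E; rewrite adjC sxE; [case/orP => /eqP E; [slia | rewrite E] | slia].
    + by have := yN j; rewrite E eqxx.
    + by move: E; rewrite adjC syE; [case/orP => /eqP E; [slia | rewrite E] | slia].
  - by apply/negP => /ZaP[]; rewrite bt.
  - by apply/negP => /ZbP[]; rewrite bt.
  - by apply/negP => /ZaP[_]; rewrite eqxx.
  - by apply/negP => /ZbP[_ _]; rewrite eqxx.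
  - move=> v' i /ZaP[v1 v2 v3 v4]; have [->|->|[j [Hj ->]]] := hB i; rewrite ?eqxx // => _.
    by apply: nbad => //; apply: inA2.
  - move=> v' i /ZbP[v1 v2 v3 v4]; have [->|->|[j [Hj ->]]] := hB i; rewrite ?eqxx // => _.
    by apply: nbad => //; apply: inA2.
  - exists (z t.-1), (c 1); split.
    + by rewrite inE mem_arc //; slia.
    + by rewrite inE [c 1 \in arc c _ _]mem_arc ?orbT //; slia.
    + by rewrite adjC; have := zA t.-1 ltac:(slia); rewrite prednK.
    + by rewrite adjC sxE //; slia.
    + apply: connect_trans (cnW _ (subsetUl _ _)) _; apply: connect1.
      rewrite /restr z0 adjC cA -z0 !inE !mem_arc ?orbT //; slia.
  - exists (z t.-1), (c f.-1); split.
    + by rewrite inE mem_arc //; slia.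
    + by rewrite inE [c f.-1 \in arc c _ _]mem_arc ?orbT //; slia.
    + by rewrite adjC; have := zA t.-1 ltac:(slia); rewrite prednK.
    + by rewrite adjC syE ?eqxx //; slia.
    + apply: connect_trans (cnW _ (subsetUl _ _)) _; rewrite z0.
      apply: seg_connect => [|j Hj|j Hj]; [slia|exact: cA|].
      by rewrite inE [c j \in arc c _ _]mem_arc ?orbT //; slia.
  - exact: leq_maxl.
  - exact: leq_maxr.
have inA2 j : f < j < n -> c j \in A2 by move=> H; apply: mem_arc; slia.
have X1P u : tentX1 x y (c 0) (c f) (c 1) (c f.-1) r1 (c n.-1) (c f.+1) u -> ~~ bad u.
  by case/or3P => [/eqP ->|/eqP ->|/key //]; apply: cbad; slia.
set F2 := tentF2 x y (c 0) (c f) (c 1) (c f.-1) r1 (c n.-1) (c f.+1).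
have F2c j : f.+2 <= j <= n - 2 -> F2 (c j).
  move=> Hj; apply/andP; split.
    by rewrite (adjC _ x) (adjC _ y) sxE ?syE ?caj; slia.
  apply/forallP => u; apply/implyP => /X1P H; apply/andP.
  by apply: nbad => //; apply: inA2; slia.
exists r1, r2; rewrite /tent_frame xy !sxE ?syE ?cA /=; try slia.
have cl : adj (c 0) (c n.-1) by rewrite cadj; slia.
have cf : adj (c f) (c f.-1) by rewrite adjC cadj; slia.
have c0f : ~~ adj (c 0) (c f) by rewrite cadj; slia.
have c0y : ~~ adj (c 0) y by rewrite adjC syE; slia.
rewrite cl cf c0f c0y !eqxx ?orbT /=.
have -> : ~~ ((f == 1) || (f == n.-1)) by slia.
move=> /=; apply/and3P; split.
- rewrite /half /r1 -/F1; case: eqP => [->|/eqP f3]; first by rewrite cA.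
  apply/orP; right; rewrite cA; apply/existsP; exists (c (f - 2)); apply/andP; split.
    have cK j : j <= f - 4 -> comp F1 (c 2) (c (2 + j)).
      elim: j => [|j IH] Hj; first by rewrite addn0; apply: comp_self; apply: F1c; slia.
      by apply: comp_step (IH _) _ _; [slia | rewrite addnS | apply: F1c; slia].
    by have := cK (f - 4) (leqnn _); have -> : 2 + (f - 4) = f - 2 by slia.
  by have := cA (f - 2); have -> : (f - 2).+1 = f.-1 by slia.
- rewrite /half /r2 -/F2; case: eqP => [n3|/eqP n3].
    by apply/orP; left; rewrite adjC cadj; slia.
  apply/orP; right; apply/andP; split; first by rewrite adjC cadj; slia.
  apply/existsP; exists (c f.+2); apply/andP; split; last by rewrite adjC.
  have cK j : j <= n - 2 - f.+2 -> comp F2 (c n.-2) (c (n.-2 - j)).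
    elim: j => [|j IH] Hj; first by rewrite subn0; apply: comp_self; apply: F2c; slia.
    by apply: comp_step (IH _) _ _; [slia | rewrite adjC cadj; slia | apply: F2c; slia].
  by have := cK (n - 2 - f.+2) (leqnn _); have -> : n.-2 - (n - 2 - f.+2) = f.+2 by slia.
- apply/forallP => u; apply/implyP => /X1P H.
  have [|-> ->] := nbad _ (c n.-1) H; first by apply: inA2; slia.
  by have [|-> ->] := nbad _ (c f.+1) H; first by apply: inA2; slia.
Qed.

End Tents.

(** * Major vertices of a smallest unbalanced hole *)

(** Omitting three elements in turn, induction gives three common partners, and the second
    hypothesis says that one of them also serves the element omitted for it. The excluded
    configuration is the 6-cycle of a 3-sun. The lemma serves for major vertices, for cliques of a
    square and for cliques as common neighbourhoods. *)
Lemma helly3 (I J : finType) (r : I -> J -> bool) (S : {set I}) :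
  (forall x y, x \in S -> y \in S -> exists j, r x j && r y j) ->
  (forall x1 x2 x3 j1 j2 j3, x1 \in S -> x2 \in S -> x3 \in S ->
     [&& r x1 j2, r x1 j3, r x2 j1, r x2 j3, r x3 j1 & r x3 j2] ->
     [|| r x1 j1, r x2 j2 | r x3 j3]) ->
  S != set0 -> exists j, forall x, x \in S -> r x j.
Proof.
have [N] := ubnP #|S|; elim: N S => // N IH S SN H2 H3 /set0Pn[x xS].
have [/eqP Sx|/set0Pn[y]] := boolP (S :\ x == set0).
  have [j /andP[rj _]] := H2 x x xS xS; exists j => u uS.
  by have [->//|ux] := eqVneq u x; have := in_set0 u; rewrite -Sx !inE ux uS.
rewrite !inE => /andP[yx yS].
have [/eqP Sy|/set0Pn[z]] := boolP (S :\ x :\ y == set0).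
  have [j /andP[rj rj']] := H2 x y xS yS; exists j => u uS.
  have [->//|ux] := eqVneq u x; have [->//|uy] := eqVneq u y.
  by have := in_set0 u; rewrite -Sy !inE ux uy uS.
rewrite !inE => /and3P[zy zx zS].
have del t t' : t \in S -> t' \in S -> t' != t -> exists j, forall u, u \in S -> u != t -> r u j.
  move=> tS tS' tt'; have [||||j Hj] := IH (S :\ t).
  - by rewrite (cardsD1 t S) tS in SN.
  - by move=> u v /setD1P[_ uS] /setD1P[_ vS]; apply: H2.
  - by move=> x1 x2 x3 j1 j2 j3 /setD1P[_ a] /setD1P[_ b] /setD1P[_ d]; apply: H3.
  - by apply/set0Pn; exists t'; rewrite !inE tt'.
  by exists j => u uS ut; apply: Hj; rewrite !inE ut.
have [j1 J1] := del x y xS yS yx.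
have [j2 J2] := del y x yS xS ltac:(by rewrite eq_sym).
have [j3 J3] := del z x zS xS ltac:(by rewrite eq_sym).
have := H3 x y z j1 j2 j3 xS yS zS.
rewrite (J2 x) 1?(J3 x) ?(J1 y) ?(J3 y) ?(J1 z) ?(J2 z) //; try by rewrite eq_sym.
move=> /(_ isT).
case/or3P => [h|h|h]; [exists j1|exists j2|exists j3] => u uS.
- by have [->//|ux] := eqVneq u x; apply: J1.
- by have [->//|ux] := eqVneq u y; apply: J2.
- by have [->//|ux] := eqVneq u z; apply: J3.
Qed.

Section Majors.
Variables (T : finType) (adj : rel T) (side : T -> bool).
Hypothesis adjC : symmetric adj.
Hypothesis bip : forall x y, adj x y -> side x != side y.

Notation ipath := (ipath adj).
Notation phole := (phole adj).
Notation theta := (theta adj side).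
Notation theta_free := (theta_free adj side).

Definition smallest (c : nat -> T) n : Prop :=
  [/\ 5 < n, n %% 4 = 2, phole c n &
      forall m c', 5 < m -> m %% 4 = 2 -> m < n -> ~ phole c' m].

Variables (c : nat -> T) (n : nat).
Hypothesis Cmin : smallest c n.

Let n5 : 5 < n. Proof. by case: Cmin. Qed.
Let n4 : n %% 4 = 2. Proof. by case: Cmin. Qed.
Let Hc : phole c n. Proof. by case: Cmin. Qed.
Let cmin m c' : 5 < m -> m %% 4 = 2 -> m < n -> ~ phole c' m.
Proof. by case: Cmin => _ _ _ H; apply: H. Qed.
Let cper i : c (i + n) = c i. Proof. by case: Hc. Qed.
Let cA i : adj (c i) (c i.+1). Proof. by apply: phole_adjS Hc _; slia. Qed.

Lemma nbr_parity w i j : adj w (c i) -> adj w (c j) -> odd i = odd j.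
Proof.
move=> /bip + /bip; rewrite (phole_side bip i Hc) ?(phole_side bip j Hc); try slia.
by case: (side w); case: (side (c 0)); case: (odd i); case: (odd j).
Qed.

(** The arc between consecutive neighbours closes through [w] to a hole of even length [j - i + 2];
    if this is less than [n], it cannot be 2 modulo 4. *)
Lemma nbr_gap w i j : (forall k, w != c k) -> adj w (c i) -> adj w (c j) -> i < j < i + n ->
  (forall k, i < k < j -> ~~ adj w (c k)) -> (j - i) %% 4 = 2 \/ n <= j - i + 2.
Proof.
move=> wN wi wj ij N; have par := nbr_parity wi wj.
have [H|H] := leqP n (j - i + 2); first by right.
have [H4|H4] := eqVneq ((j - i) %% 4) 2; [by left|exfalso].
have H1 := phole_arc i Hc (ltnW (ltac:(slia) : j - i + 2 < n)).
have H2 := @ipath2 _ adj (c i) w (c j) (phole_neq Hc ij) ltac:(by rewrite eq_sym) (wN j)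
  ltac:(rewrite (phole_adj Hc ij); slia) ltac:(by rewrite adjC) wj.
have [||||a [|[|b]] Ha Hb|h [Hh _ _]] := glue adjC H1 H2; rewrite ?addn0 //; try slia.
- by congr c; slia.
- by rewrite eq_sym adjC wN; split=> //; apply: N; slia.
by apply: (@cmin (j - i + 2) h) => //; slia.
Qed.

Definition maj w : Prop := exists i j k,
  [/\ i < j, j < k, k < i + n & [/\ adj w (c i), adj w (c j) & adj w (c k)]].

Lemma maj_window w i0 : maj w -> exists i j k,
  [/\ i0 <= i, i < j, j < k, k < i0 + n & [/\ adj w (c i), adj w (c j) & adj w (c k)]].
Proof.
move=> [i [j [k [ij jk ki [wi wj wk]]]]].
have n0 : 0 < n by slia.
have [i' [Hi Ei]] := phole_rep i0 i Hc n0; have [j' [Hj Ej]] := phole_rep i0 j Hc n0.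
have [k' [Hk Ek]] := phole_rep i0 k Hc n0.
have d1 : i' != j' by apply: contra_neq (phole_neq Hc (ltac:(slia) : i < j < i + n)) => E; rewrite -Ei -Ej E.
have d2 : i' != k' by apply: contra_neq (phole_neq Hc (ltac:(slia) : i < k < i + n)) => E; rewrite -Ei -Ek E.
have d3 : j' != k' by apply: contra_neq (phole_neq Hc (ltac:(slia) : j < k < j + n)) => E; rewrite -Ej -Ek E.
rewrite -Ei in wi; rewrite -Ej in wj; rewrite -Ek in wk.
have [a|a|a] := ltngtP i' j'; have [b|b|b] := ltngtP j' k'; have [d|d|d] := ltngtP i' k';
  try (exfalso; slia).
- by exists i', j', k'; split=> //; slia.
- by exists i', k', j'; split=> //; slia.
- by exists k', i', j'; split=> //; slia.
- by exists j', i', k'; split=> //; slia.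
- by exists j', k', i'; split=> //; slia.
- by exists k', j', i'; split=> //; slia.
Qed.

Lemma maj_gap w i j : (forall k, w != c k) -> maj w -> adj w (c i) -> adj w (c j) -> i < j ->
  (forall k, i < k < j -> ~~ adj w (c k)) ->
  [/\ (j - i) %% 4 = 2, j - i + 4 <= n & exists k, j < k < i + n /\ adj w (c k)].
Proof.
move=> wN Mw wi wj ij N; have [a [b [d [ia ab bd dn [wa wb wd]]]]] := maj_window i Mw.
have jb : j <= b by rewrite leqNgt; apply/negP => bj; have := N b ltac:(slia); rewrite wb.
have p1 := nbr_parity wj wd; have p2 := nbr_parity wi wd.
have ev := phole_even bip Hc ltac:(slia).
have [H|H] := nbr_gap wN wi wj ltac:(slia) N.
  by split=> //; [slia | exists d; split=> //; slia].
by exfalso; slia.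
Qed.

Definition cnt w i j := \sum_(i <= k < j) adj w (c k).

Lemma cnt_cat w i j k : i <= j <= k -> cnt w i k = cnt w i j + cnt w j k.
Proof. by move=> /andP[ij jk]; rewrite /cnt (big_cat_nat (n := j)). Qed.

Lemma cnt0 w i j : (forall k, i <= k < j -> ~~ adj w (c k)) -> cnt w i j = 0.
Proof. by move=> H; rewrite /cnt big_nat big1 // => k /H /negbTE ->. Qed.

Lemma cnt1 w i : adj w (c i) -> cnt w i i.+1 = 1.
Proof. by move=> H; rewrite /cnt big_nat1 H. Qed.

Lemma next_nbr w i j : i < j -> adj w (c j) ->
  exists k, [/\ i < k <= j, adj w (c k) & forall t, i < t < k -> ~~ adj w (c t)].
Proof.
move=> ij wj; have exP : exists k, (i < k) && adj w (c k) by exists j; rewrite ij.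
case: (ex_minnP exP) => k /andP[ik wk] mn; exists k; split=> //.
  by have := mn j; rewrite ij wj; slia.
move=> t Ht; apply/negP => wt; have := mn t; rewrite wt; slia.
Qed.

(** Every gap between consecutive neighbours is 2 modulo 4, and [cnt w i j] is the number of
    gaps. *)
Lemma cnt_gap w i j : (forall k, w != c k) -> maj w -> adj w (c i) -> adj w (c j) -> i <= j ->
  (j - i + 2 * cnt w i j) %% 4 = 0.
Proof.
move=> wN Mw; have [N] := ubnP (j - i); elim: N i => // N IH i jN wi wj ij.
have [->|lt] := eqVneq i j; first by rewrite subnn /cnt big_geq.
have [|k [Hk wk Nk]] := @next_nbr w i j _ wj; first by slia.
have [g _ _] := maj_gap wN Mw wi wk ltac:(slia) Nk.
have := IH k ltac:(slia) wk wj ltac:(slia).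
rewrite (@cnt_cat w i i.+1 j); last by slia.
rewrite (@cnt_cat w i.+1 k j); last by slia.
rewrite cnt1 // (@cnt0 w i.+1 k) //.
move: (cnt _ _ _) => C; slia.
Qed.

Lemma cnt_period w i : cnt w i (i + n) = cnt w 0 n.
Proof.
elim: i => // i <-; rewrite (@cnt_cat w i i.+1 (i + n)); last by slia.
rewrite addSn (@cnt_cat w i.+1 (i + n) (i + n).+1); last by slia.
by rewrite addnC /cnt !big_nat1 cper.
Qed.

(** Once around the hole the gaps add up to [n], which is 2 modulo 4. *)
Lemma cnt_odd w : (forall k, w != c k) -> maj w -> odd (cnt w 0 n).
Proof.
move=> wN Mw; have [i [_ [_ [_ _ _ [wi _ _]]]]] := Mw.
have wi' : adj w (c (i + n)) by rewrite cper.
have := cnt_gap wN Mw wi wi' ltac:(slia); rewrite cnt_period addKn.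
by move: n4; move: (cnt _ _ _) => C; slia.
Qed.

Section Pair.
Variables v w : T.
Hypotheses (vN : forall k, v != c k) (wN : forall k, w != c k) (Mv : maj v) (Mw : maj w).
Hypotheses (TF : theta_free) (svw : side v = side w).
Hypothesis disj : forall k, adj v (c k) -> ~~ adj w (c k).

(** If [w] had an odd number of neighbours in the sector, the first and the last of them, [h1] and
    [h2], would be at a distance divisible by 4. If they differ, the hole through [v], [w] and the
    two outer pieces of the sector is smaller and 2 modulo 4; if they coincide, [v] and [c h1] are
    the ends of a theta. *)
Lemma sector_even i j : adj v (c i) -> adj v (c j) -> i < j ->
  (forall k, i < k < j -> ~~ adj v (c k)) -> ~~ odd (cnt w i j).
Proof.
move=> vi vj ij N; apply/negP => o.
have [g4 gn [g [Hg vg]]] := maj_gap vN Mv vi vj ij N.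
have exP : exists k, (i < k < j) && adj w (c k).
  case: (boolP [exists k : 'I_j, (i < k) && adj w (c k)]) => [/existsP[k /andP[ik wk]]|H].
    by exists k; rewrite ik wk ltn_ord.
  move: o; rewrite cnt0 // => k /andP[ik kj]; have [<-|ki] := eqVneq i k; first exact: disj.
  move: H; rewrite negb_exists => /forallP/(_ (Ordinal kj)) /=; rewrite negb_and.
  by case/orP => // H; exfalso; slia.
have ubP k : (i < k < j) && adj w (c k) -> k <= j by move=> /andP[]; slia.
case: (ex_minnP exP) => h1 /andP[H1 w1] mn; case: (ex_maxnP exP ubP) => h2 /andP[H2 w2] mx.
have h12 : h1 <= h2 by apply: mn; rewrite H2.
have out k : i <= k <= j -> adj w (c k) -> h1 <= k <= h2.
  move=> Hk wk; have ki : k != i by apply: contraTneq wk => ->; apply: disj.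
  have kj : k != j by apply: contraTneq wk => ->; apply: disj.
  have P : (i < k < j) && adj w (c k) by rewrite wk andbT; slia.
  by rewrite mn // mx.
have cE : cnt w i j = (cnt w h1 h2).+1.
  rewrite (@cnt_cat w i h1 j); last by slia.
  rewrite (@cnt_cat w h1 h2 j); last by slia.
  rewrite (@cnt_cat w h2 h2.+1 j); last by slia.
  rewrite cnt1 // (@cnt0 w i h1) ?(@cnt0 w h2.+1 j) ?addn0 ?addn1 // => k Hk; apply/negP => /out; slia.
have h4 : (h2 - h1) %% 4 = 0.
  have := cnt_gap wN Mw w1 w2 h12; move: o; rewrite cE; move: (cnt _ _ _) => C; slia.
have vw : v != w by apply: contraTneq (disj vi) => <-; rewrite negbK.
have Nvw : ~~ adj v w by apply/negP => /bip; rewrite svw eqxx.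
have [E|h12'] := eqVneq h1 h2; last first.
  have [|||||x [Hx x0 xl xy]] := @ipath_ends _ adj adjC (fun t => c (i + t)) (h1 - i) v w
      (phole_arc i Hc (ltac:(slia) : h1 - i + 2 <= n)) vw Nvw; rewrite ?addn0 ?subnKC //; try slia.
  - by rewrite adjC.
  - by move=> t Ht; apply: N; slia.
  - by move=> t Ht; apply/negP => /out; slia.
  have H3 := ipath_rev adjC (phole_arc h2 Hc (ltac:(slia) : j - h2 + 2 <= n)).
  have [|||||z [Hz z0 zl zy]] := @ipath_ends _ adj adjC _ (j - h2) v w H3 vw Nvw;
    rewrite ?subn0 ?subnn ?addn0 ?subnKC //; try slia.
  - by rewrite adjC.
  - by move=> t Ht; apply: N; slia.
  - by move=> t Ht; apply/negP => /out; slia.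
  have [||||a b Ha Hb|h [Hh _ _]] := glue adjC Hx Hz; rewrite ?x0 ?xl //.
    have -> : a = a.-1.+1 by slia.
    have -> : b = b.-1.+1 by slia.
    rewrite xy ?zy; try slia.
    by rewrite (phole_adj Hc) ?(phole_neq Hc); slia.
  by apply: (@cmin ((h1 - i).+2 + (j - h2).+2) h) => //; slia.
have [a [b [d [ia ab bd dn [wa wb wd]]]]] := maj_window i Mw.
have [h' [Hh' wh']] : exists h', j < h' < i + n /\ adj w (c h').
  exists d; split=> //; rewrite dn andbT ltnNge; apply/negP => dj.
  by have := out b ltac:(slia) wb; have := out d ltac:(slia) wd; slia.
have pg := nbr_parity vj vg; have ev := phole_even bip Hc ltac:(slia).
have ph : odd h' = odd h1 := nbr_parity wh' w1.
have pv : odd h1 = odd j.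
  have := bip vj; have := bip w1; rewrite -svw.
  rewrite (phole_side bip h1 Hc) ?(phole_side bip j Hc); try slia.
  by case: (side v); case: (side (c 0)); case: (odd h1); case: (odd j).
have pi := nbr_parity vi vj.
(* The third path of the theta runs through [w] and a stretch of the hole away from the sector that
   contains a neighbour [g] of [v] and a neighbour [h'] of [w]. *)
have [lo [hi [Hlo Hhi Hglo Hhlo]]] : exists lo hi, [/\ j.+2 <= lo, hi + 2 <= i + n,
    lo <= g <= hi & lo <= h' <= hi].
  have b1 : j.+2 <= g by clear -pg Hg; slia.
  have b2 : j.+2 <= h' by clear -ph pv Hh'; slia.
  have b3 : g + 2 <= i + n by clear -pg pi ev Hg; slia.
  have b4 : h' + 2 <= i + n by clear -ph pv pi ev Hh'; slia.
  clear -b1 b2 b3 b4.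
  by exists (minn g h'), (maxn g h'); split; slia.
clear o pg ev ph pv pi g4 h4 cE.
apply: (@TF v (c h1) (arc c i (h1 - i)) (arc c h1.+1 (j - h1)) (w |: arc c lo (hi - lo).+1)).
have cadj a' b' : a' < b' < a' + n -> adj (c a') (c b') = (b' == a'.+1) || (b'.+1 == a' + n).
  by move=> H; rewrite (phole_adj Hc).
have far a' b' : i <= a' <= j -> lo <= b' <= hi -> c a' != c b' /\ ~~ adj (c a') (c b').
  by move=> Ha Hb; rewrite (phole_neq Hc) ?cadj; slia.
have wfar a' : i <= a' <= j -> a' != h1 -> c a' != w /\ ~~ adj (c a') w.
  by move=> Ha ne; rewrite eq_sym adjC wN; split=> //; apply/negP => /out; slia.
split.
- by rewrite svw; apply: bip.
- by apply/negP => /disj; rewrite w1.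
- split.
  + apply: lnk_arc => //; first by slia.
    by have := cA (i + (h1 - i)).-1; rewrite prednK; [rewrite subnKC //; slia | slia].
  + apply: lnkC => //; apply: lnk_arc => //; first by slia.
    have -> : (h1.+1 + (j - h1)).-1 = j by slia.
    by rewrite adjC.
  + exists (c g), w; rewrite setU11 setU1r ?mem_arc; try slia.
    split=> //; apply: (@connect_trans _ _ (c h')); last first.
      by apply: connect1; rewrite /restr adjC wh' setU11 setU1r // mem_arc //; slia.
    have seg a' b' : lo <= a' <= b' -> b' <= hi -> connect (restr adj (w |: arc c lo (hi - lo).+1)) (c a') (c b').
      move=> Ha Hb; apply: seg_connect => [|k Hk|k Hk]; [slia|exact: cA|].
      by rewrite setU1r // mem_arc //; slia.
    have [gh|hg] := leqP g h'; first by apply: seg; slia.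
    by rewrite connect_restrC //; apply: seg; slia.
- split.
  + move=> x y /arcP[a' [Ha ->]] /arcP[b' [Hb ->]].
    by rewrite (phole_neq Hc) ?cadj; slia.
  + move=> x y /arcP[a' [Ha ->]] /setU1P[->|/arcP[b' [Hb ->]]]; [apply: wfar|apply: far]; slia.
  + move=> x y /arcP[a' [Ha ->]] /setU1P[->|/arcP[b' [Hb ->]]]; [apply: wfar|apply: far]; slia.
- rewrite !in_setU3; split; rewrite !negb_or !in_setU1 !negb_or.
    rewrite vw; apply/and3P; split; try apply/andP; try split=> //; apply/arcP => -[t [_ /eqP]]; exact/negP.
  rewrite [c h1 == w]eq_sym wN /=; apply/and3P; split; apply/arcP => -[t [Ht /eqP]]; apply/negP.
  + by rewrite eq_sym; apply: (phole_neq Hc); slia.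
  + by apply: (phole_neq Hc); slia.
  + by have [] := far h1 t ltac:(slia) ltac:(slia).
Qed.

(** The neighbours of [v] cut the hole into sectors with evenly many neighbours of [w], but a major
    vertex has an odd number of neighbours in total. *)
Lemma pair_absurd : False.
Proof.
have [i [_ [_ [_ _ _ [vi _ _]]]]] := Mv.
have H j : i <= j -> adj v (c j) -> ~~ odd (cnt w i j).
  have [N] := ubnP j; elim: N j => // N IH j jN ij vj.
  have [E|ne] := eqVneq i j; first by rewrite E /cnt big_geq.
  have exP : exists k, (i <= k < j) && adj v (c k) by exists i; rewrite vi andbT; slia.
  have ubP k : (i <= k < j) && adj v (c k) -> k <= j by move=> /andP[]; slia.
  case: (ex_maxnP exP ubP) => k /andP[Hk vk] mx.
  rewrite (@cnt_cat w i k j) ?oddD; last by slia.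
  have a1 := IH k ltac:(slia) ltac:(slia) vk.
  have a2 : ~~ odd (cnt w k j).
    apply: sector_even => //; first by slia.
    by move=> t Ht; apply/negP => vt; have := mx t; rewrite vt; slia.
  by rewrite (negbTE a1) (negbTE a2).
have := H (i + n) ltac:(slia); rewrite cper => /(_ vi).
by rewrite cnt_period cnt_odd.
Qed.

End Pair.

(** There are exactly two gaps, of total length [n]. They cannot both be 2 modulo 4, so one of them
    has length at least [n - 2]. *)
Lemma minor_nbrs w i j : (forall k, w != c k) -> ~ maj w -> adj w (c i) -> adj w (c j) -> i < j < i + n ->
  j = i + 2 \/ j + 2 = i + n.
Proof.
move=> wN nM wi wj ij; have par := nbr_parity wi wj; have ev := phole_even bip Hc ltac:(slia).
have N1 k : i < k < j -> ~~ adj w (c k).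
  by move=> Hk; apply/negP => wk; apply: nM; exists i, k, j; split=> //; slia.
have N2 k : j < k < i + n -> ~~ adj w (c k).
  by move=> Hk; apply/negP => wk; apply: nM; exists i, j, k; split=> //; slia.
have wi' : adj w (c (i + n)) by rewrite cper.
have := nbr_gap wN wi wj ij N1; have := nbr_gap wN wj wi' ltac:(slia) N2; move: n4 n5; slia.
Qed.

End Majors.

(** * A common neighbour of all major vertices of one side *)

Section Cleaning.
Variables (T : finType) (adj : rel T) (side : T -> bool).
Hypothesis adjC : symmetric adj.
Hypothesis bip : forall x y, adj x y -> side x != side y.

Lemma hexagon x1 x2 x3 j1 j2 j3 :
  [&& adj x1 j2, adj x1 j3, adj x2 j1, adj x2 j3, adj x3 j1 & adj x3 j2] ->
  ~~ [|| adj x1 j1, adj x2 j2 | adj x3 j3] -> exists c, phole adj c 6.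
Proof.
case/and5P=> a12 a13 a21 a23 /andP[a31 a32]; rewrite !negb_or => /and3P[n11 n22 n33].
have sd u v : adj u v -> side u = ~~ side v by move=> /bip; case: (side u); case: (side v).
have e1 := sd _ _ a12; have e2 := sd _ _ a32; have e3 := sd _ _ a31; have e4 := sd _ _ a21; have e5 := sd _ _ a23.
have nx u v : side u = side v -> (adj u v = false) by move=> E; apply/negP => /bip; rewrite E eqxx.
have sx12 : adj x1 x2 = false by apply: nx; rewrite e1 e4 -e3 e2.
have sx13 : adj x1 x3 = false by apply: nx; rewrite e1 e2.
have sx23 : adj x2 x3 = false by apply: nx; rewrite e4 e3.
have sj12 : adj j1 j2 = false by apply: nx; apply: negb_inj; rewrite -e3 -e2.
have sj13 : adj j1 j3 = false by apply: nx; apply: negb_inj; rewrite -e4 -e5.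
have sj23 : adj j2 j3 = false by apply: nx; apply: negb_inj; rewrite -e2 -e5 e3 -e4.
have ne u v z : adj u z -> ~~ adj v z -> (u == v) = false by move=> A N; apply/negP => /eqP E; rewrite -E A in N.
have x12 : x1 == x2 = false by apply: ne a12 _.
have x13 : x1 == x3 = false by apply: ne a13 _.
have x23 : x2 == x3 = false by apply: ne a23 _.
have ne' u v z : adj z u -> ~~ adj z v -> (u == v) = false by move=> A N; apply/negP => /eqP E; rewrite -E A in N.
have j12 : j1 == j2 = false by apply: ne' a21 _.
have j13 : j1 == j3 = false by apply: ne' a31 _.
have j23 : j2 == j3 = false by apply: ne' a32 _.
have xj u v : side u = ~~ side v -> (u == v) = false.
  by move=> E; apply/negP => /eqP E'; move: E; rewrite E'; case: (side v).
have m1 : x1 == j1 = false by apply: xj; rewrite e1 -e2 e3.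
have m2 : x2 == j2 = false by apply: xj; rewrite e4 -e3 e2.
have m3 : x3 == j3 = false by apply: xj; rewrite e3 -e4 e5.
have k12 := xj _ _ e1; have k32 := xj _ _ e2; have k31 := xj _ _ e3; have k21 := xj _ _ e4; have k23 := xj _ _ e5.
have k13 := xj _ _ (sd _ _ a13).
exists (fun i => nth x1 [:: x1; j2; x3; j1; x2; j3] (i %% 6)); apply: phole_fin => //.
move=> i j ij; have i6 : i < 6 by slia.
have j6 : j < 6 by slia.
move: i j i6 j6 ij => [|[|[|[|[|[|//]]]]]] [|[|[|[|[|[|//]]]]]] //= _ _ _;
  rewrite ?(adjC j1 x1) ?(adjC j1 x2) ?(adjC j1 x3) ?(adjC j2 x1) ?(adjC j2 x2) ?(adjC j2 x3)
     ?(adjC j3 x1) ?(adjC j3 x2) ?(adjC j3 x3) ?(adjC x3 x1) ?(adjC x3 x2) ?(adjC x2 x1) ?(adjC j2 j1) ?(adjC j3 j1) ?(adjC j3 j2)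
     ?a12 ?a13 ?a21 ?a23 ?a31 ?a32 ?(negbTE n11) ?(negbTE n22) ?(negbTE n33) ?sx12 ?sx13 ?sx23 ?sj12 ?sj13 ?sj23;
  split=> //; first [by rewrite ?x12 ?x13 ?x23 ?j12 ?j13 ?j23 ?m1 ?m2 ?m3 ?k12 ?k32 ?k31 ?k21 ?k23 ?k13
    | by rewrite eq_sym ?x12 ?x13 ?x23 ?j12 ?j13 ?j23 ?m1 ?m2 ?m3 ?k12 ?k32 ?k31 ?k21 ?k23 ?k13].
Qed.

(** [helly3] with partners restricted to the hole: two major vertices of one side have a common
    neighbour there by [pair_absurd], and the excluded configuration would be an unbalanced hole of
    length 6, smaller than [n]. *)
Lemma majors_common c n s : smallest adj c n -> 6 < n -> theta_free adj side ->
  exists k, forall w, (forall i, w != c i) -> maj adj c n w -> side w = s -> adj w (c k).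
Proof.
move=> Cm n6 TF; have [n5 n4 Hc cmin] := Cm.
pose majb w := [exists i : 'I_n, exists j : 'I_n, exists k : 'I_n,
  [&& i < j, j < k, adj w (c i), adj w (c j) & adj w (c k)]].
have majP w : reflect (maj adj c n w) (majb w).
  apply: (iffP existsP) => [[i /existsP[j /existsP[k /and5P[ij jk wi wj wk]]]]|].
    by exists i, j, k; split=> //; have := ltn_ord k; slia.
  move=> /(maj_window Cm 0)[i [j [k [_ ij jk kn [wi wj wk]]]]].
  have jn : j < n by slia.
  have i_n : i < n by slia.
  exists (Ordinal i_n); apply/existsP; exists (Ordinal jn); apply/existsP; exists (Ordinal kn).
  by rewrite /= ij jk wi wj wk.
pose S := [set w | [&& [forall i : 'I_n, w != c i], majb w & side w == s]].
have SP w : w \in S -> [/\ forall i, w != c i, maj adj c n w & side w = s].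
  rewrite inE => /and3P[/forallP H /majP M /eqP E]; split=> // i.
  rewrite -(phole_modn i Hc); have im := ltn_pmod i (ltac:(slia) : 0 < n).
  exact: (H (Ordinal im)).
have [/eqP S0|Sn] := boolP (S == set0).
  exists 0 => w wN wM sw; have := in_set0 w; rewrite -S0 inE => /negP[].
  by apply/and3P; split; [apply/forallP|apply/majP|apply/eqP].
pose r x j := adj x j && [exists i : 'I_n, j == c i].
have [||//|j Hj] := @helly3 _ _ r S.
- move=> x y /SP[xN xM sx] /SP[yN yM sy].
  case: (boolP [exists k : 'I_n, adj x (c k) && adj y (c k)]) => [/existsP[k /andP[xk yk]]|H].
    exists (c k); rewrite /r xk yk /= andbb; apply/existsP; by exists k.
  exfalso; apply: (pair_absurd adjC bip Cm xN yN xM yM TF); first by rewrite sx.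
  move=> k xk; apply/negP => yk; move: H; rewrite negb_exists => /forallP.
  have km := ltn_pmod k (ltac:(slia) : 0 < n).
  by move=> /(_ (Ordinal km)) /=; rewrite (phole_modn _ Hc) xk yk.
- move=> x1 x2 x3 j1 j2 j3 _ _ _; rewrite /r.
  case/and5P => /andP[a1 e1] /andP[a2 e2] /andP[a3 e3] /andP[a4 e4] /andP[/andP[a5 e5] /andP[a6 e6]].
  rewrite e1 e2 e3 !andbT; apply/negPn/negP => H.
  have [|c' Hc'] := hexagon _ H; first by rewrite a1 a2 a3 a4 a5 a6.
  exact: cmin Hc'.
have [x0 x0S] := set0Pn _ Sn; have /andP[_ /existsP[k /eqP jk]] := Hj _ x0S.
exists k => w wN wM sw; rewrite -jk; have : r w j; last by case/andP.
by apply: Hj; rewrite inE; apply/and3P; split; [apply/forallP|apply/majP|apply/eqP].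
Qed.

End Cleaning.

(** * Smallest unbalanced holes are isometric *)

Section Iso.
Variables (T : finType) (adj : rel T) (side : T -> bool).
Hypothesis adjC : symmetric adj.
Hypothesis bip : forall x y, adj x y -> side x != side y.

Notation ipath := (ipath adj).
Notation phole := (phole adj).
Notation theta := (theta adj side).
Notation theta_free := (theta_free adj side).
Notation smallest := (smallest adj).
Notation maj := (maj adj).

Definition tent_free : Prop := forall p1 p2 c1 c2 a1 b1 r1 a2 b2 r2,
  ~~ tent_frame adj p1 p2 c1 c2 a1 b1 r1 a2 b2 r2.

(* x has the same neighbours on the hole as the vertex in position e. *)
Definition sits (c : nat -> T) n x e : Prop :=
  forall j, j < n -> adj x (c (e + j)) = (j == 1) || (j == n.-1).

Lemma sits_self c n e : phole c n -> 3 < n -> sits c n (c e) e.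
Proof.
move=> Hc n3 [|j] jn; first by rewrite addn0 (negbTE (side_irr bip _)); slia.
by rewrite (phole_adj Hc) //; slia.
Qed.

Lemma sits_shift c n x e k : sits c n x (k + e) -> sits (fun i => c (k + i)) n x e.
Proof. by move=> H j /H; rewrite addnA. Qed.

Lemma sits_period c n x e : phole c n -> sits c n x e -> sits c n x (e + n).
Proof. by move=> [P _] H j /H <-; rewrite addnAC P. Qed.

Lemma sitsE c n x e : phole c n -> sits c n x e -> 0 < e < n.-1 ->
  forall j, j < n -> adj x (c j) = (j == e.-1) || (j == e.+1).
Proof.
move=> [P _] H en j jn; have [ej|je] := leqP e j.
  by have := H (j - e) ltac:(slia); rewrite subnKC // => ->; slia.
have := H (j + n - e) ltac:(slia); have -> : e + (j + n - e) = j + n by slia.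
by rewrite P => ->; slia.
Qed.

Lemma sits_fin c n x e : phole c n -> 0 < e < n.-1 ->
  (forall j, j < n -> adj x (c j) = (j == e.-1) || (j == e.+1)) -> sits c n x e.
Proof.
move=> [P _] en H j jn; have [ej|je] := ltnP (e + j) n; first by rewrite H //; slia.
have -> : e + j = (e + j - n) + n by slia.
by rewrite P H; slia.
Qed.

Lemma phole_off c n x : phole c n -> 0 < n -> (forall j, j < n -> x != c j) -> forall j, x != c j.
Proof. by move=> Hc n0 H j; rewrite -(phole_modn j Hc); apply: H; apply: ltn_pmod. Qed.

(** Three paths join [x] and [y]: the path [w] and the two arcs. For odd [f] they give a theta, or a
    tent when [x] and [y] are adjacent. For even [f] the holes through [w] would have lengths with
    sum [n + 2 l], which is 2 modulo 4; one of them would be unbalanced, and it would be smaller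
    than [n] if [w] were shorter than both arcs. *)
Lemma sit_path0 c n x y f w l : smallest c n -> theta_free -> tent_free ->
  sits c n x 0 -> sits c n y f -> 2 <= f <= n - 2 ->
  x = c 0 \/ (forall j, x != c j) -> y = c f \/ (forall j, y != c j) ->
  ipath w l -> w 0 = x -> w l = y -> 0 < l ->
  (forall i j, 0 < i < l -> 0 < j < n -> j != f -> w i != c j /\ ~~ adj (w i) (c j)) ->
  ~~ odd f /\ (f <= l \/ n - f <= l).
Proof.
move=> Cm TF TNF sx sy fn xC yC Hw w0 wl l0 W; have [n5 n4 Hc cmin] := Cm.
have n3 : 3 < n by slia.
have sxE j : j < n -> adj x (c j) = (j == 1) || (j == n.-1).
  by move=> /sx; rewrite add0n.
have syE := sitsE Hc sy ltac:(slia).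
have ev := phole_even bip Hc ltac:(slia).
have cA i : adj (c i) (c i.+1) by apply: phole_adjS Hc _; slia.
have cadj a' b' : a' < b' < n -> adj (c a') (c b') = (b' == a'.+1) || (b'.+1 == a' + n).
  by move=> H; rewrite (phole_adj Hc); slia.
have cneq a' b' : a' < b' < n -> c a' != c b' by move=> H; apply: (phole_neq Hc); slia.
have xc j : 0 < j < n -> x != c j.
  by case: xC => [->|//] H; apply: cneq; slia.
have yc j : j < n -> j != f -> y != c j.
  case: yC => [->|//] jn jf; have [lt|gt|/eqP E] := ltngtP j f; last by rewrite E in jf.
    by rewrite eq_sym; apply: cneq; slia.
  by apply: cneq; slia.
have xy : x != y.
  have x1 := sxE 1 ltac:(slia); have xn := sxE n.-1 ltac:(slia).
  by apply/eqP => E; move: x1 xn; rewrite E !syE; slia.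
have wA i : i < l -> adj (w i) (w i.+1).
  by move=> il; have [|_ ->] := Hw i i.+1; rewrite ?eqxx //; slia.
have sxy : side y = side x (+) odd f.
  have a1 : side x = ~~ side (c 1) by have := bip (_ : adj x (c 1)); rewrite sxE ?eqxx //; [move=> /(_ isT); case: (side x); case: (side _) | slia].
  have a2 : side y = ~~ side (c f.+1) by have := bip (_ : adj y (c f.+1)); rewrite syE ?eqxx ?orbT //; [move=> /(_ isT); case: (side y); case: (side _) | slia].
  have b1 := phole_side bip f.+1 Hc ltac:(slia); have b2 := phole_side bip 1 Hc ltac:(slia).
  by move: a1 a2 b1 b2 => -> -> -> -> /=; clear; case: (side _); case: (odd f).
have odl : odd l = odd f.
  have := ipath_side bip Hw (leqnn l); rewrite w0 wl sxy.
  by case: (side x); case: (odd l); case: (odd f).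
have [of_|ef] := boolP (odd f).
  exfalso; have f3 : 3 <= f <= n - 3 by slia.
  have [xadj|Nxy] := boolP (adj x y).
    have xo : forall j, x != c j.
      case: xC => // E; move: xadj; rewrite E adjC syE; slia.
    have yo : forall j, y != c j.
      case: yC => // E; move: xadj; rewrite E sxE; slia.
    have [r1 [r2]] := tent_complete adjC bip Hc n5 TF of_ f3 sxE syE xo yo xadj.
    exact/negP/TNF.
  have l1 : 1 < l.
    have : l != 1 by apply: contraNneq Nxy => E; rewrite -w0 -wl E; apply: wA; rewrite E.
    by slia.
  apply: (TF x y (arc c 1 f.-1) (arc c f.+1 (n.-1 - f)) (arc w 1 l.-1)).
  split=> //.
  - by rewrite sxy of_; case: (side x).
  - split.
    + apply: lnk_arc => //; first by slia.
        by rewrite sxE //; slia.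
      by rewrite adjC syE ?eqxx //; slia.
    + apply: lnkC => //; apply: lnk_arc => //; first by slia.
        by rewrite syE ?eqxx ?orbT //; slia.
      by rewrite adjC sxE; slia.
    + apply: lnk_arc; first by slia.
      * by move=> k _ Hk; apply: wA; slia.
      * by rewrite -w0; apply: wA.
      * by rewrite -wl; have := wA l.-1 ltac:(slia); rewrite prednK.
  - split.
    + move=> u v /arcP[a [Ha ->]] /arcP[b [Hb ->]]; rewrite cneq ?cadj; slia.
    + by move=> u v /arcP[a [Ha ->]] /arcP[b [Hb ->]]; rewrite eq_sym adjC; apply: W; slia.
    + by move=> u v /arcP[a [Ha ->]] /arcP[b [Hb ->]]; rewrite eq_sym adjC; apply: W; slia.
  - rewrite !in_setU3; split; apply/or3P => -[] /arcP[a [Ha /eqP]]; apply/negP.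
    + by apply: xc; slia.
    + by apply: xc; slia.
    + by rewrite -w0; have [] := Hw 0 a ltac:(slia).
    + by apply: yc; slia.
    + by apply: yc; slia.
    + by rewrite -wl eq_sym; have [] := Hw a l ltac:(slia).
split=> //; apply/orP; rewrite -implyNb; apply/implyP; rewrite -ltnNge => lf; rewrite leqNgt; apply/negP => lnf.
have Nxy : ~~ adj x y by apply/negP => /bip; rewrite sxy (negbTE ef) addbF eqxx.
have l2 : 2 <= l by slia.
have [|||||x1 [H1 x10 x1f x1c]] := @ipath_ends _ adj adjC (fun t => c (1 + t)) (f - 2) x y
    (phole_arc 1 Hc (ltac:(slia) : f - 2 + 2 <= n)) xy Nxy.
- by rewrite sxE //; slia.
- by rewrite adjC syE; slia.
- by move=> i Hi; split; [apply: xc; slia | apply: yc; slia].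
- by move=> i Hi; rewrite sxE; slia.
- by move=> i Hi; rewrite syE; slia.
have [|||||x2 [H2 x20 x2f x2c]] := @ipath_ends _ adj adjC _ (n - f - 2) y x
    (phole_arc f.+1 Hc (ltac:(slia) : n - f - 2 + 2 <= n)) (ltac:(by rewrite eq_sym)) (ltac:(by rewrite adjC)).
- by rewrite syE; slia.
- by rewrite adjC sxE; slia.
- by move=> i Hi; split; [apply: yc; slia | apply: xc; slia].
- by move=> i Hi; rewrite syE; slia.
- by move=> i Hi; rewrite sxE; slia.
have [m4|m4] := eqVneq ((f + l) %% 4) 2.
  have [||||i j Hi Hj|h [Hh _ _]] := glue adjC H1 Hw; rewrite ?x10 ?x1f //.
    have -> : i = i.-1.+1 by slia.
    by rewrite x1c; [rewrite eq_sym adjC; apply: W; slia | slia].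
  by apply: (@cmin ((f - 2).+2 + l) h) => //; slia.
have [||||i j Hi Hj|h [Hh _ _]] := glue adjC H2 (ipath_rev adjC Hw); rewrite ?subn0 ?subnn ?x20 ?x2f //.
  have -> : i = i.-1.+1 by slia.
  by rewrite x2c; [rewrite eq_sym adjC; apply: W; slia | slia].
by apply: (@cmin ((n - f - 2).+2 + l) h) => //; slia.
Qed.

Lemma smallest_shift c n k : smallest c n -> smallest (fun i => c (k + i)) n.
Proof. by case=> a b d e; split=> //; apply: phole_shift. Qed.

Lemma sit_path c n e f x y w l : smallest c n -> theta_free -> tent_free ->
  sits c n x e -> sits c n y (e + f) -> 2 <= f <= n - 2 ->
  x = c e \/ (forall j, x != c j) -> y = c (e + f) \/ (forall j, y != c j) ->
  ipath w l -> w 0 = x -> w l = y -> 0 < l ->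
  (forall i j, 0 < i < l -> 0 < j < n -> j != f -> w i != c (e + j) /\ ~~ adj (w i) (c (e + j))) ->
  ~~ odd f /\ (f <= l \/ n - f <= l).
Proof.
move=> Cm TF TNF sx sy fn xC yC Hw w0 wl l0 W.
apply: (@sit_path0 (fun i => c (e + i)) n x y f w l) => //.
- exact: smallest_shift.
- exact: sits_shift.
- by case: xC => [->|H]; [left; rewrite addn0 | right].
- by case: yC => [->|H]; [left | right].
Qed.

Lemma twin_sits c n w e : smallest c n -> (forall k, w != c k) -> ~ maj c n w ->
  adj w (c e) -> adj w (c (e + 2)) -> sits c n w (e + 1).
Proof.
move=> Cm wN nM we we2 j jn; have [n5 n4 Hc cmin] := Cm; have [P _] := Hc.
have [->|j1] := eqVneq j 1; first by rewrite -addnA we2.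
have [->|jn1] := eqVneq j n.-1.
  have -> : e + 1 + n.-1 = e + n by slia.
  by rewrite P we.
apply/negbTE/negP => wj.
have [E|E] := minor_nbrs adjC bip Cm wN nM we wj ltac:(slia); first by slia.
by apply: nM; exists e, (e + 2), (e + 1 + j); split=> //; slia.
Qed.

(** This is the isometry claim for positions at distance [d]. Antipodal positions get a slack of
    two, so that a shortcut by exactly two has to be refuted only for [d.*2 < n]; the five points
    used later never need the antipodal case. *)
Definition long n d l : bool := if d.*2 == n then d <= l + 2 else (d <= l) || (n - d <= l).

Definition awalk (A : pred T) l u v : Prop :=
  exists x, [/\ x 0 = u, x l = v, forall i, i < l -> adj (x i) (x i.+1) & forall i, i <= l -> A (x i)].

Lemma awalk_sym A l u v : awalk A l u v -> awalk A l v u.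
Proof.
move=> [x [x0 xl H1 H2]]; exists (fun i => x (l - i)); rewrite subn0 subnn; split=> // i il.
  by rewrite adjC; have := H1 (l - i.+1) ltac:(slia); have -> : (l - i.+1).+1 = l - i by slia.
by apply: H2; slia.
Qed.

End Iso.

Section Iso2.
Variables (T : finType) (adj : rel T) (side : T -> bool).
Hypothesis adjC : symmetric adj.
Hypothesis bip : forall x y, adj x y -> side x != side y.

Notation ipath := (ipath adj).
Notation phole := (phole adj).
Notation theta := (theta adj side).
Notation theta_free := (theta_free adj side).
Notation smallest := (smallest adj).
Notation maj := (maj adj).

Notation tent_free := (tent_free adj).
Notation sits := (sits adj).
Notation awalk := (awalk adj).

Let awalk_sym (A : pred T) l u v : awalk A l u v -> awalk A l v u.
Proof. exact: awalk_sym. Qed.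
Let sits_self c n e : phole c n -> 3 < n -> sits c n (c e) e.
Proof. exact: (sits_self bip). Qed.
Let twin_sits c n w e : smallest c n -> (forall k, w != c k) -> ~ maj c n w ->
  adj w (c e) -> adj w (c (e + 2)) -> sits c n w (e + 1).
Proof. exact: (twin_sits adjC bip). Qed.

(** * Refutation of a shortest shortcut of a smallest hole *)

Section Step.
Variables (c : nat -> T) (n : nat) (A : pred T) (d : nat) (l : nat) (p : nat -> T).
Hypotheses (Cm : smallest c n) (TF : theta_free) (TNF : tent_free).
Hypothesis AC : forall i, A (c i).
Hypothesis minor : forall v, A v -> (forall k, v != c k) -> ~ maj c n v.
Hypothesis IH : forall l' i d', l' < l -> 0 < d' < n -> awalk A l' (c i) (c (i + d')) -> long n d' l'.
Hypotheses (d0 : 0 < d) (dn : d.*2 <= n).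
Hypotheses (Hp : ipath p l) (p0 : p 0 = c 0) (pl : p l = c d).
Hypothesis (pA : forall i, i <= l -> A (p i)).
Hypothesis nlong : ~~ long n d l.

Let Hc : phole c n. Proof. by case: Cm. Qed.
Let n5 : 5 < n. Proof. by case: Cm. Qed.
Let ev : ~~ odd n. Proof. by apply: (phole_even bip Hc); slia. Qed.
Let padj i : i < l -> adj (p i) (p i.+1).
Proof. by move=> il; have [|_ ->] := Hp (i := i) (j := i.+1); rewrite ?eqxx //; slia. Qed.

Let par : odd l = odd d.
Proof.
have := ipath_side bip Hp (leqnn l); rewrite p0 pl (phole_side bip d Hc); last by slia.
by case: (side (c 0)); case: (odd l); case: (odd d).
Qed.

Let dl : l + 2 <= d /\ (d.*2 = n -> l + 2 < d).
Proof.
move: nlong; rewrite /long; case: eqP => [E|E] H; split; move: d0 dn par ev; slia.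
Qed.

Let pwalk i j : i <= j <= l -> awalk A (j - i) (p i) (p j).
Proof.
move=> ij; exists (fun t => p (i + t)); rewrite addn0 subnKC; last by slia.
by split=> // t Ht; [rewrite addnS; apply: padj; slia | apply: pA; slia].
Qed.

Let awalkS l' u v w : awalk A l' u v -> adj v w -> A w -> awalk A l'.+1 u w.
Proof.
move=> [x [x0 xl H1 H2]] Aw Hw; exists (fun t => if t <= l' then x t else w); split=> //.
- by rewrite ltnn.
- move=> t Ht; have -> : t <= l' by slia.
  case: ltnP => C; first exact: H1.
  have -> : t = l' by slia.
  by rewrite xl.
- by move=> t Ht; case: leqP => C //; apply: H2.
Qed.

(** A hole vertex inside [p] would split it into two shorter walks. By induction both are long, and
    then [p] is long as well. *)
Lemma off i : 0 < i < l -> forall j, p i != c j.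
Proof.
move=> il; apply: (phole_off Hc ltac:(slia)) => j jn; apply/eqP => E.
have j0 : j != 0 by apply/eqP => j0; have [] := Hp (i := 0) (j := i) ltac:(slia); rewrite E j0 p0 eqxx.
have jd : j != d by apply/eqP => jd; have [] := Hp (i := i) (j := l) ltac:(slia); rewrite E jd pl eqxx.
have L1 : long n j i.
  apply: (@IH i 0 j); try slia.
  by have := pwalk (ltac:(slia) : 0 <= i <= l); rewrite subn0 p0 E.
have L2 : long n (if j < d then d - j else j - d) (l - i).
  have W := pwalk (ltac:(slia) : i <= l <= l); rewrite E pl in W.
  case: ltnP => C; first by apply: (@IH (l - i) j (d - j)); try slia; rewrite subnKC // ltnW.
  by apply: (@IH (l - i) d (j - d)); try slia; rewrite subnKC //; apply: awalk_sym.
move: L1 L2 dl dn d0; rewrite /long; case: (ltnP j d) => C; case: eqP => E1; case: eqP => E2; slia.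
Qed.

(** The edge to [c j] turns the two pieces of [p] into walks of lengths [i + 1] and [l - i + 1],
    both shorter than [l] because [i] is not next to an end. By induction both are long, which
    leaves only the case that [p] saves exactly two. *)
Lemma attach i j : 1 < i < l.-1 -> j < n -> adj (p i) (c j) ->
  [/\ d = l + 2, d.*2 < n & j = i.+1].
Proof.
move=> il jn pc.
have j0 : j != 0.
  by apply/eqP => j0; have [|_] := Hp (i := 0) (j := i); [slia | rewrite adjC p0 -j0 pc; slia].
have jd : j != d.
  by apply/eqP => jd; have [|_] := Hp (i := i) (j := l); [slia | rewrite pl -jd pc; slia].
have L1 : long n j i.+1.
  apply: (@IH i.+1 0 j); try slia.
  by have := pwalk (ltac:(slia) : 0 <= i <= l); rewrite subn0 p0 => /awalkS; apply.
have L2 : long n (if j < d then d - j else j - d) (l - i).+1.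
  have W := awalkS (awalk_sym (pwalk (ltac:(slia) : i <= l <= l))) pc (AC j); rewrite pl in W.
  case: ltnP => C; last by apply: (@IH (l - i).+1 d (j - d)); try slia; rewrite subnKC.
  by apply: (@IH (l - i).+1 j (d - j)); try slia; rewrite subnKC ?(ltnW C) //; apply: awalk_sym.
have [D1 D2] := dl.
have M1 : j <= i.+1 \/ n - j <= i.+1.
  by move: L1; rewrite /long; clear -il D1 dn; case: eqP => E; slia.
set dj := if j < d then d - j else j - d in L2.
have djb : j < d /\ dj = d - j \/ d < j /\ dj = j - d.
  by rewrite /dj; clear -jd; case: (ltnP j d) => C; slia.
have M2 : dj <= (l - i).+1 \/ n - dj <= (l - i).+1.
  by move: L2; rewrite /long; clear -il D1 dn; case: eqP => E; slia.
clear -M1 M2 D1 D2 djb il dn jn d0.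
by case: M1 => M1; case: M2 => M2; case: djb => -[? ?]; split; slia.
Qed.

Lemma l_ge3 : 3 <= l.
Proof.
have [lE|[lE|l2]] : l = 0 \/ l = 1 \/ 2 <= l by slia.
- by exfalso; move: pl; rewrite lE p0; apply/eqP/(phole_neq Hc); move: dl dn; slia.
- exfalso; have := padj (ltac:(slia) : 0 < l); have -> : 1 = l by [].
  by rewrite p0 pl (phole_adj Hc); move: dl dn; slia.
have [l3|//] := eqVneq l 2; last by slia.
exfalso; have o := off (ltac:(slia) : 0 < 1 < l).
have a1 : adj (p 1) (c 0) by rewrite adjC -p0; apply: padj; slia.
have a2 : adj (p 1) (c d) by rewrite -pl l3; apply: padj; slia.
have := minor_nbrs adjC bip Cm o (minor (pA (ltac:(slia) : 1 <= l)) o) a1 a2; move: dl dn; slia.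
Qed.

Lemma first_nbr j : j < n -> adj (p 1) (c j) -> [\/ j = 0, j = 2 | j.+2 = n].
Proof.
have l3 := l_ge3; move=> jn pc; have [->|j0] := eqVneq j 0; first by constructor 1.
have o := off (ltac:(slia) : 0 < 1 < l).
have a1 : adj (p 1) (c 0) by rewrite adjC -p0; apply: padj; slia.
have [E|E] := minor_nbrs adjC bip Cm o (minor (pA (ltac:(slia) : 1 <= l)) o) a1 pc ltac:(slia).
  by constructor 2; slia.
by constructor 3; slia.
Qed.

Lemma last_nbr j : j < n -> adj (p l.-1) (c j) -> [\/ j = d, j = d.+2 | j.+2 = d].
Proof.
have l3 := l_ge3; move=> jn pc; have [->|jd] := eqVneq j d; first by constructor 1.
have o := off (ltac:(slia) : 0 < l.-1 < l).
have a1 : adj (p l.-1) (c d).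
  by rewrite -pl; have := padj (ltac:(slia) : l.-1 < l); rewrite prednK //; slia.
have nM := minor (pA (ltac:(slia) : l.-1 <= l)) o.
have [lt|ge] := ltnP j d.
  have [E|E] := minor_nbrs adjC bip Cm o nM pc a1 ltac:(move: dn; slia); first by constructor 3; slia.
  by move: dl dn d0; slia.
have [E|E] := minor_nbrs adjC bip Cm o nM a1 pc ltac:(slia); first by constructor 2; slia.
by move: dl dn d0; slia.
Qed.

Let cper i : c (i + n) = c i. Proof. by case: Hc. Qed.
Let n3 : 3 < n. Proof. by move: n5; slia. Qed.
Let a1 : adj (p 1) (c 0). Proof. by rewrite adjC -p0; apply: padj; have := l_ge3; slia. Qed.
Let aL : adj (p l.-1) (c d).
Proof. by rewrite -pl; have := l_ge3 => l3; have := padj (ltac:(slia) : l.-1 < l); rewrite prednK //; slia. Qed.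

(** Here [p] touches the hole only near its ends. As [p 1] is minor, a second neighbour makes it a
    clone of [c 1] or [c n.-1], and likewise at the other end; cutting [p] off at these clones gives
    a path to which [sit_path] applies. *)
Lemma no_middle : (forall i j, 1 < i < l.-1 -> j < n -> ~~ adj (p i) (c j)) -> False.
Proof.
move=> M; have l3 := l_ge3.
have o1 := off (ltac:(slia) : 0 < 1 < l); have oL := off (ltac:(slia) : 0 < l.-1 < l).
have m1 := minor (pA (ltac:(slia) : 1 <= l)) o1.
have mL := minor (pA (ltac:(slia) : l.-1 <= l)) oL.
have [D1 D2] := dl.
have [s [e [sx xC E Hs]]] : exists s e, [/\ sits c n (p s) e, p s = c e \/ (forall j, p s != c j),
    [\/ s = 0 /\ e = 0, s = 1 /\ e = 1 | s = 1 /\ e = n.-1]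
  & s = 0 -> forall j, j < n -> adj (p 1) (c j) -> j = 0].
  have [b1|b1] := boolP (adj (p 1) (c 2)).
    exists 1, 1; split; [|by right|by constructor 2|by []].
    exact: (twin_sits Cm o1 m1 a1 b1).
  have [b2|b2] := boolP (adj (p 1) (c (n - 2))).
    exists 1, n.-1; split; [|by right|by constructor 3|by []].
    have := twin_sits Cm o1 m1 b2; have -> : n - 2 + 2 = 0 + n by slia.
    rewrite cper; have -> : n - 2 + 1 = n.-1 by slia.
    by apply.
  exists 0, 0; split; [by rewrite p0; apply: sits_self|by left|by constructor 1|].
  move=> _ j jn pj; have [//|E|E] := first_nbr jn pj; first by rewrite E (negbTE b1) in pj.
  have E' : j = n - 2 by slia.
  by rewrite E' (negbTE b2) in pj.
have [t [f [sy yC F Ht]]] : exists t f, [/\ sits c n (p (l - t)) f, p (l - t) = c f \/ (forall j, p (l - t) != c j),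
    [\/ t = 0 /\ f = d, t = 1 /\ f = d.+1 | t = 1 /\ f = d.-1]
  & t = 0 -> forall j, j < n -> adj (p l.-1) (c j) -> j = d].
  have [b1|b1] := boolP (adj (p l.-1) (c d.+2)).
    exists 1, d.+1; rewrite subn1; split; [|by right|by constructor 2|by []].
    by have := twin_sits Cm oL mL aL; rewrite addn2 addn1; apply.
  have [b2|b2] := boolP (adj (p l.-1) (c (d - 2))).
    exists 1, d.-1; rewrite subn1; split; [|by right|by constructor 3|by []].
    have := twin_sits Cm oL mL b2; have -> : d - 2 + 2 = d by slia.
    have -> : d - 2 + 1 = d.-1 by slia.
    by apply.
  exists 0, d; rewrite subn0 pl; split; [by apply: sits_self|by left|by constructor 1|].
  move=> _ j jn pj; have [//|E'|E'] := last_nbr jn pj; first by rewrite E' (negbTE b1) in pj.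
  have E'' : j = d - 2 by slia.
  by rewrite E'' (negbTE b2) in pj.
(* [g] leads forward from position [e] to position [f]; [e > 1] means [e = n.-1], where the way
   passes position 0. *)
pose g := if e <= 1 then f - e else f.+1.
have eg : e + g = f \/ e + g = f + n.
  by rewrite /g; clear -E F D1 d0 n5; case: leqP => C; case: E => -[? ?]; case: F => -[? ?]; slia.
have gb : 2 <= g <= n - 2 /\ l - s - t < g /\ l - s - t < n - g.
  by rewrite /g; clear -E F D1 d0 n5 dn l3; case: (leqP e 1) => C; case: E => -[? ?]; case: F => -[? ?]; slia.
have st : s <= 1 /\ t <= 1 by clear -E F; case: E => -[? ?]; case: F => -[? ?]; slia.
have en : e < n by clear -E n5; case: E => -[? ?]; slia.
have sy' : sits c n (p (l - t)) (e + g) by case: eg => ->; [|apply: sits_period].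
have yC' : p (l - t) = c (e + g) \/ (forall j, p (l - t) != c j).
  by case: yC => [->|H]; [left; case: eg => ->; rewrite ?cper | right].
have [] := @sit_path _ _ _ adjC bip c n e g (p s) (p (l - t)) (fun i => p (s + i)) (l - s - t) Cm TF TNF sx sy' (proj1 gb) xC yC'.
- by apply: ipathW Hp _; slia.
- by rewrite addn0.
- by congr p; slia.
- by slia.
- move=> i j Hi Hj jg; split; first by apply: off; slia.
  have [k [Hk Ek]] := phole_rep 0 (e + j) Hc ltac:(slia).
  have kE := phole_idx Hc Ek ltac:(slia) ltac:(slia).
  rewrite -Ek; have kn : k < n by slia.
  have [mid|nm] := boolP (1 < s + i < l.-1); first by apply: M.
  have [E1|E1] := eqVneq (s + i) 1.
    rewrite E1; apply/negP => pk; have := Hs ltac:(slia) k kn pk.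
    by clear -E E1 kE Hi Hj jg n5 en; case: E => -[? ?]; slia.
  have E2 : s + i = l.-1 by slia.
  rewrite E2; apply/negP => pk; have := Ht ltac:(slia) k kn pk.
  clear -F E2 kE Hi Hj jg eg kn gb; case: F => -[? ?]; slia.
by move=> _; slia.
Qed.

Lemma ipath_rcons x m b : ipath x m -> adj (x m) b -> (forall i, i <= m -> x i != b) ->
  (forall i, i < m -> ~~ adj (x i) b) -> ipath (fun t => if t <= m then x t else b) m.+1.
Proof.
move=> Hx Am N NA i j ij; have [jm|mj] := leqP j m.
  have -> : i <= m by slia.
  by apply: Hx; slia.
have im : i <= m by slia.
rewrite im N //; split=> //; have [->|ne] := eqVneq i m; first by rewrite Am; slia.
by rewrite (negbTE (NA _ _)); slia.
Qed.

(** In the remaining case [p] runs parallel to the hole. As long as the edges from [p i] to [c i.+1]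
    exist, moving the beginning of the hole onto [p] yields a smallest hole again. *)
Definition sub q j := if j %% n <= q then p (j %% n) else c (j %% n).

Lemma subE q j : j < n -> sub q j = if j <= q then p j else c j.
Proof. by move=> jn; rewrite /sub modn_small. Qed.

(** Move the hole onto [p] as long as [p i] is adjacent to [c i.+1]. If this never stops, two
    adjacent clones at odd distance appear. Otherwise [p] leaves the moved hole at [p e], and its
    next contact [p i] closes a path that is too short or produces a theta. *)
Lemma middle_false i0 j0 : 1 < i0 < l.-1 -> j0 < n -> adj (p i0) (c j0) -> False.
Proof.
move=> Hi0 jn0 pi0; have [dE d2 jE] := attach Hi0 jn0 pi0; have l3 := l_ge3.
rewrite {}jE in pi0 jn0.
have cadj a' b' : a' < b' < n -> adj (c a') (c b') = (b' == a'.+1) || (b'.+1 == a' + n).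
  by move=> H; rewrite (phole_adj Hc); slia.
have cneq a' b' : a' < b' < n -> c a' != c b' by move=> H; apply: (phole_neq Hc); slia.
have padjE a b : a < b <= l -> adj (p a) (p b) = (b == a.+1) by move=> /Hp[].
have pneq a b : a < b <= l -> p a != p b by move=> /Hp[].
have S i j : 0 < i < l -> j < n -> adj (p i) (c j) ->
    [\/ i = 1 /\ j = 0, i = l.-1 /\ j = d | j = i.+1].
  move=> il jn pj; have [E|E] := eqVneq i 1.
    rewrite E in pj *; have [->|->|E2] := first_nbr jn pj; [by constructor 1|by constructor 3|exfalso].
    have W := awalkS (pwalk (ltac:(slia) : 1 <= i0 <= l)) pi0 (AC _).
    have {}W := awalkS (awalk_sym W) pj (AC _).
    have E3 : j = i0.+1 + (n - i0 - 3) by slia.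
    rewrite E3 in W; have := IH _ _ W; rewrite /long.
    by move: d2 Hi0 dE; clear; case: eqP; slia.
  have [E'|E'] := eqVneq i l.-1; last by have [_ _ ->] := attach (ltac:(slia) : 1 < i < l.-1) jn pj; constructor 3.
  rewrite E' in pj *; have [->|E2|E2] := last_nbr jn pj; [by constructor 2|exfalso|by constructor 3; slia].
  have W := awalkS (pwalk (ltac:(slia) : i0 <= l.-1 <= l)) pj (AC _).
  have {}W := awalk_sym (awalkS (awalk_sym W) pi0 (AC _)).
  have E3 : j = i0.+1 + (d.+1 - i0) by slia.
  rewrite E3 in W; have := IH _ _ W; rewrite /long.
  by move: d2 Hi0 dE; clear; case: eqP; slia.
have exP : exists i, (0 < i) && ((i == l) || ~~ adj (p i) (c i.+1)) by exists l; rewrite eqxx; slia.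
case: (ex_minnP exP) => e1 /andP[e10 He1] mn.
have e1l : e1 <= l by apply: mn; rewrite eqxx; slia.
have E1 i : 0 < i < e1 -> adj (p i) (c i.+1).
  by move=> Hi; apply/negPn/negP => H; have := mn i; rewrite H orbT; slia.
pose e := e1.-1.
have pc0 j : 0 < j < n -> c 0 != c j by move=> H; apply: cneq; slia.
have subs q : q < e1 -> q.+2 <= l -> smallest (sub q) n.
  move=> qe ql; case: Cm => m1 m2 _ m4; split=> //.
  apply: (@phole_fin _ _ adjC (fun j => if j <= q then p j else c j)) => //; first by slia.
  move=> i j ij; case: leqP => iq; case: leqP => jq.
  - by rewrite pneq ?padjE; try slia; split=> //; slia.
  - have [->|i1] := posnP i; first by rewrite p0 cneq ?cadj; try slia; split=> //; slia.
    rewrite off; last by slia.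
    split=> //; have [->|ji] := eqVneq j i.+1; first by rewrite E1 //; slia.
    apply/negbTE/negP => /S H; have [] := H ltac:(slia) ltac:(slia); slia.
  - by slia.
  - by rewrite cneq ?cadj; try slia; split=> //; slia.
have offs q j : q.+2 <= l -> forall t, q < t < l -> j < n -> p t != sub q j.
  move=> ql t Ht jn; rewrite subE //; case: leqP => C; first by rewrite eq_sym; apply: pneq; slia.
  by apply: off; slia.
(* All edges exist: on the hole [sub (l - 3)] the adjacent vertices [p (l - 2)] and [p l.-1] sit at
   positions [l - 2] and [l + 1], against the parity in [sit_path]. *)
have [E|E] := eqVneq e1 l.
  have Sq := subs (l - 3) ltac:(slia) ltac:(slia); have Hq : phole (sub (l - 3)) n by case: Sq.
  have [] := @sit_path _ _ _ adjC bip (sub (l - 3)) n (l - 2) 3 (p (l - 2)) (p l.-1) (fun i => p (l - 2 + i)) 1 Sq TF TNF.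
  - apply: sits_fin => //; first by slia.
    move=> j jn; rewrite subE //; case: leqP => C; first by rewrite adjC padjE; slia.
    have [->|j1] := eqVneq j (l - 2).+1; first by rewrite E1 ?orbT //; slia.
    have -> : (j == (l - 2).-1) = false by slia.
    by apply/negbTE/negP => /S H; have [] := H ltac:(slia) ltac:(slia); slia.
  - apply: sits_fin => //; first by slia.
    move=> j jn; rewrite subE //; case: leqP => C; first by rewrite adjC padjE; slia.
    have [->|jd] := eqVneq j d; first by rewrite aL; slia.
    have [->|jl] := eqVneq j l.
      by have := E1 l.-1 ltac:(slia); rewrite prednK; [move=> ->; slia | slia].
    have -> : (j == (l - 2 + 3).-1) || (j == (l - 2 + 3).+1) = false by slia.
    by apply/negbTE/negP => /S H; have [] := H ltac:(slia) ltac:(slia); slia.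
  - by slia.
  - by right; apply: (phole_off Hq) => [|j jn]; [slia | apply: offs => //; slia].
  - by right; apply: (phole_off Hq) => [|j jn]; [slia | apply: offs => //; slia].
  - by apply: ipathW Hp _; slia.
  - by rewrite addn0.
  - by congr p; slia.
  - by [].
  - by slia.
  - by [].
have Ne : ~~ adj (p e1) (c e1.+1) by move: He1; rewrite (negbTE E).
have Sq := subs e ltac:(rewrite /e; slia) ltac:(rewrite /e; slia); have Hq : phole (sub e) n by case: Sq.
have eE : e.+1 = e1 by rewrite /e; slia.
move: (e) eE Sq Hq => {}e eE Sq Hq.
have el2 : e.+2 <= l by slia.
have AE : exists i, (e < i) && [exists j : 'I_n, (e < j) && adj (p i) (c j)].
  exists l.-1; apply/andP; split; first by slia.
  have dn' : d < n by slia.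
  by apply/existsP; exists (Ordinal dn'); rewrite /= aL andbT; slia.
case: (ex_minnP AE) => i /andP[ei /existsP[[j jn] /= /andP[ej pij]]] mni.
have il : i <= l.-1.
  apply: mni; apply/andP; split; first by slia.
  have dn' : d < n by slia.
  by apply/existsP; exists (Ordinal dn'); rewrite /= aL andbT; slia.
have nat_ t k : e < t < i -> e < k < n -> ~~ adj (p t) (c k).
  move=> Ht Hk; apply/negP => ptk; have := mni t; suff -> : (e < t) && [exists j : 'I_n, (e < j) && adj (p t) (c j)] by slia.
  apply/andP; split; first by slia.
  have kn : k < n by slia.
  by apply/existsP; exists (Ordinal kn); rewrite /= ptk andbT; slia.
have psub t k : e < t < l -> k < n -> k != e -> k <= e -> p t != sub e k /\ ~~ adj (p t) (sub e k).
  move=> Ht kn ke ke'; rewrite offs //.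
  by split=> //; rewrite subE // ke' adjC padjE; slia.
have inter t k : e < t < i -> k < n -> k != e -> p t != sub e k /\ ~~ adj (p t) (sub e k).
  move=> Ht kn ke; have [le|gt] := leqP k e; first by apply: psub => //; slia.
  rewrite offs //; last by slia.
  by split=> //; rewrite subE // leqNgt gt /=; apply: nat_; slia.
have sube : sub e e = p e by rewrite subE ?leqnn //; slia.
have sx : sits (sub e) n (p e) e by rewrite -sube; apply: sits_self.
have idx k : 0 < k < n -> exists k', [/\ k' < n, k' != e, sub e (e + k) = sub e k' & e + k = k' \/ e + k = k' + n].
  move=> Hk; have [lt|ge] := ltnP (e + k) n; first by exists (e + k); split=> //; slia.
  exists (e + k - n); split; [slia|slia| |slia].
  by case: Hq => P _; rewrite -[in LHS](subnK ge) P.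
have pe k : e < k < n -> k != e.+1 -> p e != c k /\ ~~ adj (p e) (c k) \/ k.+1 = n.
  move=> Hk ke; have [e0|e0] := posnP e.
    have [->|kn] := eqVneq k.+1 n; [by right|left].
    by rewrite e0 p0 cneq ?cadj; try slia; split=> //; slia.
  left; split; first by apply: off; slia.
  by apply/negP => /S H; have [] := H ltac:(slia) ltac:(slia); slia.
(* Before [p l.-1], the contact is [c i.+1], and [sit_path] yields only that [i - e] is odd. Then
   [p e] and [p i] are the ends of a theta whose third path takes the end of [p], the hole from
   [c d] on, and the beginning of [p]. *)
have [ilt|ige] := ltnP i l.-1.
  have ji : j = i.+1 by have [] := S i j ltac:(slia) jn pij; slia.
  rewrite {}ji in pij ej jn.
  have ie : i != e.+1 by apply: contraNneq Ne => H; rewrite -eE -H.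
  have Hw : ipath (fun t => if t <= i - e then p (e + t) else c i.+1) (i - e).+1.
    apply: ipath_rcons.
    - by apply: ipathW Hp _; slia.
    - by rewrite subnKC //; slia.
    - move=> t Ht; have [->|t0] := posnP t; last by apply: off; slia.
      by rewrite addn0; have [[] //|] := pe i.+1 ltac:(slia) ltac:(slia); slia.
    - move=> t Ht; have [->|t0] := posnP t; last by apply: nat_; slia.
      by rewrite addn0; have [[] //|] := pe i.+1 ltac:(slia) ltac:(slia); slia.
  have subi : sub e i.+1 = c i.+1 by rewrite subE // leqNgt (ltac:(slia) : e < i.+1).
  have [] := @sit_path _ _ _ adjC bip (sub e) n e (i.+1 - e) (p e) (c i.+1) _ _ Sq TF TNF sx _ _ _ _ Hw.
  - by rewrite subnKC; [rewrite -subi; apply: sits_self | slia].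
  - by slia.
  - by left.
  - by left; rewrite subnKC ?subi //; slia.
  - by rewrite addn0.
  - by rewrite ltnn.
  - by [].
  - move=> t k Ht Hk kf; have -> : t <= i - e by slia.
    have [k' [kn' ke' -> Ek]] := idx k Hk.
    have [ti|ti] := eqVneq t (i - e); last by apply: inter => //; slia.
    rewrite ti subnKC; last by slia.
    have [le|gt] := leqP k' e; first by apply: psub => //; slia.
    rewrite offs //; last by slia.
    split=> //; rewrite subE // leqNgt gt /=.
    by apply/negP => /S H; have [] := H ltac:(slia) ltac:(slia); slia.
  move=> oddi _.
  apply: (@TF (p e) (p i) (arc p e.+1 (i - e).-1) (arc c e.+1 (i.+1 - e))
    (arc p i.+1 (l.-1 - i) :|: arc c d (n - d) :|: arc p 0 e)).
  have cA k : adj (c k) (c k.+1) by apply: phole_adjS Hc _; slia.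
  split.
  - rewrite (ipath_side bip Hp (ltac:(slia) : e <= l)) (ipath_side bip Hp (ltac:(slia) : i <= l)).
    have : odd i != odd e by slia.
    by case: (side _); case: (odd i); case: (odd e).
  - by rewrite padjE; slia.
  - split.
    + apply: lnk_arc; first by slia.
      * by move=> k _ Hk; apply: padj; slia.
      * by apply: padj; slia.
      * have -> : (e.+1 + (i - e).-1).-1 = i.-1 by slia.
        by have := padj (ltac:(slia) : i.-1 < l); rewrite prednK //; slia.
    + apply: lnk_arc => //; first by slia.
        have [->|e0] := posnP e; first by rewrite p0.
        by apply: E1; slia.
      have -> : (e.+1 + (i.+1 - e)).-1 = i.+1 by slia.
      by rewrite adjC.
    + set X3 := _ :|: _.
      have X1 k : i < k < l -> p k \in X3 by move=> H; rewrite !in_setU mem_arc //; slia.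
      have X2 k : d <= k < n -> c k \in X3 by move=> H; rewrite !in_setU (mem_arc c) ?orbT //; slia.
      have X4 k : k < e -> p k \in X3 by move=> H; rewrite !in_setU (mem_arc p (lo := 0)) ?orbT //; slia.
      have C1 : connect (restr adj X3) (c n.-1) (p i.+1).
        rewrite connect_restrC //; apply: (@connect_trans _ _ (p l.-1)).
          by apply: seg_connect => [|k Hk|k Hk]; [slia | apply: padj; slia | apply: X1; slia].
        apply: (@connect_trans _ _ (c d)).
          by apply: connect1; rewrite /restr aL X1 ?X2 //; slia.
        by apply: seg_connect => [|k Hk|k Hk]; [slia | exact: cA | apply: X2; slia].
      have cn0 : adj (c n.-1) (c 0).
        by have := cA n.-1; rewrite prednK; [rewrite -[n]add0n cper | slia].
      have [e0|e0] := posnP e.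
        exists (c n.-1), (p i.+1); split=> //.
        * by apply: X2; slia.
        * by apply: X1; slia.
        * by rewrite e0 p0 adjC.
        * by rewrite adjC; apply: padj; slia.
      exists (p e.-1), (p i.+1); split=> //.
      * by apply: X4; slia.
      * by apply: X1; slia.
      * by rewrite adjC; have := padj (ltac:(slia) : e.-1 < l); rewrite prednK.
      * by rewrite adjC; apply: padj; slia.
      * apply: connect_trans C1; rewrite connect_restrC //; apply: (@connect_trans _ _ (p 0)).
          by apply: connect1; rewrite /restr p0 cn0 -p0 X2 ?X4 //; slia.
        by apply: seg_connect => [|k Hk|k Hk]; [slia | apply: padj; slia | apply: X4; slia].
  - have cc a b : 0 < a < b -> b < n -> b != a.+1 -> c a != c b /\ ~~ adj (c a) (c b).
      by move=> H1 H2 H3; rewrite cneq ?cadj; try slia; split=> //; slia.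
    have pp a b : a.+1 < b <= l -> p a != p b /\ ~~ adj (p a) (p b).
      by move=> H; rewrite pneq ?padjE; try slia; split=> //; slia.
    split.
    + move=> u v /arcP[a [Ha ->]] /arcP[b [Hb ->]]; split; first by apply: off; slia.
      by apply: nat_; slia.
    + move=> u v /arcP[a [Ha ->]]; rewrite in_setU3 => /or3P[] /arcP[b [Hb ->]].
      * by apply: pp; slia.
      * by split; [apply: off; slia | apply: nat_; slia].
      * by rewrite eq_sym adjC; apply: pp; slia.
    + move=> u v /arcP[a [Ha ->]]; rewrite in_setU3 => /or3P[] /arcP[b [Hb ->]].
      * rewrite eq_sym adjC; split; first by apply: off; slia.
        by apply/negP => /S H; have [] := H ltac:(slia) ltac:(slia); slia.
      * by apply: cc; slia.
      * have [->|b0] := posnP b; first by rewrite p0 eq_sym adjC cneq ?cadj; try slia; split=> //; slia.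
        rewrite eq_sym adjC; split; first by apply: off; slia.
        by apply/negP => /S H; have [] := H ltac:(slia) ltac:(slia); slia.
  - rewrite !in_setU3; split; apply/negP => /or3P[||/or3P[||]] /arcP[a [Ha /eqP]]; apply/negP.
    + by apply: pneq; slia.
    + have [->|e0] := posnP e; last by apply: off; slia.
      by rewrite p0; apply: pc0; slia.
    + by apply: pneq; slia.
    + have [->|e0] := posnP e; last by apply: off; slia.
      by rewrite p0; apply: pc0; slia.
    + by rewrite eq_sym; apply: pneq; slia.
    + by rewrite eq_sym; apply: pneq; slia.
    + by apply: off; slia.
    + by apply: pneq; slia.
    + by apply: off; slia.
    + by rewrite eq_sym; apply: pneq; slia.
have iE : i = l.-1 by slia.
(* The next contact is at the last inner vertex. Either it sits at position [l + 1], or the path is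
   continued to [c d]; in both cases it is shorter than both arcs. *)
have [bl|bl] := boolP (adj (p l.-1) (c l)).
  have el : e.+3 <= l.
    have : e.+2 != l; last by slia.
    by apply: contraNneq Ne => H; rewrite -eE (_ : e.+1 = l.-1) ?prednK //; slia.
  have [] := @sit_path _ _ _ adjC bip (sub e) n e (l.+1 - e) (p e) (p l.-1) (fun t => p (e + t)) (l.-1 - e) Sq TF TNF sx.
  - rewrite subnKC; last by slia.
    apply: sits_fin => //; first by slia.
    move=> k kn; rewrite subE //; case: leqP => C; first by rewrite adjC padjE; slia.
    have [->|kd] := eqVneq k d; first by rewrite aL; slia.
    have [->|kl] := eqVneq k l; first by rewrite bl; slia.
    have -> : (k == l.+2) = false by slia.
    rewrite orbF.
    by apply/negbTE/negP => /S H; have [] := H ltac:(slia) ltac:(slia); slia.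
  - by slia.
  - by left.
  - by right; apply: (phole_off Hq) => [|k kn]; [slia | apply: offs => //; slia].
  - by apply: ipathW Hp _; slia.
  - by rewrite addn0.
  - by congr p; slia.
  - by slia.
  - move=> t k Ht Hk kf; have [k' [kn' ke' -> Ek]] := idx k Hk.
    by apply: inter => //; slia.
  by move=> _; slia.
have subd : sub e d = c d by rewrite subE; [rewrite leqNgt (ltac:(slia) : e < d) | slia].
have Hw : ipath (fun t => if t <= l.-1 - e then p (e + t) else c d) (l.-1 - e).+1.
  apply: ipath_rcons.
  - by apply: ipathW Hp _; slia.
  - by rewrite subnKC //; slia.
  - move=> t Ht; have [->|t0] := posnP t; last by apply: off; slia.
    by rewrite addn0; have [[] //|] := pe d ltac:(slia) ltac:(slia); slia.
  - move=> t Ht; have [->|t0] := posnP t; last by apply: nat_; slia.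
    by rewrite addn0; have [[] //|] := pe d ltac:(slia) ltac:(slia); slia.
have [] := @sit_path _ _ _ adjC bip (sub e) n e (d - e) (p e) (c d) _ _ Sq TF TNF sx _ _ _ _ Hw.
- by rewrite subnKC; [rewrite -subd; apply: sits_self | slia].
- by slia.
- by left.
- by left; rewrite subnKC ?subd //; slia.
- by rewrite addn0.
- by rewrite ltnn.
- by [].
- move=> t k Ht Hk kf; have -> : t <= l.-1 - e by slia.
  have [k' [kn' ke' -> Ek]] := idx k Hk.
  have [ti|ti] := eqVneq t (l.-1 - e); last by apply: inter => //; slia.
  rewrite ti subnKC; last by slia.
  have [le|gt] := leqP k' e; first by apply: psub => //; slia.
  rewrite offs //; last by slia.
  split=> //; rewrite subE // leqNgt gt /=.
  have [->//|kl] := eqVneq k' l.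
  by apply/negP => /S H; have [] := H ltac:(slia) ltac:(slia); slia.
by move=> _; slia.
Qed.

Lemma step_false : False.
Proof.
apply: no_middle => i j Hi jn; apply/negP; exact: middle_false.
Qed.

End Step.

End Iso2.

(** * Detecting clean holes *)

Section HoleFrame.
Variables (T : finType) (adj : rel T) (side : T -> bool).
Hypothesis adjC : symmetric adj.
Hypothesis bip : forall x y, adj x y -> side x != side y.

Notation ipath := (ipath adj).
Notation phole := (phole adj).
Notation theta_free := (theta_free adj side).
Notation tent_free := (tent_free adj).
Notation smallest := (smallest adj).
Notation maj := (maj adj).
Notation awalk := (awalk adj).
Notation cst := (cstep adj).

(** Strong induction on the length: the walk is thinned to an induced path, and exchanging its ends
    allows the shorter of the two arcs to be considered. *)
Lemma isometry c n (A : pred T) : smallest c n -> theta_free -> tent_free ->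
  (forall i, A (c i)) -> (forall v, A v -> (forall k, v != c k) -> ~ maj c n v) ->
  forall l i d, 0 < d < n -> awalk A l (c i) (c (i + d)) -> long n d l.
Proof.
move=> Cm TF TNF AC minor l; have [N] := ubnP l; elim: N l => // N IH l lN i d dn W.
have [n5 n4 Hc cmin] := Cm; have [P _] := Hc.
have main i' d' : 0 < d' -> d'.*2 <= n -> awalk A l (c i') (c (i' + d')) -> long n d' l.
  move=> d0 dn' [x [x0 xl H1 H2]]; apply/negPn/negP => nl.
  have [||y [m [ml y0 ym Hy [Ay Iy]]]] := @walk_ipath _ adj A x l.
  - by split=> // j Hj; apply: H2; slia.
  - by rewrite x0 xl; apply: (phole_neq Hc); slia.
  apply: (@step_false _ adj side adjC bip (fun k => c (i' + k)) n A d' m y) => //.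
  - exact: smallest_shift.
  - move=> v Av vN [a [b [e [h1 h2 h3 [h4 h5 h6]]]]]; apply: (minor v) => //.
      move=> k; have [k' [Hk <-]] := phole_rep i' k Hc ltac:(slia).
      by have := vN (k' - i'); rewrite subnKC //; slia.
    by exists (i' + a), (i' + b), (i' + e); split=> //; slia.
  - by move=> l' j e l'm de; rewrite addnA; apply: IH => //; slia.
  - by rewrite y0 x0 addn0.
  - by rewrite ym xl.
  - move=> j jm; have [->|j0] := posnP j; first by rewrite y0 x0.
    have [->|jm'] := eqVneq j m; first by rewrite ym xl.
    by apply: Iy; slia.
  - move: nl; rewrite /long; case: eqP => _; slia.
have [le|gt] := leqP d.*2 n; first by apply: main W; slia.
have := main (i + d) (n - d) ltac:(slia) ltac:(slia); rewrite -addnA subnKC; last by slia.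
rewrite P => /(_ (awalk_sym adjC W)); rewrite /long.
by clear -dn gt; case: eqP; case: eqP; slia.
Qed.

Lemma awalk_cat (A : pred T) j k u v w : awalk A j u v -> awalk A k v w -> awalk A (j + k) u w.
Proof.
move=> [x [x0 xj H1 H2]] [y [y0 yk H3 H4]].
exists (fun t => if t <= j then x t else y (t - j)); split=> //.
- have [k0|k0] := posnP k; first by rewrite k0 addn0 leqnn xj -yk k0 y0.
  by rewrite leqNgt -{1}[j]addn0 ltn_add2l k0 /= addKn.
- move=> t Ht; have [lt|ge] := ltnP t j; first by rewrite ltnW //; apply: H1.
  have [->|ne] := eqVneq t j; first by rewrite leqnn subSnn xj -y0; apply: H3; slia.
  have -> : t <= j = false by slia.
  by rewrite subSn //; apply: H3; slia.
- by move=> t Ht; case: leqP => C; [apply: H2 | apply: H4; slia].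
Qed.

Lemma wkb_awalk (A : pred T) k u v : A u -> wkb (cst A) k u v -> awalk A k u v.
Proof.
move=> Au /wkbP[x [x0 xk H]]; exists x; split=> // [i /H /and3P[]//|[|i] ik]; first by rewrite x0.
by have /and3P[] := H i ik.
Qed.

Lemma awalk_wkb (A : pred T) k u v : awalk A k u v -> wkb (cst A) k u v.
Proof.
move=> [x [x0 xk H1 H2]]; apply/wkbP; exists x; split=> // i ik.
by rewrite /cstep H1 // !H2 //; slia.
Qed.

(** [0 < j2] leaves out the far end of a segment, so that consecutive segments need not share a
    vertex. *)
Definition spot (A : pred T) (x : 'I_5 -> T) (a : 'I_5 -> nat) i v : Prop :=
  exists j1 j2, [/\ j1 + j2 = a i, 0 < j2, wkb (cst A) j1 (x i) v
                  & wkb (cst A) j2 v (x (ordS i))].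

(** Two of five segments in cyclic order are equal, consecutive or one apart, and two consecutive
    segments still span less than half of the hole, where distances along it are exact. This is the
    reason for the number five. *)
Definition hole_frame (A : pred T) (x : 'I_5 -> T) (a : 'I_5 -> nat) : Prop :=
  [/\ forall i, 0 < a i /\ wkb (cst A) (a i) (x i) (x (ordS i)),
      forall i b, b < a i -> ~~ wkb (cst A) b (x i) (x (ordS i)),
      forall i v v', spot A x a i v -> spot A x a (ordS i) v' ->
        v != v' /\ (adj v v' -> v' = x (ordS i)),
      forall i v v', spot A x a i v -> spot A x a (ordS (ordS i)) v' -> v != v' /\ ~~ adj v v'
    & (\sum_i a i) %% 4 = 2].

(** No shorter walk exists, so thinning a walk of length [a i] to an induced path keeps its length.
    The clauses on [spot] then say that the five paths meet only in their common ends. *)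
Lemma hole_frame_sound A x a : hole_frame A x a -> unb adj.
Proof.
move=> [H0 Hmin H1 H2 H4].
have /fin_all_exists[y Hy] i : exists y, [/\ ipath y (a i), y 0 = x i, y (a i) = x (ordS i)
    & forall t, t < a i -> spot A x a i (y t)].
  have [a0 /wkbP[w [w0 wa Hw]]] := H0 i.
  have [||y [m [ml y0 ym Hy [Ay Iy]]]] := @walk_ipath _ adj A w (a i).
  - by split=> j Hj; [have /and3P[] := Hw j Hj | have /and3P[] := Hw j ltac:(slia)].
  - by rewrite w0 wa; apply: contraNneq (Hmin i 0 a0) => /= ->.
  have Aw j : j <= a i -> A (w j).
    by case: j => [|j] Hj; [have /and3P[] := Hw 0 a0 | have /and3P[] := Hw j Hj].
  have yA j : j <= m -> A (y j).
    move=> jm; have [->|j0] := posnP j; first by rewrite y0; apply: Aw.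
    have [->|jm'] := eqVneq j m; first by rewrite ym; apply: Aw.
    by apply: Iy; slia.
  have yw j k : j <= k <= m -> wkb (cst A) (k - j) (y j) (y k).
    move=> jk; apply/wkbP; exists (fun t => y (j + t)); rewrite addn0 subnKC; last by slia.
    by split=> // t Ht; rewrite addnS /cstep Ay ?yA //; slia.
  have ma : m = a i.
    apply/eqP; rewrite eqn_leq ml leqNgt; apply/negP => lt.
    have := Hmin i m lt; have := yw 0 m (leqnn m).
    by rewrite subn0 y0 ym w0 wa => ->.
  have yE : y (a i) = x (ordS i) by rewrite -wa -ym ma.
  rewrite ma in Hy yw; exists y; split; rewrite ?y0 //.
  move=> t Ht; exists t, (a i - t); split; try slia.
    by have := yw 0 t ltac:(slia); rewrite subn0 y0 w0.
  by have := yw t (a i) ltac:(slia); rewrite yE.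
pose o k : 'I_5 := iter k (@ordS 5) ord0.
have o5 k : o (k + 5) = o k.
  elim: k => [|k IH]; first by apply/val_inj.
  by rewrite addSn /o !iterS -/(o _) -/(o k) IH.
have Yp k t : t < a (o k) -> spot A x a (o k) (y (o k) t) by move=> Ht; have [_ _ _ H] := Hy (o k); apply: H.
have yI k : ipath (y (o k)) (a (o k)) by have [] := Hy (o k).
have y0 k : y (o k) 0 = x (o k) by have [] := Hy (o k).
have yE k : y (o k) (a (o k)) = x (o k.+1) by have [] := Hy (o k).
have a0 k : 0 < a (o k) by have [] := H0 (o k).
have X1 k s t : s < a (o k) -> 0 < t < a (o k.+1) -> y (o k) s != y (o k.+1) t /\ ~~ adj (y (o k) s) (y (o k.+1) t).
  move=> Hs Ht; have [N M] := H1 (o k) _ _ (Yp k s Hs) (Yp k.+1 t ltac:(slia)).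
  split=> //; apply/negP => /M E; have [] := yI k.+1 0 t ltac:(slia); by rewrite E y0 eqxx.
have X2 k s t : s < a (o k) -> t < a (o k.+2) -> y (o k) s != y (o k.+2) t /\ ~~ adj (y (o k) s) (y (o k.+2) t).
  by move=> Hs Ht; apply: H2 (Yp k s Hs) (Yp k.+2 t Ht).
have X1' k s t : s < a (o k) -> 0 < t <= a (o k.+1) -> y (o k) s != y (o k.+1) t /\ ~~ adj (y (o k) s) (y (o k.+1) t).
  move=> Hs Ht; have [->|ne] := eqVneq t (a (o k.+1)); last by apply: X1; slia.
  by rewrite yE -y0; apply: X2.
have X3 k s t : s < a (o k) -> t < a (o k.+3) -> y (o k) s != y (o k.+3) t /\ ~~ adj (y (o k) s) (y (o k.+3) t).
  move=> Hs Ht; rewrite eq_sym adjC; rewrite -(o5 k) in Hs *.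
  by rewrite addnC in Hs *; apply: (X2 k.+3).
have X2' k s t : s < a (o k) -> t <= a (o k.+2) -> y (o k) s != y (o k.+2) t /\ ~~ adj (y (o k) s) (y (o k.+2) t).
  move=> Hs Ht; have [->|ne] := eqVneq t (a (o k.+2)); last by apply: X2; slia.
  by rewrite yE -y0; apply: X3.
have C01 := ipath_cat (yI 0) (yI 1) (etrans (yE 0) (esym (y0 1))) (X1' 0).
have C012 : ipath (fun i => if i <= a (o 0) + a (o 1) then (if i <= a (o 0) then y (o 0) i else y (o 1) (i - a (o 0)))
     else y (o 2) (i - (a (o 0) + a (o 1)))) (a (o 0) + a (o 1) + a (o 2)).
  apply: ipath_cat C01 (yI 2) _ _.
    have -> : (a (o 0) + a (o 1) <= a (o 0)) = false by have := a0 1; slia.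
    by rewrite addKn yE y0.
  move=> i j Hi Hj; case: leqP => C.
    have [E|ne] := eqVneq i (a (o 0)); last by apply: X2'; slia.
    by rewrite E yE -y0; apply: X1' => //; have := a0 1; slia.
  by apply: X1'; slia.
have C34 := ipath_rev adjC (ipath_cat (yI 3) (yI 4) (etrans (yE 3) (esym (y0 4))) (X1' 3)).
have E5 : o 5 = o 0 by apply/val_inj.
have rep1 i : 0 < i < a (o 0) + a (o 1) + a (o 2) -> exists k t, [/\ t < a (o k),
    [\/ k = 0 /\ 0 < t, k = 1 | k = 2]
  & (if i <= a (o 0) + a (o 1) then (if i <= a (o 0) then y (o 0) i else y (o 1) (i - a (o 0)))
     else y (o 2) (i - (a (o 0) + a (o 1)))) = y (o k) t].
  move=> Hi; have [lt|ge] := ltnP i (a (o 0)).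
    by exists 0, i; split; [slia | constructor 1; slia | rewrite !ifT //; slia].
  have [lt|ge'] := ltnP i (a (o 0) + a (o 1)).
    exists 1, (i - a (o 0)); split; [slia | by constructor 2 | rewrite ifT; last by slia].
    case: leqP => C //; have -> : i = a (o 0) by slia.
    by rewrite subnn yE y0.
  exists 2, (i - (a (o 0) + a (o 1))); split; [slia | by constructor 3 | ].
  case: leqP => C //; have -> : i = a (o 0) + a (o 1) by slia.
  rewrite subnn y0 ifF; last by have := a0 1; slia.
  by rewrite addKn yE.
have rep2 i : 0 < i < a (o 3) + a (o 4) -> exists k t, [/\ t < a (o k),
    k = 3 /\ 0 < t \/ k = 4 & (if i <= a (o 3) then y (o 3) i else y (o 4) (i - a (o 3))) = y (o k) t].
  move=> Hi; have [lt|ge] := ltnP i (a (o 3)).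
    by exists 3, i; split; [slia | left; slia | rewrite ifT //; slia].
  exists 4, (i - a (o 3)); split; [slia | by right | ].
  case: leqP => C //; have -> : i = a (o 3) by slia.
  by rewrite subnn yE y0.
have [||||i j Hi Hj|h [Hh _ _]] := glue adjC C012 C34.
- rewrite subn0 y0 ifF; last by have := a0 4; slia.
  by rewrite addKn yE E5.
- rewrite subnn ifF; last by have := a0 2; slia.
  by rewrite addKn yE y0.
- by have := a0 0; have := a0 1; slia.
- by have := a0 3; have := a0 4; slia.
- have [k [t [Ht kE ->]]] := rep1 i Hi.
  have [k' [t' [Ht' kE' ->]]] := rep2 _ (ltac:(slia) : 0 < a (o 3) + a (o 4) - j < a (o 3) + a (o 4)).
  case: kE Ht => [[-> t0]|->|->] Ht; case: kE' Ht' => [[-> t0']|->] Ht'.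
  + exact: X3.
  + by rewrite eq_sym adjC -E5; rewrite -E5 in Ht; apply: (X1 4) => //; rewrite t0.
  + exact: X2.
  + exact: X3.
  + by apply: X1 => //; rewrite t0'.
  + exact: X2.
have sE : \sum_i a i = a (o 0) + a (o 1) + a (o 2) + (a (o 3) + a (o 4)).
  rewrite !big_ord_recl big_ord0 addn0 !addnA; congr (_ + _ + _ + _ + _); congr a; exact/val_inj.
rewrite sE in H4; exists (a (o 0) + a (o 1) + a (o 2) + (a (o 3) + a (o 4))), h; split=> //.
by move: H4; have := a0 0; have := a0 1; have := a0 2; have := a0 3; have := a0 4; clear; slia.
Qed.

(** [x] and [y] are meant as the common neighbours of the major vertices of the two sides; deleting
    their neighbours other than the two on the hole removes every major vertex. *)
Definition clean (x xm xp y ym yp : T) : pred T := fun v =>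
  (adj v x ==> (v == xm) || (v == xp)) && (adj v y ==> (v == ym) || (v == yp)).

Lemma hole_frame_complete c n : smallest c n -> 6 < n -> theta_free -> tent_free ->
  exists z, exists x a, (forall i, a i < #|T|) /\
    hole_frame (let '(u, um, up, v, vm, vp) := z in clean u um up v vm vp) x a.
Proof.
move=> Cm n6 TF TNF; have [n5 n4 Hc cmin] := Cm; have [P _] := Hc.
have n10 : 10 <= n by slia.
have [k1 K1] := majors_common adjC bip true Cm n6 TF.
have [k2 K2] := majors_common adjC bip false Cm n6 TF.
pose A := clean (c k1) (c (k1 + n.-1)) (c k1.+1) (c k2) (c (k2 + n.-1)) (c k2.+1).
exists (c k1, c (k1 + n.-1), c k1.+1, c k2, c (k2 + n.-1), c k2.+1); rewrite -/A.
have AC i : A (c i).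
  have H k : adj (c i) (c k) ==> (c i == c (k + n.-1)) || (c i == c k.+1).
    apply/implyP; have [j [Hj <-]] := phole_rep k i Hc ltac:(slia).
    have [->|jk] := eqVneq j k; first by rewrite (negbTE (side_irr bip _)).
    rewrite adjC (phole_adj Hc); last by slia.
    case/orP => /eqP E; first by rewrite E eqxx orbT.
    have -> : j = k + n.-1 by slia.
    by rewrite eqxx.
  by rewrite /A /clean !H.
have minor v : A v -> (forall k, v != c k) -> ~ maj c n v.
  move=> /andP[/implyP A1 /implyP A2] vN vM; case E: (side v).
    by have := A1 (K1 v vN vM E); rewrite !(negbTE (vN _)).
  by have := A2 (K2 v vN vM E); rewrite !(negbTE (vN _)).
have iso := isometry Cm TF TNF AC minor.
(* The [k]-th point is at position [pos k]: the first [r] segments have length [q + 1], the others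
   [q], and [n >= 10] gives [q >= 2]. *)
pose q := n %/ 5; pose r := n %% 5; pose pos k := k * q + minn k r.
have nE : n = 5 * q + r by rewrite /q /r; slia.
have r5 : r < 5 by rewrite /r; slia.
have q2 : 2 <= q by rewrite /q; slia.
have qb : r = 0 /\ 4 * q < n \/ 4 * q + 4 < n by rewrite /q /r; clear -n4 n10; slia.
pose b (i : 'I_5) := q + (i < r).
pose x (i : 'I_5) := c (pos i).
have posS (i : nat) : pos i.+1 = pos i + (q + (i < r)) by rewrite /pos mulSn /minn; clear; case: (ltnP i r); case: (ltnP i.+1 r) => /=; slia.
have pos5 : pos 5 = n by rewrite /pos nE /minn; clear -r5; case: ltnP; slia.
have xs (i : 'I_5) t : c (pos i + b i + t) = c (pos (ordS i) + t).
  rewrite /b -posS /=; have [E|ne] := eqVneq i.+1 5.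
    by rewrite E pos5 modnn addnC P /pos mul0n min0n.
  by rewrite modn_small //; have := ltn_ord i; slia.
have xS (i : 'I_5) : c (pos i + b i) = x (ordS i) by have := xs i 0; rewrite !addn0.
have b2 i : 2 <= b i by rewrite /b; slia.
have bb i j : b i + b j < n - (b i + b j) by rewrite /b; clear -qb; case: (i < r) / idP; case: (j < r) / idP => /=; slia.
have bn i : b i < n by have := bb i i; slia.
have D1 i l : awalk A l (x i) (x (ordS i)) -> b i <= l.
  rewrite -xS => /iso; rewrite bn (ltac:(have := b2 i; slia) : 0 < b i) => /(_ isT).
  by have := bb i i; have := b2 i; rewrite /long; clear; case: eqP; slia.
have D2 i l : awalk A l (x i) (x (ordS (ordS i))) -> b i + b (ordS i) <= l.
  rewrite -xS -xs -addnA => /iso; have := bb i (ordS i); have := b2 i; have := b2 (ordS i).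
  move: (b i) (b (ordS i)) => u v; clear -n5 => H1 H2 H3 H; move: (H ltac:(slia)).
  by rewrite /long; case: eqP; slia.
have spA i v : spot A x b i v -> exists j1 j2, [/\ j1 + j2 = b i, 0 < j2, awalk A j1 (x i) v & awalk A j2 v (x (ordS i))].
  move=> [j1 [j2 [E j0 W1 W2]]]; exists j1, j2.
  have W := wkb_awalk (AC _) W1; split=> //; apply: wkb_awalk W2.
  by have [w [_ <- _ H]] := W; apply: H.
have aE u v : A u -> A v -> adj u v -> awalk A 1 u v.
  by move=> Hu Hv uv; exists (fun t => if t is 0 then u else v); split=> // -[|[]].
have Aend j u v : awalk A j u v -> A u /\ A v.
  by move=> [w [<- <- _ H]]; split; apply: H.
exists x, b; split.
  move=> i; have : #|arc c 0 n| = n by apply: card_arc_inj => u v uv; apply: (phole_neq Hc); slia.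
  by have := max_card (mem (arc c 0 n)) => H1 H2; have := bn i; rewrite H2 in H1; slia.
split.
- move=> i; split; first by have := b2 i; slia.
  apply: awalk_wkb; rewrite -xS; exists (fun t => c (pos i + t)); split; rewrite ?addn0 //.
  by move=> t _; rewrite addnS; apply: phole_adjS Hc _; slia.
- by move=> i l lb; apply/negP => /(wkb_awalk (AC _)) /D1; slia.
- move=> i v v' /spA[j1 [j2 [E j0 W1 W2]]] /spA[i1 [i2 [E' i0 V1 V2]]]; split.
    apply/eqP => vv; rewrite -vv in V2; have := D2 i _ (awalk_cat W1 V2); slia.
  move=> vv; have [_ Av] := Aend _ _ _ W1; have [_ Av'] := Aend _ _ _ V1.
  have := D2 i _ (awalk_cat (awalk_cat W1 (aE _ _ Av Av' vv)) V2) => H.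
  have i10 : i1 = 0 by slia.
  by move: V1; rewrite i10 => -[w [<- <- _ _]].
- move=> i v v' /spA[j1 [j2 [E j0 W1 W2]]] /spA[i1 [i2 [E' i0 V1 V2]]].
  (* A connection of length [k] gives walks from point [i] to point [i + 2] and from point [i + 1]
     to point [i + 3]. Adding the two distance bounds yields [b (ordS i) <= k], while
     [b (ordS i) >= 2]. *)
  have H k : awalk A k v v' -> k <= 1 -> False.
    move=> K k1'; have := D2 i _ (awalk_cat (awalk_cat W1 K) (awalk_sym adjC V1)).
    have := D2 (ordS i) _ (awalk_cat (awalk_cat (awalk_sym adjC W2) K) V2).
    by have := b2 (ordS i); slia.
  have [_ Av] := Aend _ _ _ W1; have [_ Av'] := Aend _ _ _ V1.
  split; first by apply/eqP => vv; apply: (H 0) => //; exists (fun=> v); split=> //; rewrite vv.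
  by apply/negP => vv; apply: (H 1) => //; apply: aE.
- have -> : \sum_i b i = n by rewrite /b !big_ord_recl big_ord0 /= /bump /= nE; clear -r5; do 4 case: ltnP => /= ?; slia.
  exact: n4.
Qed.

End HoleFrame.

(** * Balanced matrices and odd suns *)

Definition osun (I J : Type) (r : I -> J -> bool) : Prop :=
  exists l (u : 'I_l -> I) (v : 'I_l -> J), [/\ 3 <= l, odd l &
    forall i j, r (u i) (v j) = (j == i) || (j == ordS i)].

Lemma ordS_neq l (i : 'I_l) : 2 <= l -> ordS i != i.
Proof.
move=> l2; apply/eqP => /(congr1 (@nat_of_ord l)) /=; have := ltn_ord i => il.
have [E|ne] := eqVneq i.+1 l; first by rewrite E modnn; slia.
by rewrite modn_small; slia.
Qed.

Lemma ordS2_neq l (i : 'I_l) : 3 <= l -> ordS (ordS i) != i.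
Proof.
move=> l2; apply/eqP => /(congr1 (@nat_of_ord l)) /=; have := ltn_ord i => il.
have [E|ne] := eqVneq i.+1 l; first by rewrite E modnn modn_small; slia.
rewrite (@modn_small i.+1); last by slia.
have [E|ne'] := eqVneq i.+2 l; first by rewrite E modnn; slia.
by rewrite modn_small; slia.
Qed.

Lemma osun_row_inj I J r l (u : 'I_l -> I) (v : 'I_l -> J) : 3 <= l ->
  (forall i j, r (u i) (v j) = (j == i) || (j == ordS i)) -> injective u.
Proof.
move=> l3 H i i' E.
have := H i' i; rewrite -E H eqxx /= => /esym/orP[/eqP //|/eqP iE].
have := H i' (ordS i); rewrite -E H eqxx orbT => /esym/orP[/eqP E2|/eqP/ordS_inj //].
by have := ordS2_neq i' l3; rewrite -iE E2 eqxx.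
Qed.

Lemma osun_col_inj I J r l (u : 'I_l -> I) (v : 'I_l -> J) : 3 <= l ->
  (forall i j, r (u i) (v j) = (j == i) || (j == ordS i)) -> injective v.
Proof.
move=> l3 H j j' E.
have := H j j'; rewrite -E H eqxx /= => /esym/orP[/eqP //|/eqP jE].
have := H (ord_pred j) j'; rewrite -E H ord_predK eqxx orbT => /esym/orP[/eqP E2|/eqP //].
have := ordS2_neq (ord_pred j) l3; rewrite ord_predK -jE E2.
by rewrite eqxx.
Qed.

Lemma two_ones_sun l (B : 'M[bool]_l) : 3 <= l ->
  (forall i j, B i j = (j == i) || (j == ordS i)) -> two_ones_mx B.
Proof.
move=> l3 H; split=> [i|j].
  have -> : [set j | B i j] = [set i; ordS i] by apply/setP => j; rewrite !inE H.
  by rewrite cards2 eq_sym ordS_neq //; slia.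
have -> : [set i | B i j] = [set j; ord_pred j].
  apply/setP => i; rewrite !inE H eq_sym; congr (_ || _).
  by apply/eqP/eqP => [->|->]; rewrite ?ordSK ?ord_predK.
by rewrite cards2 -{1}(ord_predK j) ordS_neq //; slia.
Qed.

Section Darts.
Variables (k : nat) (B : 'M[bool]_k).
Hypothesis HB : two_ones_mx B.
Hypothesis kodd : odd k.

Let D := {d : 'I_k * 'I_k | B d.1 d.2}.
Let row (d : D) := (sval d).1.
Let col (d : D) := (sval d).2.

Let dB (d : D) : B (row d) (col d). Proof. exact: (svalP d). Qed.
Let dE (d d' : D) : row d = row d' -> col d = col d' -> d = d'.
Proof.
rewrite /row /col; move=> E1 E2; apply: val_inj => /=.
by case: (val d) (val d') E1 E2 => [a b] [a' b'] /= -> ->.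
Qed.

Let three (T : finType) (S : {set T}) a b c : #|S| = 2 -> a \in S -> b \in S -> c \in S ->
  a != b -> c = a \/ c = b.
Proof.
move=> S2 aS bS cS ab; have : c \in [set a; b]; last by rewrite !inE => /orP[]/eqP; [left | right].
suff -> : [set a; b] = S by [].
by apply/eqP; rewrite eqEcard subUset !sub1set aS bS cards2 ab S2.
Qed.

Let other (T : finType) (S : {set T}) a : #|S| = 2 -> a \in S -> exists2 b, b \in S & b != a.
Proof.
move=> S2 aS; have : 0 < #|S :\ a| by have := cardsD1 a S; rewrite aS S2; slia.
by case/card_gt0P => b; rewrite !inE => /andP[ba bS]; exists b.
Qed.

Let rho_ex (d : D) : exists d', row d' = row d /\ col d' != col d.
Proof.
have [] := @other _ [set j | B (row d) j] (col d) (HB.1 _); first by rewrite inE.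
by move=> j; rewrite inE => Bj nj; exists (exist _ (row d, j) Bj).
Qed.

Let tau_ex (d : D) : exists d', col d' = col d /\ row d' != row d.
Proof.
have [] := @other _ [set i | B i (col d)] (row d) (HB.2 _); first by rewrite inE.
by move=> j; rewrite inE => Bj nj; exists (exist _ (j, col d) Bj).
Qed.

(* The 1-entries of B are joined to the other entry of their row by [rho] and to the
   other entry of their column by [tau]; an orbit of [rho \o tau] is a cycle with one
   of its two orientations. *)
Lemma two_ones_osun : osun (fun i j => B i j).
Proof.
have /fin_all_exists[rho Hrho] := rho_ex; have /fin_all_exists[tau Htau] := tau_ex.
have rU d d' : row d' = row d -> d' = d \/ d' = rho d.
  move=> E; have [R1 R2] := Hrho d.
  have A1 : col (rho d) \in [set j | B (row d) j] by rewrite inE -R1.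
  have A2 : col d \in [set j | B (row d) j] by rewrite inE.
  have A3 : col d' \in [set j | B (row d) j] by rewrite inE -E.
  by have [C|C] := three (HB.1 _) A1 A2 A3 R2; [right | left]; apply: dE; rewrite ?R1.
have tU d d' : col d' = col d -> d' = d \/ d' = tau d.
  move=> E; have [R1 R2] := Htau d.
  have A1 : row (tau d) \in [set i | B i (col d)] by rewrite inE -R1.
  have A2 : row d \in [set i | B i (col d)] by rewrite inE.
  have A3 : row d' \in [set i | B i (col d)] by rewrite inE -E.
  by have [C|C] := three (HB.2 _) A1 A2 A3 R2; [right | left]; apply: dE; rewrite ?R1.
have rhoN d : rho d <> d by have [_ N] := Hrho d; move=> E; rewrite E eqxx in N.
have tauN d : tau d <> d by have [_ N] := Htau d; move=> E; rewrite E eqxx in N.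
have rhoK : involutive rho.
  by move=> d; have [|E|//] := rU (rho d) d; [have [] := Hrho d | case: (rhoN d)].
have tauK : involutive tau.
  by move=> d; have [|E|//] := tU (tau d) d; [have [] := Htau d | case: (tauN d)].
pose phi d := rho (tau d).
have phiI : injective phi by move=> a b /(inv_inj rhoK)/(inv_inj tauK).
have itI n : injective (iter n phi) by elim: n => // n IH a b /phiI/IH.
have phiR d n : iter n phi (rho (iter n phi d)) = rho d.
  elim: n d => // n IH d; rewrite iterS iterSr IH /phi rhoK.
  by rewrite tauK.
(* If the orbit of [d] met [rho d], both orientations of the cycle would coincide, and halfway
   between the two entries [rho] or [tau] would have a fixed point. *)
have orbR d n : iter n phi d <> rho d.
  move=> E; set t := n./2; pose e := iter t phi d.
  have E1 : iter t phi (rho e) = rho d by exact: phiR.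
  have [no|no] := boolP (odd n).
    have nE : n = t + t.+1 by rewrite /t; slia.
    move: E; rewrite -E1 nE iterD => /(itI t) E.
    have : iter t.+1 phi d = phi e by [].
    by rewrite E /phi => /(inv_inj rhoK)/esym/tauN.
  have nE : n = t + t by rewrite /t; slia.
  by move: E; rewrite -E1 nE iterD => /(itI t)/esym/rhoN.
have rootR d n : froot phi (rho (iter n phi d)) = froot phi (rho d).
  apply/eqP; rewrite root_connect; last exact: fconnect_sym.
  by rewrite -(phiR d n) fconnect_iter.
pose cl i := [set froot phi d | d : D & row d == i].
have cl_row d : cl (row d) = [set froot phi d; froot phi (rho d)].
  apply/setP => z; apply/imsetP/set2P => [[d']|].
    rewrite inE => /eqP/rU[->|->] ->; by [left | right].
  case=> ->; first by exists d; rewrite ?inE.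
  by exists (rho d) => //; rewrite inE; have [-> _] := Hrho d.
(* [cl i] is the set of the two orbits through row [i], that is, its cycle without orientation.
   These classes partition an odd number of rows, so one of them is odd. *)
have [i0 oi0] : exists i0, odd #|[set i | cl i == cl i0]|.
  have : odd (\sum_(C : {set D}) #|[set i | cl i == C]|).
    suff -> : \sum_(C : {set D}) #|[set i | cl i == C]| = k by [].
    rewrite -[RHS]card_ord -sum1_card (partition_big cl xpredT) //=.
    by apply: eq_bigr => C _; rewrite -sum1_card; apply: eq_bigl => i; rewrite inE.
  have H (s : seq {set D}) : odd (\sum_(C <- s) #|[set i | cl i == C]|) -> exists C, odd #|[set i | cl i == C]|.
    elim: s => [|C s IH]; first by rewrite big_nil.
    by rewrite big_cons oddD; case E: (odd #|_|); [exists C | rewrite addFb].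
  case/H => C oC; have : 0 < #|[set i | cl i == C]| by move: oC; case: #|_|.
  by case/card_gt0P => i0; rewrite inE => /eqP E; exists i0; rewrite E.
have [j0 Bj0] : exists j0, B i0 j0.
  have : 0 < #|[set j | B i0 j]| by rewrite HB.1.
  by case/card_gt0P => j; rewrite inE; exists j.
pose d0 : D := exist _ (i0, j0) Bj0.
pose l := order phi d0; pose e (i : 'I_l) := iter i phi d0.
have eI : injective e.
  move=> i i' E; apply/val_inj; have := congr1 (findex phi d0) E.
  by rewrite !findex_iter ?ltn_ord.
have l0 : 0 < l by apply: order_gt0.
have eS i : e (ordS i) = phi (e i).
  rewrite /e /=; have [E|ne] := eqVneq i.+1 l.
    by rewrite E modnn /= -iterS E iter_order.
  by rewrite modn_small //; have := ltn_ord i; slia.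
have eR i i' : e i <> rho (e i').
  have [s Es] : exists s, e i = iter s phi (e i').
    exists (i + (l - i')); rewrite /e -iterD -addnA subnK ?(ltnW (ltn_ord _)) //.
    by rewrite iterD iter_order.
  by rewrite Es; apply: orbR.
have rI : injective (fun i => row (e i)).
  by move=> i i' /= E; have [/eI //|/eR] := rU _ _ E.
have lE : l = #|[set i | cl i == cl i0]|.
  rewrite -[LHS]card_ord -(card_imset _ rI); apply: eq_card => i; rewrite inE.
  have cl0 : cl i0 = cl (row d0) by [].
  apply/imsetP/eqP => [[t _ ->]|E].
    rewrite cl0 !cl_row rootR; congr [set _; _].
    by apply/esym/eqP; rewrite root_connect ?fconnect_iter //; exact: fconnect_sym.
  have : froot phi d0 \in cl i by rewrite E cl0 cl_row set21.
  case/imsetP => d; rewrite inE => /eqP <- /eqP; rewrite root_connect; last exact: fconnect_sym.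
  move=> C; have fl : findex phi d0 d < l by apply: findex_max.
  by exists (Ordinal fl) => //; rewrite /e /= iter_findex.
have lo : odd l by rewrite lE.
have l1 : l <> 1.
  move=> E; pose z := Ordinal l0; have := eS z.
  have -> : ordS z = z by apply/val_inj; rewrite /= E modn1.
  move=> E1; have : row (rho (tau (e z))) = row (e z) by rewrite {2}E1.
  have [-> _] := Hrho (tau (e z)); have [_] := Htau (e z).
  by move=> N E2; rewrite E2 eqxx in N.
exists l, (fun i => row (e i)), (fun j => col (e (ord_pred j))); split=> //; first by slia.
move=> i j; have cI i1 i2 : col (e i1) = col (e i2) -> i1 = i2.
  move=> E; have [/eI //|E1] := tU _ _ E.
  by case: (eR (ordS i2) i1); rewrite eS /phi -E1.
apply/idP/orP => [Bij|[/eqP ->|/eqP ->]]; last first.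
- by rewrite ordSK.
- have := eS (ord_pred i); rewrite ord_predK => ->.
  have [-> _] := Hrho (tau (e (ord_pred i))); have [<- _] := Htau (e (ord_pred i)).
  exact: dB.
pose y : D := exist _ (row (e i), col (e (ord_pred j))) Bij.
have [E|E] := rU (e i) y (erefl _).
  have : col (e i) = col (e (ord_pred j)) by rewrite -E.
  by move/cI => E'; right; rewrite E' ord_predK.
left; have : col (e (ord_pred i)) = col (e (ord_pred j)).
  have := eS (ord_pred i); rewrite ord_predK => E1.
  have <- : col y = col (e (ord_pred j)) by [].
  by rewrite E E1 /phi rhoK; have [] := Htau (e (ord_pred i)).
by move/cI/(congr1 (@ordS l)); rewrite !ord_predK => ->.
Qed.

End Darts.

Lemma balanced_osun m n (A : 'M[bool]_(m, n)) : balanced_mx A <-> ~ osun (fun i j => A i j).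
Proof.
split=> [H [l [u [v [l3 lo E]]]]|H k f g ko fI gI /two_ones_osun-/(_ ko)[l [u [v [l3 lo E]]]]].
  apply: (H l u v lo) => //.
  - exact: osun_row_inj E.
  - exact: osun_col_inj E.
  - by apply: two_ones_sun => // i j; rewrite mxE.
apply: H; exists l, (fun i => f (u i)), (fun j => g (v j)); split=> // i j.
by have := E i j; rewrite mxE.
Qed.

(** * Square roots and maximal cliques *)

Section Squares.
Variables (T : finType).
Implicit Types (e h : rel T) (K S : {set T}).

Lemma cliqueP e K : reflect {in K &, forall x y, x != y -> e x y} (clique e K).
Proof.
apply: (iffP forall_inP) => [H x y xK yK xy|H x xK].
  by have /forall_inP/(_ y yK)/implyP := H x xK; apply.
by apply/forall_inP => y yK; apply/implyP; apply: H.
Qed.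

Lemma independentP e S : reflect {in S &, forall x y, ~~ e x y} (independent e S).
Proof.
apply: (iffP forall_inP) => [H x y xS yS|H x xS]; first by have /forall_inP := H x xS; apply.
by apply/forall_inP => y yS; apply: H.
Qed.

Lemma squareE h x y : simple_graph h ->
  square h x y = (x != y) && (h x y || [exists z, h x z && h z y]).
Proof.
move=> [hC hI].
have W0 : has_walk h x y 0 = (x == y).
  by apply/existsP/idP => [[p]|xy]; [rewrite (tuple0 p) | exists [tuple]].
have W1 : has_walk h x y 1 = h x y.
  apply/existsP/idP => [[p]|xy]; last by exists [tuple y]; rewrite /= xy eqxx.
  by case/tupleP: p => z p; rewrite (tuple0 p) /= andbT => /andP[xz /eqP <-].
have W2 : has_walk h x y 2 = [exists z, h x z && h z y].
  apply/existsP/existsP => [[p]|[z /andP[xz zy]]]; last by exists [tuple z; y]; rewrite /= xz zy eqxx.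
  case/tupleP: p => z p; case/tupleP: p => w p; rewrite (tuple0 p) /= andbT => /andP[/andP[xz zw] /eqP <-].
  by exists z; rewrite xz.
rewrite /square /at_distance W2.
have -> : [forall j : 'I_2, ~~ has_walk h x y j] = (x != y) && ~~ h x y.
  apply/forallP/andP => [H|[N0 N1] [[|[|//]] Hj]]; rewrite /= ?W0 ?W1 //.
  by have := H ord0; have := H (lift ord0 ord0); rewrite /= W0 W1.
have [->|xy] := eqVneq x y; first by rewrite hI.
by case: (h x y); case: [exists z, _].
Qed.

(** An isolated vertex is a maximal clique by itself. It lies in no sun and does not obstruct a
    disconnected root, but it would spoil the common intersection of the cliques. *)
Definition edge_cliques e : {set {set T}} := [set K in max_cliques e | 1 < #|K|].

Lemma max_cliqueP e K : reflect (clique e K /\ forall K', clique e K' -> K \subset K' -> K' = K)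
  (K \in max_cliques e).
Proof. by rewrite inE; apply: maxsetP. Qed.

Lemma clique_max e K : clique e K -> exists2 K', K' \in max_cliques e & K \subset K'.
Proof. by move=> /maxset_exists[K' M sub]; exists K' => //; rewrite inE. Qed.

Lemma clique2 e x y : symmetric e -> e x y -> clique e [set x; y].
Proof.
by move=> eC xy; apply/cliqueP => a b /set2P[]-> /set2P[]->; rewrite ?eqxx // eC.
Qed.

Lemma edge_clique e x y : simple_graph e -> e x y ->
  exists2 K, K \in edge_cliques e & (x \in K) && (y \in K).
Proof.
move=> [eC eI] xy; have [K KM] := clique_max (clique2 eC xy).
rewrite subUset !sub1set => /andP[xK yK]; exists K; rewrite ?xK //.
rewrite inE KM; apply/card_gt1P; exists x, y; split=> //.
by apply: contraTneq xy => ->; rewrite eI.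
Qed.

Lemma clique_adj e K x y : K \in edge_cliques e -> x \in K -> y \in K -> x != y -> e x y.
Proof. by rewrite inE => /andP[/max_cliqueP[/cliqueP H _] _]; apply: H. Qed.

(** The clique of an induced sun is forced into [K0]: a vertex [v_j] outside would have both its
    neighbours [u_j] and [u_(j-1)] in [K0], where they would be adjacent. A vertex [u_i] in [K0]
    would be adjacent to [v_(i+2)]. *)
Lemma split_osun h K0 : clique h K0 -> independent h (~: K0) -> simple_graph h ->
  odd_sun_free h <-> ~ osun (fun x w => [&& x \notin K0, w \in K0 & h x w]).
Proof.
move=> /cliqueP cK /independentP iK [hC hI]; split=> [F [l [u [v [l3 lo H]]]]|F l l3 lo [phi [phiI Hphi]]].
  have uv i : [&& u i \notin K0, v i \in K0 & h (u i) (v i)] by rewrite H eqxx.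
  have uN i : u i \in ~: K0 by have /and3P[] := uv i; rewrite inE.
  have vK i : v i \in K0 by have /and3P[] := uv i.
  have uI := @osun_row_inj _ _ (fun x w => [&& x \notin K0, w \in K0 & h x w]) _ _ _ l3 H.
  have vI := @osun_col_inj _ _ (fun x w => [&& x \notin K0, w \in K0 & h x w]) _ _ _ l3 H.
  have HE i j : h (u i) (v j) = (j == i) || (j == ordS i).
    by rewrite -H vK; have := uN i; rewrite inE => ->.
  apply: (F l l3 lo); exists (fun a => match a with inl i => u i | inr j => v j end); split.
    move=> [i|i] [j|j] // E.
    - by rewrite (uI _ _ E).
    - by have := uN i; rewrite E inE vK.
    - by have := uN j; rewrite -E inE vK.
    - by rewrite (vI _ _ E).
  move=> [i|i] [j|j] /=; rewrite ?HE // 1?hC ?HE //; first by apply/negbTE; apply: iK.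
  have [->|ij] := eqVneq i j; first by rewrite hI.
  by apply: cK => //; apply: contra_neq ij => /vI.
have vK j : phi (inr j) \in K0.
  apply/negPn/negP => vN.
  have a i : (j == i) || (j == ordS i) -> phi (inl i) \in K0.
    move=> ji; apply/negPn/negP => uN; have := Hphi (inl i) (inr j); rewrite /= ji.
    by apply/negP; apply: iK; rewrite inE.
  have := Hphi (inl j) (inl (ord_pred j)); rewrite /= => /negP; apply; apply: cK.
  - by apply: a; rewrite eqxx.
  - by apply: a; rewrite ord_predK eqxx orbT.
  - apply/eqP => /phiI[E]; have := ordS_neq (ord_pred j) (ltac:(slia) : 2 <= l).
    by rewrite ord_predK -E eqxx.
have uN i : phi (inl i) \notin K0.
  apply/negP => uK; have := Hphi (inl i) (inr (ordS (ordS i))).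
  rewrite /= (negbTE (ordS2_neq i l3)) (negbTE (ordS_neq _ _)) /=; last by slia.
  by move=> /negP; apply; apply: cK => //; apply/eqP => /phiI.
apply: F; exists l, (fun i => phi (inl i)), (fun j => phi (inr j)); split=> // i j.
by rewrite uN vK Hphi.
Qed.

Definition clique_osun e : Prop := osun (fun x K => (x \in K) && (K \in edge_cliques e)).

Section Root.
Variables (e h : rel T).
Hypotheses (hS : simple_graph h) (eh : e =2 square h).

Let eE x y : e x y = (x != y) && (h x y || [exists z, h x z && h z y]).
Proof. by rewrite eh squareE. Qed.

Section Part.
Variable K0 : {set T}.
Hypotheses (cK : clique h K0) (iK : independent h (~: K0)) (F : odd_sun_free h).

Let nb v := [set x | (x == v) || h x v].

Let nb_clique v : clique e (nb v).
Proof.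
have [hC hI] := hS; apply/cliqueP => x y; rewrite !inE eE => /orP[/eqP ->|xv] /orP[/eqP ->|yv] xy; rewrite xy /=.
- by rewrite eqxx in xy.
- by rewrite hC yv.
- by rewrite xv.
- by apply/orP; right; apply/existsP; exists v; rewrite xv hC.
Qed.

Let nb_K0 v : v \in K0 -> K0 \subset nb v.
Proof.
move=> vK; apply/subsetP => x xK; rewrite inE; have [//|xv] := eqVneq x v.
by move/cliqueP: cK; apply.
Qed.

Let nb_ind x z : x \notin K0 -> h x z -> z \in K0.
Proof.
move=> xN xz; apply/negPn/negP => zN; move/independentP: iK => /(_ x z).
by rewrite !inE xz => /(_ xN zN).
Qed.

(* The vertices of K outside the clique K0 have pairwise common neighbours; as there is
   no 3-sun, all of them have a common neighbour. *)
Lemma edge_clique_nb K : K \in edge_cliques e -> exists2 v, v \in K0 & K = nb v.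
Proof.
have [hC hI] := hS; move=> KE; have /andP[/max_cliqueP[KC Kmax] K2] : (K \in max_cliques e) && (1 < #|K|) by rewrite inE in KE.
suff [v vK sub] : exists2 v, v \in K0 & K :\: K0 \subset nb v.
  exists v => //; apply/esym/Kmax; first exact: nb_clique.
  apply/subsetP => x xK; have [xK0|xN] := boolP (x \in K0); first by apply: (subsetP (nb_K0 vK)).
  by apply: (subsetP sub); rewrite inE xN.
have hz x : x \in K -> exists z, h x z.
  move=> xK; have : 0 < #|K :\ x| by have := cardsD1 x K; rewrite xK; slia.
  case/card_gt0P => y; rewrite !inE => /andP[yx yK].
  have := clique_adj KE xK yK; rewrite eq_sym yx => /(_ isT); rewrite eE => /andP[_ /orP[xy|/existsP[z /andP[xz _]]]].
    by exists y.
  by exists z.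
have [E|SN] := eqVneq (K :\: K0) set0.
  have /card_gt0P[x xK] : 0 < #|K| by slia.
  have xK0 : x \in K0 by apply/negPn/negP => xN; have := in_set0 x; rewrite -E inE xN xK.
  by exists x => //; rewrite E sub0set.
have [||//|v Hv] := @helly3 _ _ (fun x v => (v \in K0) && h x v) (K :\: K0).
- move=> x y; rewrite !inE => /andP[xN xK] /andP[yN yK]; have [<-|xy] := eqVneq x y.
    by have [z xz] := hz x xK; exists z; rewrite andbb xz (nb_ind xN xz).
  have := clique_adj KE xK yK xy; rewrite eE xy /= => /orP[/(nb_ind xN)|/existsP[z /andP[xz zy]]].
    by rewrite (negbTE yN).
  by exists z; rewrite xz hC zy (nb_ind xN xz).
- move=> x1 x2 x3 j1 j2 j3; rewrite !inE => /andP[N1 _] /andP[N2 _] /andP[N3 _].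
  case/and5P=> /andP[J2 a12] /andP[J3 a13] /andP[J1 a21] /andP[_ a23] /andP[/andP[_ a31] /andP[_ a32]].
  rewrite J1 J2 J3 /=; apply/negPn/negP; rewrite !negb_or => /and3P[n11 n22 n33].
  have [H _] := split_osun cK iK hS; apply: (H F).
  pose u (i : 'I_3) := nth x1 [:: x3; x1; x2] i; pose v (i : 'I_3) := nth j1 [:: j1; j2; j3] i.
  exists 3, u, v; split=> // -[[|[|[|//]]] Hi] [[|[|[|//]]] Hj];
    by rewrite /u /v /= ?N1 ?N2 ?N3 ?J1 ?J2 ?J3 ?a12 ?a13 ?a21 ?a23 ?a31 ?a32 ?(negbTE n11) ?(negbTE n22) ?(negbTE n33).
have /set0Pn[x xS] := SN.
exists v; first by have /andP[] := Hv x xS.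
by apply/subsetP => y yS; rewrite inE; have /andP[_ ->] := Hv y yS; rewrite orbT.
Qed.

(** Each clique of the sun is the closed neighbourhood of some [w j] in [K0]. Every [u i] is outside
    [K0], since [K0] lies in all these cliques while [u i] misses one of them. *)
Lemma root_no_osun : ~ clique_osun e.
Proof.
have [hC hI] := hS; move=> [l [u [v [l3 lo H]]]].
have vE j : v j \in edge_cliques e by have := H j j; rewrite eqxx => /andP[].
have /fin_all_exists[w Hw] j : exists w, w \in K0 /\ v j = nb w.
  by have [x] := edge_clique_nb (vE j); exists x.
have [HF _] := split_osun cK iK hS; apply: (HF F).
exists l, u, w; split=> // i j; have [wK vj] := Hw j.
have uN : u i \notin K0.
  apply/negP => uK; have := H i (ordS (ordS i)).
  rewrite (negbTE (ordS2_neq i l3)) (negbTE (ordS_neq _ _)); last by slia.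
  have [wK' vj'] := Hw (ordS (ordS i)); rewrite vE andbT /= => /negbT/negP; apply.
  by rewrite vj'; apply: (subsetP (nb_K0 wK')).
rewrite uN wK -H vE andbT vj inE; case: eqVneq => // E.
by rewrite E wK in uN.
Qed.

Lemma root_count : #|edge_cliques e| <= #|\bigcap_(K in edge_cliques e) K|.
Proof.
apply: (@leq_trans #|K0|).
  apply: leq_trans (leq_imset_card nb K0); apply: subset_leq_card; apply/subsetP => K /edge_clique_nb[v vK ->].
  by apply/imsetP; exists v.
apply: subset_leq_card; apply/subsetP => x xK; apply/bigcapP => K /edge_clique_nb[v vK ->].
exact: (subsetP (nb_K0 vK)).
Qed.

End Part.
End Root.

(** * Construction of a square root *)

Section Build.
Variable e : rel T.
Hypotheses (eS : simple_graph e) (NO : ~ clique_osun e).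
Let E := edge_cliques e.
Let U := \bigcap_(K in E) K.
Hypothesis cnt : #|E| <= #|U|.

Lemma build_root : has_osf_split_root e.
Proof.
have [eC eI] := eS.
have [E0|[K1 K1E]] := set_0Vmem E.
  have e0 x y : e x y = false.
    by apply/negP => /(edge_clique eS)[K]; rewrite -/E E0 inE.
  exists e; split=> //.
  - exists set0; split; [by apply/cliqueP => x y; rewrite inE | by apply/independentP => x y _ _; rewrite e0].
  - move=> l l3 lo [phi [_ H]]; have l0 : 0 < l by slia.
    by have := H (inl (Ordinal l0)) (inr (Ordinal l0)); rewrite e0 /sun_adj eqxx.
  - move=> x y; rewrite squareE // e0; apply/esym/negP => /andP[_ /existsP[z]].
    by rewrite e0.
have UK K x : K \in E -> x \in U -> x \in K by move=> KE /bigcapP; apply.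
have /card_gt0P[x0 _] : 0 < #|K1| by move: K1E; rewrite inE => /andP[_]; slia.
(* [f] sends the cliques injectively into their common intersection; this is where the bound on
   their number enters. *)
pose f K := nth x0 (enum U) (index K (enum E)).
have fi K : K \in E -> index K (enum E) < size (enum U).
  move=> KE; apply: leq_trans (_ : size (enum E) <= _); last by rewrite -!cardE.
  by rewrite index_mem mem_enum.
have fU K : K \in E -> f K \in U by move=> KE; rewrite -mem_enum mem_nth ?fi.
have fI K K' : K \in E -> K' \in E -> f K = f K' -> K = K'.
  move=> KE KE' /eqP; rewrite nth_uniq ?fi ?enum_uniq // => /eqP.
  by move=> Ei; rewrite -[K](nth_index K1 (s := enum E)) ?mem_enum // Ei nth_index ?mem_enum.
pose a x y := [exists K in E, (f K == y) && (x \in K)].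
pose h x y := (x != y) && [|| (x \in U) && (y \in U), (x \notin U) && a x y | (y \notin U) && a y x].
have aU x y : a x y -> y \in U by case/exists_inP=> K KE /andP[/eqP <- _]; apply: fU.
have hC : symmetric h.
  by move=> x y; rewrite /h eq_sym [(y \in U) && _]andbC; congr (_ && (_ || _)); rewrite orbC.
have hI : irreflexive h by move=> x; rewrite /h eqxx.
have hS : simple_graph h by [].
have cU : clique h U by apply/cliqueP => x y xU yU xy; rewrite /h xy xU yU.
have ha x y : x \notin U -> h x y = a x y.
  move=> xN; rewrite /h xN (negbTE xN) /=; have [<-|xy] /= := eqVneq x y.
    by apply/esym/negbTE/negP => /aU xU; rewrite xU in xN.
  have [//|axy] := boolP (a x y).
  by apply/negbTE/negP => /andP[_ /aU xU]; rewrite xU in xN.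
have iU : independent h (~: U).
  by apply/independentP => x y; rewrite !inE => xN yN; rewrite ha //; apply/negP => /aU yU; rewrite yU in yN.
have ine x y K : K \in E -> x \in K -> y \in K -> x != y -> e x y by apply: clique_adj.
exists h; split=> //.
- by exists U.
- apply/(split_osun cU iU hS) => -[l [u [w [l3 lo H]]]]; apply: NO.
  have uw i j : [/\ u i \notin U, w j \in U & a (u i) (w j) = (j == i) || (j == ordS i)].
    have := H i i; rewrite eqxx => /and3P[uN _ _]; have := H j j; rewrite eqxx => /and3P[_ wU _].
    by rewrite -H uN wU ha.
  have /fin_all_exists[v Hv] j : exists K, K \in E /\ f K = w j.
    have [_ _] := uw j j; rewrite eqxx => /exists_inP[K KE /andP[/eqP fK _]]; by exists K.
  exists l, u, v; split=> // i j; have [vE fv] := Hv j; have [_ _ <-] := uw i j.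
  rewrite vE andbT; apply/idP/exists_inP => [uv|[K KE /andP[/eqP fK uK]]].
    by exists (v j); rewrite ?fv ?eqxx.
  by rewrite (fI (v j) K) // fv.
have some x z : h x z -> exists2 K, K \in E & x \in K.
  have [xU|xN] := boolP (x \in U); first by exists K1; rewrite // UK.
  by rewrite ha // => /exists_inP[K KE /andP[_ xK]]; exists K.
have mid x z y : h x z -> h z y -> x != y -> e x y.
  move=> xz zy xy; have [xU|xN] := boolP (x \in U).
    rewrite hC in zy; have [K KE yK] := some _ _ zy; apply: (ine x y K) => //; exact: UK.
  have [yU|yN] := boolP (y \in U).
    have [K KE xK] := some _ _ xz; apply: (ine x y K) => //; exact: UK.
  rewrite hC in zy; rewrite !ha // in xz zy.
  have [K KE /andP[/eqP fK xK]] := exists_inP xz; have [K' KE' /andP[/eqP fK' yK]] := exists_inP zy.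
  by apply: (ine x y K) => //; rewrite (fI K K') // fK fK'.
have dir x y : h x y -> e x y.
  move=> xy; have ne : x != y by move: xy => /andP[].
  have [xU|xN] := boolP (x \in U).
    rewrite hC in xy; have [K KE yK] := some _ _ xy; apply: (ine x y K) => //; exact: UK.
  rewrite ha // in xy; have [K KE /andP[/eqP fK xK]] := exists_inP xy.
  by apply: (ine x y K) => //; rewrite -fK; apply/UK/fU.
move=> x y; rewrite squareE //; apply/idP/andP => [exy|[ne /orP[/dir //|/existsP[z /andP[xz zy]]]]]; last exact: mid xz zy ne.
have ne : x != y by apply: contraTneq exy => ->; rewrite eI.
split=> //; have [K KE /andP[xK yK]] := edge_clique eS exy.
have af z : z \in K -> a z (f K) by move=> zK; apply/exists_inP; exists K; rewrite ?eqxx.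
have hf z : z \in K -> z != f K -> h z (f K).
  move=> zK zf; have [zU|zN] := boolP (z \in U); first by rewrite /h zf zU fU.
  by rewrite ha // af.
have [xf|xf] := eqVneq x (f K); first by apply/orP; left; rewrite hC xf hf // -xf eq_sym.
have [yf|yf] := eqVneq y (f K); first by apply/orP; left; rewrite yf hf.
by apply/orP; right; apply/existsP; exists (f K); rewrite hf // hC hf.
Qed.

End Build.

Lemma osf_root_iff e : simple_graph e -> has_osf_split_root e <->
  ~ clique_osun e /\ #|edge_cliques e| <= #|\bigcap_(K in edge_cliques e) K|.
Proof.
move=> eS; split=> [[h [hS [K0 [cK iK]] F eh]]|[NO cnt]]; last exact: build_root.
by split; [apply: (root_no_osun hS eh cK iK F) | apply: (root_count hS eh cK iK F)].
Qed.

(** A clique occurring in an odd sun contains two of its vertices, so cliques with a single vertex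
    make no difference. *)
Lemma balanced_graph_osun e : balanced_graph e <-> ~ clique_osun e.
Proof.
rewrite /balanced_graph /balanced_hypergraph balanced_osun; split=> H [l [u [v [l3 lo E]]]]; apply: H.
  have vM j : v j \in max_cliques e.
    by have := E j j; rewrite eqxx => /andP[_]; rewrite inE => /andP[].
  exists l, (fun i => enum_rank (u i)), (fun j => enum_rank_in (vM j) (v j)); split=> // i j.
  rewrite mxE enum_rankK enum_rankK_in //.
  have := E i j; have := E j j; rewrite eqxx => /andP[_ ->].
  by rewrite andbT.
exists l, (fun i => enum_val (u i)), (fun j => enum_val (v j)); split=> // i j.
rewrite -E mxE; case: (boolP (enum_val (u i) \in enum_val (v j))) => //= uv.
rewrite inE enum_valP /=; apply/card_gt1P.
exists (enum_val (u j)), (enum_val (u (ord_pred j))); split.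
- by have := E j j; rewrite mxE eqxx.
- by have := E (ord_pred j) j; rewrite mxE ord_predK eqxx orbT.
apply/eqP => /enum_val_inj/(osun_row_inj l3 E) jE.
by have := ordS_neq (ord_pred j) (ltac:(slia) : 2 <= l); rewrite ord_predK -jE eqxx.
Qed.

Lemma edge_cliques_max e (x : T) : simple_graph e -> (forall y, exists z, e y z) ->
  edge_cliques e = max_cliques e.
Proof.
move=> [eC eI] H; apply/setP => K; rewrite inE; case: (boolP (K \in max_cliques e)) => //= /max_cliqueP[KC Kmax].
have ext y : K \subset [set y] -> False.
  move=> sub; have [z yz] := H y.
  have sub2 : K \subset [set y; z] by apply: subset_trans sub _; rewrite subsetUl.
  have E := Kmax _ (clique2 eC yz) sub2; have : z \in [set y] by apply: (subsetP sub); rewrite -E set22.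
  by rewrite inE => /eqP zy; rewrite zy eI in yz.
apply/negPn/negP; rewrite -leqNgt => K1; have [K0|[y yK]] := set_0Vmem K.
  by apply: (ext x); rewrite K0 sub0set.
by apply: (ext y); apply/subsetP => z zK; rewrite inE; have := card_le1_eqP K1 z y zK yK => ->.
Qed.

Lemma connected_root_iff e : simple_graph e ->
  has_connected_osf_split_root e <->
  balanced_graph e /\ #|max_cliques e| <= #|\bigcap_(K in max_cliques e) K|.
Proof.
move=> eS; have [eC eI] := eS; rewrite balanced_graph_osun.
(* On a single vertex [max_cliques] and [edge_cliques] differ although the graph is connected, so
   this case is treated apart. *)
have one : #|T| = 1 -> max_cliques e = [set setT] /\ edge_cliques e = set0.
  move=> T1; have cT : clique e setT.
    apply/cliqueP => x y _ _ /eqP[]; apply: (card_le1_eqP (A := predT)) => //.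
    by rewrite T1.
  have M : max_cliques e = [set setT].
    apply/setP => K; rewrite [RHS]inE; apply/max_cliqueP/eqP => [[_ Km]|->]; first by rewrite -(Km _ cT (subsetT K)).
    by split=> // K' _; rewrite subTset => /eqP.
  split=> //; apply/setP => K; rewrite inE M !inE; apply/negP => /andP[/eqP ->].
  by rewrite cardsT T1.
split=> [[h [hS [T0 con] [K0 [cK iK]] F eh]]|[NO cnt]].
  have NO := root_no_osun hS eh cK iK F; have cnt := root_count hS eh cK iK F; split=> //.
  have [T1|T2] : #|T| = 1 \/ 1 < #|T| by slia.
    by have [-> _] := one T1; rewrite cards1 big_set1 cardsT T1.
  have [x _] := card_gt0P T0.
  rewrite -(@edge_cliques_max e x) // => y.
  have : 0 < #|[set~ y]| by have := cardsC1 y; slia.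
  case/card_gt0P => z; rewrite !inE => zy.
  have /connectP[[|w p] /=] := con y z; first by move=> _ E; rewrite E eqxx in zy.
  case/andP=> yw _ _; exists w; rewrite eh squareE // yw /= andbT.
  by apply: contraTneq yw => ->; have [_ ->] := hS.
(* Some maximal clique always exists, so the counting condition makes the intersection nonempty. A
   vertex in it is adjacent to all others, which makes the root connected. *)
have [|K KM _] := @clique_max e set0; first by apply/cliqueP => x y; rewrite inE.
have /card_gt0P[x xU] : 0 < #|\bigcap_(K in max_cliques e) K|.
  by apply: leq_trans cnt; apply/card_gt0P; exists K.
have univ y : y != x -> e x y.
  move=> yx; have [|K' KM' sub] := @clique_max e [set y].
    by apply/cliqueP => a b /set1P -> /set1P ->; rewrite eqxx.
  have yK : y \in K' by rewrite -sub1set.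
  move/bigcapP: xU => /(_ K' KM') xK; move/max_cliqueP: KM' => [/cliqueP H _].
  by apply: H => //; rewrite eq_sym.
have T0 : 0 < #|T| by apply/card_gt0P; exists x.
have cnt' : #|edge_cliques e| <= #|\bigcap_(K in edge_cliques e) K|.
  have [T1|T2] : #|T| = 1 \/ 1 < #|T| by slia.
    by have [_ ->] := one T1; rewrite cards0.
  rewrite (@edge_cliques_max e x) // => y; have [->|yx] := eqVneq y x.
    have : 0 < #|[set~ x]| by have := cardsC1 x; slia.
    by case/card_gt0P => z; rewrite !inE => zx; exists z; apply: univ.
  by exists x; rewrite eC univ.
have [h [hS hK F eh]] := build_root eS NO cnt'.
exists h; split=> //; split=> //.
have ce y z : e y z -> connect h y z.
  rewrite eh squareE // => /andP[_ /orP[yz|/existsP[w /andP[yw wz]]]]; first exact: connect1.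
  exact: connect_trans (connect1 yw) (connect1 wz).
have cx y : connect h x y by have [->|yx] := eqVneq y x; [exact: connect0 | apply/ce/univ].
have hsym : connect_sym h by apply: sym_connect_sym; case: hS.
by move=> y z; apply: connect_trans (cx z); rewrite hsym.
Qed.

End Squares.

(** * Cliques as common neighbourhoods *)

Section UnbalancedHoles.
Variables (V : finType) (adj : rel V) (side : V -> bool).
Hypothesis adjC : symmetric adj.
Hypothesis bip : forall x y, adj x y -> side x != side y.

Lemma hole_osun c n : 5 < n -> n %% 4 = 2 -> phole adj c n -> ~~ side (c 0) ->
  osun (fun x y => ~~ side x && adj x y).
Proof.
move=> n5 n4 Hc s0; pose l := n./2; have nE : n = l.*2 by rewrite /l; slia.
(* [p j] is [2 j - 1], read cyclically: on the hole, column [j] lies between row [j - 1] at position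
   [2 j - 2] and row [j] at position [2 j]. *)
pose p (j : nat) := if j is j'.+1 then j'.*2.+1 else n.-1.
exists l, (fun i : 'I_l => c i.*2), (fun j : 'I_l => c (p j)); split; try by rewrite /l; slia.
move=> i j; rewrite (phole_side bip _ Hc); last by slia.
rewrite odd_double addbF s0 /=.
have il := ltn_ord i; have jl := ltn_ord j.
have -> : (j == i) || (j == ordS i) = ((j == i :> nat) || (j == (if i.+1 == l then 0 else i.+1) :> nat)).
  congr (_ || _); rewrite -val_eqE /=; have [E|ne] := eqVneq i.+1 l; first by rewrite E modnn.
  by rewrite modn_small //; slia.
case: (j : nat) jl => [|j'] jl /=; rewrite /p.
  have [lt|ge] := ltnP i.*2 n.-1; last by slia.
  rewrite (phole_adj Hc); last by slia.
  by clear -nE il n5; case: (eqVneq i.+1 l) => C; slia.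
have [lt|ge] := ltnP i.*2 j'.*2.+1.
  rewrite (phole_adj Hc); last by slia.
  by clear -nE il lt jl; case: (eqVneq i.+1 l) => C; slia.
rewrite adjC (phole_adj Hc); last by slia.
by clear -nE il ge jl; case: (eqVneq i.+1 l) => C; slia.
Qed.

(** The rows and columns of a sun alternate along a cycle of length [2 l], which is 2 modulo 4
    exactly for odd [l]. A hole that starts on the wrong side is shifted by one. *)
Lemma unb_osun : unb adj <-> osun (fun x y => ~~ side x && adj x y).
Proof.
split=> [[n [c [n5 n4 Hc]]]|[l [u [v [l3 lo H]]]]].
  have [s0|s0] := boolP (side (c 0)); last exact: (hole_osun n5 n4 Hc s0).
  apply: (hole_osun n5 n4 (phole_shift 1 Hc)).
  by rewrite (phole_side bip _ Hc) ?s0 //; slia.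
pose r x y := ~~ side x && adj x y.
have l0 : 0 < l by slia.
have uI := @osun_row_inj _ _ r _ _ _ l3 H; have vI := @osun_col_inj _ _ r _ _ _ l3 H.
have us i : side (u i) = false by have := H i i; rewrite eqxx => /andP[/negbTE].
have vs j : side (v j) = true.
  by have := H j j; rewrite eqxx => /andP[s /bip]; rewrite us; case: (side (v j)).
have HE i j : adj (u i) (v j) = (j == i) || (j == ordS i) by rewrite -H us.
pose o m : 'I_l := Ordinal (ltn_pmod m l0).
pose f t := if odd t then v (o t.+1./2) else u (o t./2).
have irr x y : side x = side y -> adj x y = false by move=> E; apply/negP => /bip; rewrite E eqxx.
have fs t : side (f t) = odd t by rewrite /f; case: ifP; rewrite ?us ?vs.
have onat a b : a < l -> 0 < b <= l -> ((o b == o a) || (o b == ordS (o a))) = (b == a) || (b == a.+1) || ((a == 0) && (b == l)).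
  move=> al bl; rewrite -!val_eqE /= (modn_small al).
  have [->|ne] := eqVneq b l; first by rewrite modnn; have [E|ne'] := eqVneq a.+1 l; [rewrite E modnn; slia | rewrite modn_small; slia].
  rewrite (@modn_small b); last by slia.
  by have [E|ne'] := eqVneq a.+1 l; [rewrite E modnn; slia | rewrite modn_small; slia].
exists l.*2, (fun t => f (t %% l.*2)); split; try by slia.
apply: (@phole_fin _ adj adjC f); first by slia.
move=> i j ij; have fij : odd i = odd j -> f i != f j.
  rewrite /f => E; rewrite -E; case: ifP => oi; apply/eqP.
    move/vI/(congr1 (@nat_of_ord l)) => E'.
    have {E'} : i.+1./2 %% l = j.+1./2 %% l by exact: E'.
    have [jl|jl] := eqVneq j.+1./2 l; last by rewrite !modn_small; slia.
    by rewrite jl modnn modn_small; slia.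
  by move/uI/(congr1 (@nat_of_ord l)) => /=; rewrite !modn_small; slia.
split.
  have [E|E] := eqVneq (odd i) (odd j); first exact: fij.
  by apply: contra_neq E; rewrite -!fs => ->.
have [E|E] := eqVneq (odd i) (odd j).
  by rewrite irr ?fs //; move: E ij; clear; slia.
rewrite /f; case: ifP => oi.
  have oj : odd j = false by move: E; rewrite oi; case: (odd j).
  by rewrite oj adjC HE onat; clear -oi oj ij l3; slia.
have oj : odd j by move: E; rewrite oi; case: (odd j).
by rewrite oj HE onat; clear -oi oj ij l3; slia.
Qed.

End UnbalancedHoles.

Section CliquePairs.
Variables (T : finType) (e : rel T).
Hypothesis eS : simple_graph e.

Definition cnb (x z : T) : bool := (x == z) || e x z.
Definition pair_clique (x y : T) : {set T} := [set z | cnb x z && cnb y z].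
Definition good (p : T * T) : bool := e p.1 p.2 && clique e (pair_clique p.1 p.2).

Definition extended_triangle : Prop := exists x y z a b c,
  [/\ [&& e x y, e y z & e x z], [&& cnb x a, cnb y a & ~~ cnb z a],
      [&& cnb y b, cnb z b & ~~ cnb x b] & [&& cnb x c, cnb z c & ~~ cnb y c]].

Let eC : symmetric e. Proof. by case: eS. Qed.
Let eI : irreflexive e. Proof. by case: eS. Qed.
Let cnbC x y : cnb x y = cnb y x. Proof. by rewrite /cnb eq_sym eC. Qed.
Let cnbxx x : cnb x x. Proof. by rewrite /cnb eqxx. Qed.

Let clique3 x y z : cnb x y -> cnb y z -> cnb x z -> clique e [set x; y; z].
Proof.
move=> xy yz xz; apply/cliqueP => a b; rewrite !inE.
have H u v : cnb u v -> u != v -> e u v by rewrite /cnb; case: eqVneq.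
by move=> /orP[/orP[]|]/eqP-> /orP[/orP[]|]/eqP->; rewrite ?eqxx // => /H; apply; rewrite // cnbC.
Qed.

Lemma clique_cnb K x y : K \in edge_cliques e -> x \in K -> y \in K -> cnb x y.
Proof. by move=> KE xK yK; rewrite /cnb; case: eqVneq => //= xy; apply: clique_adj KE _ _ xy. Qed.

(** Maximal cliques containing [x y a], [y z b] and [x z c] each miss the third vertex of the
    triangle, so together with it they form a 3-sun. *)
Lemma extended_triangle_osun : extended_triangle -> clique_osun e.
Proof.
move=> [x [y [z [a [b [c [/and3P[xy yz xz] /and3P[xa ya za] /and3P[yb zb xb] /and3P[xc zc yc]]]]]]]].
have cE u v w : e u v -> cnb u w -> cnb v w -> exists2 K, K \in edge_cliques e & [&& u \in K, v \in K & w \in K].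
  move=> uv uw vw; have [|K KM] := @clique_max _ e [set u; v; w].
    by apply: clique3 => //; rewrite /cnb uv orbT.
  rewrite !subUset !sub1set => /andP[/andP[uK vK] wK]; exists K; rewrite ?uK ?vK //.
  rewrite inE KM; apply/card_gt1P; exists u, v; split=> //.
  by apply: contraTneq uv => ->; rewrite eI.
have [K1 E1 /and3P[xK1 yK1 aK1]] := cE _ _ _ xy xa ya.
have [K2 E2 /and3P[yK2 zK2 bK2]] := cE _ _ _ yz yb zb.
have [K3 E3 /and3P[xK3 zK3 cK3]] := cE _ _ _ xz xc zc.
have zK1 : z \notin K1 by apply: contra za => zK; apply: clique_cnb E1 zK aK1.
have xK2 : x \notin K2 by apply: contra xb => xK; apply: clique_cnb E2 xK bK2.
have yK3 : y \notin K3 by apply: contra yc => yK; apply: clique_cnb E3 yK cK3.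
exists 3, (fun i : 'I_3 => nth x [:: x; y; z] i), (fun j : 'I_3 => nth K1 [:: K3; K1; K2] j); split=> //.
by move=> [[|[|[|//]]] Hi] [[|[|[|//]]] Hj];
  rewrite /= ?E1 ?E2 ?E3 ?xK1 ?yK1 ?yK2 ?zK2 ?xK3 ?zK3 ?(negbTE zK1) ?(negbTE xK2) ?(negbTE yK3).
Qed.

Lemma good_edge_clique p : good p -> pair_clique p.1 p.2 \in edge_cliques e.
Proof.
case: p => x y /andP[/= xy cl].
have xC : x \in pair_clique x y by rewrite inE cnbxx cnbC /cnb xy orbT.
have yC : y \in pair_clique x y by rewrite inE cnbxx andbT /cnb xy orbT.
rewrite inE; apply/andP; split; last first.
  by apply/card_gt1P; exists x, y; split=> //; apply: contraTneq xy => ->; rewrite eI.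
apply/max_cliqueP; split=> // K KC sub; apply/eqP; rewrite eqEsubset sub andbT.
have H u v : u \in K -> v \in K -> cnb u v.
  by move=> uK vK; rewrite /cnb; case: eqVneq => //= uv; move/cliqueP: KC; apply.
by apply/subsetP => z zK; rewrite inE !H //; apply: (subsetP sub).
Qed.

(** Otherwise any two vertices of [K] have a common closed neighbour outside [K]. Without extended
    triangles, [helly3] provides one for all of [K], against maximality. *)
Lemma edge_clique_good K : ~ extended_triangle -> K \in edge_cliques e ->
  exists2 p, good p & pair_clique p.1 p.2 = K.
Proof.
move=> NT KE; have /andP[/max_cliqueP[KC Kmax] K2] : (K \in max_cliques e) && (1 < #|K|) by rewrite inE in KE.
suff [x [y [xK yK xy sub]]] : exists x y, [/\ x \in K, y \in K, x != y & pair_clique x y \subset K].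
  have E : pair_clique x y = K.
    apply/eqP; rewrite eqEsubset sub; apply/subsetP => z zK.
    by rewrite inE !(clique_cnb KE).
  by exists (x, y) => //; rewrite /good /= E KC andbT; apply: clique_adj KE _ _ xy.
have /card_gt1P[x0 [y0 [x0K y0K xy0]]] := K2.
have [/existsP[x /existsP[y]]|N] := boolP [exists x, exists y, [&& x \in K, y \in K & pair_clique x y \subset K]].
  case/and3P=> xK yK sub; have [xy|xy] := eqVneq x y; last by exists x, y.
  have [z [zK xz]] : exists z, z \in K /\ x != z.
    by have [xx|xx] := eqVneq x x0; [exists y0; rewrite xx | exists x0].
  exists x, z; split=> //; apply: subset_trans sub; rewrite -xy.
  by apply/subsetP => w; rewrite !inE => /andP[-> _].
have [||//|v Hv] := @helly3 _ _ (fun x v => (v \notin K) && cnb x v) K.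
- move=> x y xK yK; move: N; rewrite negb_exists => /forallP/(_ x); rewrite negb_exists => /forallP/(_ y).
  rewrite xK yK /= => /subsetPn[v]; rewrite inE => /andP[xv yv] vN.
  by exists v; rewrite vN xv yv.
- move=> x1 x2 x3 j1 j2 j3 X1 X2 X3.
  case/and5P=> /andP[J2 a12] /andP[J3 a13] /andP[J1 a21] /andP[_ a23] /andP[/andP[_ a31] /andP[_ a32]].
  rewrite J1 J2 J3 /=; apply/negPn/negP => /norP[n11 /norP[n22 n33]]; apply: NT.
  have ne x y j : cnb x j -> ~~ cnb y j -> x != y by move=> xj; apply: contraNneq => <-.
  exists x1, x2, x3, j3, j1, j2; split; rewrite ?a12 ?a13 ?a21 ?a23 ?a31 ?a32 ?n11 ?n22 ?n33 //.
  have ce x y : x \in K -> y \in K -> x != y -> e x y by apply: clique_adj.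
  by apply/and3P; split; apply: ce => //; [apply: (ne _ _ j2) | apply: (ne _ _ j3) | apply: (ne _ _ j3)].
- by apply/set0Pn; exists x0.
have /andP[vN _] := Hv _ x0K.
have E : v |: K = K.
  apply: Kmax; last exact: subsetUr.
  apply/cliqueP => a b; rewrite !inE => /orP[/eqP ->|aK] /orP[/eqP ->|bK]; rewrite ?eqxx //.
  - by move=> vb; have /andP[_] := Hv b bK; rewrite /cnb eq_sym (negbTE vb) eC.
  - by move=> av; have /andP[_] := Hv a aK; rewrite /cnb (negbTE av).
  - exact: (clique_adj KE).
by rewrite -E setU11 in vN.
Qed.

(* A pair (x, x) stands for the vertex x, and a good pair for its clique. *)
Definition pair_adj (p q : T * T) : bool :=
  [&& p.1 == p.2, good q & p.1 \in pair_clique q.1 q.2] ||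
  [&& q.1 == q.2, good p & q.1 \in pair_clique p.1 p.2].

Definition pair_side (p : T * T) : bool := p.1 != p.2.

Lemma pair_adjC : symmetric pair_adj.
Proof. by move=> p q; rewrite /pair_adj orbC. Qed.

Lemma good_side p : good p -> pair_side p.
Proof. by case/andP=> xy _; apply: contraTneq xy => ->; rewrite eI. Qed.

Lemma pair_bip p q : pair_adj p q -> pair_side p != pair_side q.
Proof.
by rewrite /pair_adj => /orP[] /and3P[/eqP E /good_side -> _]; rewrite /pair_side E eqxx.
Qed.

(** Several good pairs may stand for one clique. This is harmless: the sun condition already makes
    the columns different, and conversely one pair is chosen for each clique of a sun. *)
Lemma unb_pair_adj : ~ extended_triangle -> unb pair_adj <-> clique_osun e.
Proof.
move=> NT; rewrite (unb_osun pair_adjC pair_bip).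
have aE p q : ~~ pair_side p -> pair_adj p q = good q && (p.1 \in pair_clique q.1 q.2).
  move=> sp; rewrite /pair_adj; have /negPn -> := sp; rewrite /=.
  have [/good_side|] := boolP (good p); first by rewrite (negbTE sp).
  by rewrite andbF orbF.
split=> [[l [u [v [l3 lo H]]]]|[l [u [v [l3 lo H]]]]].
  have us i : ~~ pair_side (u i) by have := H i i; rewrite eqxx => /andP[].
  have vg j : good (v j) by have := H j j; rewrite eqxx aE // => /and3P[].
  exists l, (fun i => (u i).1), (fun j => pair_clique (v j).1 (v j).2); split=> // i j.
  by rewrite good_edge_clique // andbT -H us aE // vg.
have vE j : v j \in edge_cliques e by have := H j j; rewrite eqxx => /andP[].
have /fin_all_exists[q Hq] j : exists q, good q /\ pair_clique q.1 q.2 = v j.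
  by have [q] := edge_clique_good NT (vE j); exists q.
exists l, (fun i => (u i, u i)), q; split=> // i j; have [gq qv] := Hq j.
by rewrite aE /pair_side /= ?eqxx // gq qv -H vE andbT.
Qed.

Definition central (v : T) : bool := [forall p, good p ==> (v \in pair_clique p.1 p.2)].

Lemma osf_root_pairs : has_osf_split_root e <->
  [/\ ~ extended_triangle, ~ unb pair_adj &
      #|[set pair_clique p.1 p.2 | p : T * T & good p]| <= #|[set v | central v]|].
Proof.
rewrite osf_root_iff //.
have key : ~ extended_triangle -> [set pair_clique p.1 p.2 | p : T * T & good p] = edge_cliques e /\
   [set v | central v] = \bigcap_(K in edge_cliques e) K.
  move=> NT; have E : [set pair_clique p.1 p.2 | p : T * T & good p] = edge_cliques e.
    apply/setP => K; apply/imsetP/idP => [[p] | /(edge_clique_good NT)[p gp <-]]; last by exists p; rewrite ?inE.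
    by rewrite inE => gp ->; apply: good_edge_clique.
  split=> //; apply/setP => v; rewrite inE -E; apply/forallP/bigcapP => [H K /imsetP[p]|H p].
    by rewrite inE => gp ->; have := H p; rewrite gp.
  by apply/implyP => gp; apply: H; apply/imsetP; exists p; rewrite ?inE.
split=> [[NO cnt]|[NT NU cnt]].
  have NT : ~ extended_triangle by move/extended_triangle_osun.
  have [-> ->] := key NT; split=> //.
  by move/(unb_pair_adj NT).
have [E1 E2] := key NT; rewrite -E2 -E1; split=> //.
by move/(unb_pair_adj NT).
Qed.

End CliquePairs.

(** * Polynomial time functions on trees *)

(** Bounds are built from constants, the identity, sums and products only, so that they are monotone
    and closed under composition. *)
Inductive isP : (nat -> nat) -> Prop :=
  | isP_const k : isP (fun=> k)
  | isP_id : isP (fun n => n)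
  | isP_add p q : isP p -> isP q -> isP (fun n => p n + q n)
  | isP_mul p q : isP p -> isP q -> isP (fun n => p n * q n).

Lemma isP_mono p m n : isP p -> m <= n -> p m <= p n.
Proof. by move=> Hp mn; elim: Hp => //= *; [apply: leq_add | apply: leq_mul]. Qed.

Lemma isP_comp p q : isP p -> isP q -> isP (fun n => p (q n)).
Proof. by move=> Hp Hq; elim: Hp => [k||p1 p2 _ H1 _ H2|p1 p2 _ H1 _ H2] //; constructor. Qed.

Lemma isP_bound p : isP p -> exists a k, forall n, p n <= a * n ^ k + a.
Proof.
have mon n k1 k2 : n ^ k1 <= n ^ (k1 + k2) + 1.
  case: n => [|n]; first by case: k1 => [|k1]; rewrite ?expn0 ?addn1 // exp0n.
  by rewrite (leq_trans _ (leq_addr _ _)) // leq_pexp2l // leq_addr.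
elim=> [k||p1 p2 _ [a1 [k1 H1]] _ [a2 [k2 H2]]|p1 p2 _ [a1 [k1 H1]] _ [a2 [k2 H2]]].
- by exists k, 0 => n; rewrite leq_addl.
- by exists 1, 1 => n; rewrite expn1 mul1n leq_addr.
- exists (2 * (a1 + a2)), (k1 + k2) => n.
  have := mon n k1 k2; have := mon n k2 k1; rewrite [k2 + k1]addnC.
  have := H1 n; have := H2 n; move: (n ^ k1) (n ^ k2) (n ^ (k1 + k2)) (p1 n) (p2 n).
  by move=> x y z u v *; nia.
- exists (4 * (a1 * a2)), (k1 + k2) => n.
  apply: leq_trans (leq_mul (H1 n) (H2 n)) _.
  have := mon n k1 k2; have := mon n k2 k1; rewrite [k2 + k1]addnC expnD => h1 h2.
  have -> : (a1 * n ^ k1 + a1) * (a2 * n ^ k2 + a2) = a1 * a2 * ((n ^ k1).+1 * (n ^ k2).+1).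
    by rewrite -!mulnSr mulnACA.
  have -> : 4 * (a1 * a2) * (n ^ k1 * n ^ k2) + 4 * (a1 * a2) = a1 * a2 * (4 * (n ^ k1 * n ^ k2).+1).
    by rewrite -mulnSr [4 * (a1 * a2)]mulnC -mulnA.
  rewrite leq_mul2l; apply/orP; right.
  by rewrite mulSn mulnS; move: h1 h2; move: (n ^ k1 * n ^ k2) (n ^ k1) (n ^ k2) => *; slia.
Qed.

Fixpoint lst (t : tree) : seq tree := if t is Node a b then a :: lst b else [::].

Lemma lst_enc s : lst (enc_seq s) = s.
Proof. by elim: s => //= x s ->. Qed.

Lemma size_lst t : size (lst t) < tree_size t.
Proof. by elim: t => //= a _ b; slia. Qed.

Lemma hd_size t : tree_size (hd_tree t) <= tree_size t.
Proof. by case: t => //= a b; slia. Qed.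

Lemma tl_size t : tree_size (tl_tree t) <= tree_size t.
Proof. by case: t => //= a b; slia. Qed.

(* [f] is computed in variable 0 by a program that touches only the variables
   below [m] and whose behaviour depends only on the content of variable 0. *)
Definition computes (c : cmd) (m : nat) (p : nat -> nat) (f : tree -> tree) : Prop :=
  forall s, exists t s', [/\ exec s c t s', s' 0 = f (s 0),
    forall x, m <= x -> s' x = s x, t <= p (tree_size (s 0))
    & tree_size (f (s 0)) <= p (tree_size (s 0))].

Definition PF f : Prop := exists c m p, [/\ 0 < m, isP p & computes c m p f].

Lemma PF_ext f g : f =1 g -> PF f -> PF g.
Proof.
move=> fg [c [m [p [m0 Hp H]]]]; exists c, m, p; split=> // s.
by have [t [s' [? ? ? ? ?]]] := H s; exists t, s'; rewrite -fg.
Qed.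

Lemma updE s x d y : update s x d y = if y == x then d else s y. Proof. by []. Qed.

Lemma PFid : PF (fun d => d).
Proof.
exists (CAssign 0 (EVar 0)), 1, (fun n => n); split=> //; first by constructor.
move=> s; exists (tree_size (s 0)), (update s 0 (s 0)); split=> //.
- by have := ExecAssign s 0 (EVar 0); rewrite /= addn0.
- by case.
Qed.

Lemma PFleaf : PF (fun=> Leaf).
Proof.
exists (CAssign 0 ELeaf), 1, (fun n => 1); split=> //; first by constructor.
move=> s; exists 1, (update s 0 Leaf); split=> //.
- by have := ExecAssign s 0 ELeaf; rewrite /= addn0.
- by case.
Qed.

Lemma PFhd_ : PF hd_tree.
Proof.
exists (CAssign 0 (EHd (EVar 0))), 1, (fun n => n + n); split=> //; first by do 2 constructor.
move=> s; exists (eval_cost s (EHd (EVar 0))), (update s 0 (hd_tree (s 0))).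
split=> //; last by have := hd_size (s 0); slia.
- exact: ExecAssign.
- by case.
- by rewrite /= addn0 leq_add2r hd_size.
Qed.

Lemma PFtl_ : PF tl_tree.
Proof.
exists (CAssign 0 (ETl (EVar 0))), 1, (fun n => n + n); split=> //; first by do 2 constructor.
move=> s; exists (eval_cost s (ETl (EVar 0))), (update s 0 (tl_tree (s 0))).
split=> //; last by have := tl_size (s 0); slia.
- exact: ExecAssign.
- by case.
- by rewrite /= addn0 leq_add2r tl_size.
Qed.

Lemma PFcomp f g : PF f -> PF g -> PF (fun d => g (f d)).
Proof.
move=> [c1 [m1 [p1 [m10 P1 H1]]]] [c2 [m2 [p2 [m20 P2 H2]]]].
exists (CSeq c1 c2), (maxn m1 m2), (fun n => p1 n + p2 (p1 n)); split; first by slia.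
  by apply: isP_add => //; apply: isP_comp.
move=> s; have [t1 [s1 [E1 O1 K1 T1 S1]]] := H1 s; have [t2 [s2 [E2 O2 K2 T2 S2]]] := H2 s1.
have M := isP_mono P2 S1; rewrite O1 in T2 O2 S2.
exists (t1 + t2), s2; split; [exact: ExecSeq E1 E2 | by [] | | slia | slia].
by move=> x Hx; rewrite K2 ?K1 //; slia.
Qed.

Lemma PFhd f : PF f -> PF (fun d => hd_tree (f d)).
Proof. by move=> Hf; apply: PFcomp Hf PFhd_. Qed.

Lemma PFtl f : PF f -> PF (fun d => tl_tree (f d)).
Proof. by move=> Hf; apply: PFcomp Hf PFtl_. Qed.

Lemma PFnode f g : PF f -> PF g -> PF (fun d => Node (f d) (g d)).
Proof.
move=> [c1 [m1 [p1 [m10 P1 H1]]]] [c2 [m2 [p2 [m20 P2 H2]]]].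
pose M := maxn m1 m2.
exists (CSeq (CAssign M (EVar 0)) (CSeq c1 (CSeq (CAssign M.+1 (EVar 0))
  (CSeq (CAssign 0 (EVar M)) (CSeq c2 (CAssign 0 (ENode (EVar M.+1) (EVar 0)))))))),
  M.+2, (fun n => n + n + (p1 n + p1 n + p1 n + p1 n) + (p2 n + p2 n + p2 n) + 1).
split=> //; first by repeat (apply: isP_add || apply: isP_const || apply: isP_id || assumption).
move=> s; set S := tree_size (s 0).
set s0 := update s M (s 0).
have [t1 [s1 [E1 O1 K1 T1 S1]]] := H1 s0.
have s00 : s0 0 = s 0 by rewrite /s0 updE; case: eqP => // E; have := m10; slia.
rewrite s00 -/S in T1 O1 S1.
set s1' := update (update s1 M.+1 (s1 0)) 0 (s 0).
have [t2 [s2 [E2 O2 K2 T2 S2]]] := H2 s1'.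
have s10 : s1' 0 = s 0 by [].
rewrite s10 -/S in T2 O2 S2.
have s2M : s2 M.+1 = f (s 0).
  by rewrite K2; [rewrite /s1' !updE eqxx /= | slia].
have s1M : s1 M = s 0 by rewrite K1 /s0 ?updE ?eqxx //; slia.
do 2 eexists; split.
- apply: ExecSeq; first exact: ExecAssign.
  apply: ExecSeq; first exact: E1.
  apply: ExecSeq; first exact: ExecAssign.
  apply: ExecSeq; first exact: ExecAssign.
  have -> : update (update s1 M.+1 (eval s1 (EVar 0))) 0 (eval (update s1 M.+1 (eval s1 (EVar 0))) (EVar M)) = s1'.
    by congr (update _ 0 _); rewrite /= updE (ltn_eqF (ltnSn M)).
  apply: ExecSeq; first exact: E2.
  exact: ExecAssign.
- by rewrite /update /= s2M O2.
- move=> x Hx; have x0 : (x == 0) = false by slia.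
  rewrite updE x0 K2; last by slia.
  rewrite /s1' !updE x0 (ltac:(slia) : x == M.+1 = false) K1; last by slia.
  by rewrite /s0 updE (ltac:(slia) : x == M = false).
- rewrite /= s2M O1 O2 !addn0 {1}/update (ltac:(slia) : M == M.+1 = false) s1M -/S.
  by clear -T1 S1 T2 S2; lia.
- by rewrite /=; slia.
Qed.

Definition ift (c a b : tree) : tree := if c is Leaf then b else a.

(** The pair of condition and input is computed first, so that the input survives the evaluation of
    the condition. *)
Lemma PFif c f g : PF c -> PF f -> PF g -> PF (fun d => ift (c d) (f d) (g d)).
Proof.
move=> Hc [c1 [m1 [p1 [m10 P1 H1]]]] [c2 [m2 [p2 [m20 P2 H2]]]].
have [cc [m [p [m0 P H]]]] := PFnode Hc PFid.
pose M := maxn (maxn m1 m2) m.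
exists (CSeq cc (CSeq (CAssign M (EVar 0)) (CSeq (CAssign 0 (ETl (EVar 0)))
  (CIf (EHd (EVar M)) c1 c2)))), M.+1, (fun n => p n + (p n + p n + p n + p n + p n) + p1 n + p2 n).
split; first by slia.
  by repeat (apply: isP_add || assumption).
move=> s; set S := tree_size (s 0).
have [t [s1 [E1 O1 K1 T1 S1]]] := H s.
have [Z1 Z2] : tree_size (c (s 0)) <= p S /\ S <= p S by move: S1; rewrite /= -/S; slia.
set s2 := update (update s1 M (s1 0)) 0 (s 0).
have s2M : s2 M = s1 0 by rewrite /s2 !updE eqxx; case: eqP => //; slia.
have ex t' s' : exec s2 (CIf (EHd (EVar M)) c1 c2) t' s' ->
    exists2 t'', exec s (CSeq cc (CSeq (CAssign M (EVar 0)) (CSeq (CAssign 0 (ETl (EVar 0)))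
      (CIf (EHd (EVar M)) c1 c2)))) t'' s' & t'' <= t' + p S + (p S + p S + p S).
  move=> E'; eexists.
    apply: ExecSeq; first exact: E1.
    apply: ExecSeq; first exact: ExecAssign.
    apply: ExecSeq; first exact: ExecAssign.
    have -> : update (update s1 M (eval s1 (EVar 0))) 0 (eval (update s1 M (eval s1 (EVar 0))) (ETl (EVar 0))) = s2.
      by congr (update _ 0 _); rewrite /= updE O1; case: eqP.
    exact: E'.
  rewrite /= !addn0 {1 2}/update; have -> : (0 == M) = false by slia.
  by rewrite O1 /= -/S; move: T1 S1; rewrite /= -/S; clear; lia.
have cst : eval_cost s2 (EHd (EVar M)) <= p S + p S.
  by rewrite /= s2M O1 /= -/S addn0; move: S1; rewrite /= -/S; slia.
have evM : eval s2 (EHd (EVar M)) = c (s 0) by rewrite /= s2M O1.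
have s20 : s2 0 = s 0 by [].
have keep x : M < x -> s2 x = s x.
  move=> Hx; rewrite /s2 !updE (ltac:(slia) : x == 0 = false) (ltac:(slia) : x == M = false).
  by apply: K1; slia.
case E: (c (s 0)) => [|u v] /=.
  have [t2 [s3 [E2 O2 K2 T2 S2]]] := H2 s2; rewrite s20 -/S in O2 T2 S2.
  have [t3 E3 T3] := ex _ _ (ExecIfFalse c1 (etrans evM E) E2).
  by exists t3, s3; split=> //; [move=> x Hx; rewrite K2 ?keep //; slia | slia | slia].
have [t2 [s3 [E2 O2 K2 T2 S2]]] := H1 s2; rewrite s20 -/S in O2 T2 S2.
have nl : eval s2 (EHd (EVar M)) <> Leaf by rewrite evM E.
have [t3 E3 T3] := ex _ _ (ExecIfTrue c2 nl E2).
by exists t3, s3; split=> //; [move=> x Hx; rewrite K2 ?keep //; slia | slia | slia].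
Qed.

Section Fold.
Variables (f a l : tree -> tree) (q : nat -> nat).
Hypotheses (Hf : PF f) (Ha : PF a) (Hl : PF l) (Hq : isP q).
Let stp d := fun acc x => f (Node acc (Node x d)).
Hypothesis Hb : forall d k, tree_size (foldl (stp d) (a d) (take k (lst (l d)))) <= q (tree_size d).

(** This is the only place where a loop is programmed. The size bound [Hb] on all intermediate
    accumulators is essential, since iterating a polynomial time step may produce exponential
    growth. *)
Lemma PFfold : PF (fun d => foldl (stp d) (a d) (lst (l d))).
Proof.
have [c1 [m1 [p1 [m10 P1 H1]]]] := Hf.
have [c [m [p [m0 P H]]]] := PFnode Ha (PFnode Hl PFid).
pose M := maxn m1 m.
(* Register [M] keeps the input, [M.+1] the rest of the list and [M.+2] the accumulator; [c1]
   touches only registers below [M]. *)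
pose body := CSeq (CAssign 0 (ENode (EVar M.+2) (ENode (EHd (EVar M.+1)) (EVar M))))
  (CSeq c1 (CSeq (CAssign M.+2 (EVar 0)) (CAssign M.+1 (ETl (EVar M.+1))))).
(* This bounds the cost of one round when input and list have size at most [S] and the accumulator
   at most [Q]; the argument of [p1] bounds the node handed to [f]. *)
pose K S Q := 10 * S + 3 * Q + 3 + p1 (Q + 2 * S + 2).
have loop d S Q lt : tree_size d <= S -> forall s, s M = d -> s M.+1 = lt -> tree_size lt <= S ->
   (forall k, tree_size (foldl (stp d) (s M.+2) (take k (lst lt))) <= Q) ->
   exists t s', [/\ exec s (CWhile (EVar M.+1) body) t s', s' M.+2 = foldl (stp d) (s M.+2) (lst lt),
     forall x, M.+2 < x -> s' x = s x & t <= size (lst lt) * K S Q + S].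
  move=> dS; elim: lt => [|x _ lt IH] s sM sM1 lS bnd.
    exists (eval_cost s (EVar M.+1)), s; split=> //.
      by apply: ExecWhileFalse; rewrite /= sM1.
    by rewrite /= sM1 /= in lS *.
  have A0 : tree_size (s M.+2) <= Q by have := bnd 0; rewrite take0.
  set acc := s M.+2 in bnd A0 *.
  set s1 := update s 0 (Node acc (Node x d)).
  have [t2 [s2 [E2 O2 K2 T2 S2]]] := H1 s1.
  have s10 : s1 0 = Node acc (Node x d) by [].
  rewrite s10 in O2 T2 S2.
  have s1x y : 0 < y -> s1 y = s y by rewrite /s1 updE; case: y.
  have s2x y : M <= y -> s2 y = s y by move=> Hy; rewrite K2 ?s1x //; slia.
  set s3 := update (update s2 M.+2 (s2 0)) M.+1 lt.
  have EB : exec s body (eval_cost s (ENode (EVar M.+2) (ENode (EHd (EVar M.+1)) (EVar M))) + (t2 + (eval_cost s2 (EVar 0)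
      + eval_cost (update s2 M.+2 (s2 0)) (ETl (EVar M.+1))))) s3.
    apply: ExecSeq; first exact: ExecAssign.
    have -> : update s 0 (eval s (ENode (EVar M.+2) (ENode (EHd (EVar M.+1)) (EVar M)))) = s1.
      by rewrite /s1 /= sM1 sM.
    apply: ExecSeq; first exact: E2.
    apply: ExecSeq; first exact: ExecAssign.
    have -> : s3 = update (update s2 M.+2 (s2 0)) M.+1 (eval (update s2 M.+2 (s2 0)) (ETl (EVar M.+1))).
      by congr (update _ M.+1 _); rewrite /= updE (ltn_eqF (ltnSn _)) s2x ?sM1.
    exact: ExecAssign.
  have s3M : s3 M = d by rewrite /s3 !updE (ltn_eqF (ltnSn M)) (ltn_eqF (ltac:(slia) : M < M.+2)) s2x.
  have s3M1 : s3 M.+1 = lt by rewrite /s3 updE eqxx.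
  have s3M2 : s3 M.+2 = stp d acc x by rewrite /s3 !updE eqxx O2; case: eqP => //; slia.
  have [|k|t4 [s4 [E4 O4 K4 T4]]] := IH s3 s3M s3M1.
  - by move: lS => /=; slia.
  - by have := bnd k.+1; rewrite s3M2.
  eexists; exists s4; split.
  - by apply: ExecWhileTrue EB E4; rewrite /= sM1.
  - by rewrite O4 s3M2.
  - move=> y Hy; rewrite K4 // /s3 !updE (ltac:(slia) : y == M.+1 = false) (ltac:(slia) : y == M.+2 = false).
    by rewrite s2x //; slia.
  have Q1 : tree_size (stp d acc x) <= Q by have := bnd 1; rewrite /= take0.
  have T2' : t2 <= p1 (Q + 2 * S + 2).
    by apply: leq_trans T2 _; apply: isP_mono => //=; move: lS A0 dS => /=; slia.
  move: T4; rewrite /= mulSn /K sM1 sM -/acc updE (ltn_eqF (ltnSn M.+1)) O2 s2x; last by slia.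
  rewrite sM1 /= -/(stp d acc x) !addn0; move: (size _ * _) => Z.
  by move: lS A0 dS Q1 T2' => /=; clear; lia.
pose prog := CSeq c (CSeq (CAssign M (ETl (ETl (EVar 0)))) (CSeq (CAssign M.+1 (EHd (ETl (EVar 0))))
  (CSeq (CAssign M.+2 (EHd (EVar 0))) (CSeq (CWhile (EVar M.+1) body) (CAssign 0 (EVar M.+2)))))).
exists prog, M.+3, (fun n => p n + (10 * p n) + (p n * K (p n) (q n) + p n) + q n).
split=> //.
  by repeat (apply: isP_add || apply: isP_mul || apply: isP_const || assumption || apply: (isP_comp P1)).
move=> s; have [t [s1 [E1 O1 K1 T1 S1]]] := H s; set d := s 0 in O1 T1 S1 *.
set S := tree_size d in T1 S1 *.
have [Z1 [Z2 Z3]] : tree_size (a d) <= p S /\ tree_size (l d) <= p S /\ S <= p S.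
  by move: S1; rewrite /= -/S; slia.
set s2 := update (update (update s1 M d) M.+1 (l d)) M.+2 (a d).
have neq : [/\ M == M.+2 = false, M == M.+1 = false, M.+1 == M.+2 = false, 0 == M = false & [/\ 0 == M.+1 = false & 0 == M.+2 = false]].
  by split; slia.
have [n1 n2 n3 n4 [n5 n6]] := neq.
have [||||k|t3 [s3 [E3 O3 K3 T3]]] := loop d (p S) (q S) (l d) _ s2.
- exact: Z3.
- by rewrite /s2 !updE n1 n2 eqxx.
- by rewrite /s2 !updE n3 eqxx.
- exact: Z2.
- by rewrite /s2 [X in foldl _ X _]updE eqxx; apply: Hb.
rewrite [s2 _]updE eqxx in O3.
do 2 eexists; split.
- apply: ExecSeq; first exact: E1.
  apply: ExecSeq; first exact: ExecAssign.
  apply: ExecSeq; first exact: ExecAssign.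
  apply: ExecSeq; first exact: ExecAssign.
  have <- : s2 = update (update (update s1 M (eval s1 (ETl (ETl (EVar 0))))) M.+1 (eval (update s1 M (eval s1 (ETl (ETl (EVar 0))))) (EHd (ETl (EVar 0)))))
     M.+2 (eval (update (update s1 M (eval s1 (ETl (ETl (EVar 0))))) M.+1 (eval (update s1 M (eval s1 (ETl (ETl (EVar 0))))) (EHd (ETl (EVar 0))))) (EHd (EVar 0))).
    by rewrite /s2 /= !updE n4 n5 O1.
  apply: ExecSeq; first exact: E3.
  exact: ExecAssign.
- by rewrite updE eqxx /= O3.
- move=> x Hx; rewrite updE (ltac:(slia) : x == 0 = false) K3; last by slia.
  by rewrite /s2 !updE !(ltac:(slia) : x == M = false) (ltac:(slia) : x == M.+1 = false) (ltac:(slia) : x == M.+2 = false) K1 //; slia.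
- have B := Hb d (size (lst (l d))); rewrite take_size -/S in B.
  rewrite /= !updE n4 n5 O1 O3 /= !addn0 -/S.
  have : size (lst (l d)) * K (p S) (q S) <= p S * K (p S) (q S).
    by rewrite leq_mul2r; apply/orP; right; have := size_lst (l d); slia.
  move: S1 T3; rewrite /= -/S; move: (_ * K _ _) (_ * K _ _) => *; slia.
- by have := Hb d (size (lst (l d))); rewrite take_size -/S; slia.
Qed.

End Fold.

Ltac ispoly := repeat first [ assumption | lazymatch goal with
  | |- isP (fun x => x) => exact isP_id
  | |- isP (addn ?k) => exact (isP_add (isP_const k) isP_id)
  | |- isP (fun x => _ + _) => apply isP_add
  | |- isP (fun x => _ * _) => apply isP_mul
  | |- isP (fun _ => ?k) => exact (isP_const k)
  end ].

Lemma PF_size f : PF f -> exists2 q, isP q & forall d, tree_size (f d) <= q (tree_size d).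
Proof.
move=> [c [m [p [_ Hp H]]]]; exists p => // d.
by have [t [s [_ _ _ _]]] := H (fun=> d).
Qed.

Lemma PFfoldl (g : tree -> tree -> tree -> tree) (a l : tree -> tree) q :
  PF (fun e => g (hd_tree e) (hd_tree (tl_tree e)) (tl_tree (tl_tree e))) -> PF a -> PF l -> isP q ->
  (forall d k, tree_size (foldl (fun acc x => g acc x d) (a d) (take k (lst (l d)))) <= q (tree_size d)) ->
  PF (fun d => foldl (fun acc x => g acc x d) (a d) (lst (l d))).
Proof. by move=> Hg Ha Hl Hq Hb; exact: (PFfold Hg Ha Hl Hq Hb). Qed.

Lemma foldl_size (g : tree -> tree -> tree) a t c k :
  (forall acc x, tree_size x <= tree_size t -> tree_size (g acc x) <= tree_size acc + c) ->
  tree_size (foldl g a (take k (lst t))) <= tree_size a + tree_size t * c.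
Proof.
elim: t a k => [|x _ t IH] a k H /=; first by slia.
case: k => [|k] /=; first by slia.
have := IH (g a x) k; have := H a x ltac:(rewrite /=; slia) => H1 H2.
have := H2 (fun acc y Hy => H acc y (ltac:(rewrite /=; slia))).
move: H1; clear; move: (tree_size x) (tree_size t) (tree_size _) (tree_size _) (tree_size a) => *; nia.
Qed.

(** * Polynomial time predicates and operations on lists and unary numbers *)

Definition PP (P : tree -> bool) : Prop := PF (fun d => enc_bool (P d)).

Lemma PP_ext P Q : P =1 Q -> PP P -> PP Q.
Proof. by move=> PQ; apply: PF_ext => d; rewrite PQ. Qed.

Lemma PPcomp f P : PF f -> PP P -> PP (fun d => P (f d)).
Proof. by move=> Hf HP; exact: (PFcomp Hf HP). Qed.

Lemma PPtrue : PP (fun=> true).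
Proof. exact: (PFnode PFleaf PFleaf). Qed.

Lemma PPnot P : PP P -> PP (fun d => ~~ P d).
Proof. by move=> H; apply: PF_ext (PFif H PFleaf PPtrue) => d; case: (P d). Qed.

Lemma PPand P Q : PP P -> PP Q -> PP (fun d => P d && Q d).
Proof. by move=> HP HQ; apply: PF_ext (PFif HP HQ PFleaf) => d; case: (P d). Qed.

Lemma PPor P Q : PP P -> PP Q -> PP (fun d => P d || Q d).
Proof. by move=> HP HQ; apply: PF_ext (PFif HP PPtrue HQ) => d; case: (P d). Qed.

Lemma PFifb P f g : PP P -> PF f -> PF g -> PF (fun d => if P d then f d else g d).
Proof. by move=> HP Hf Hg; apply: PF_ext (PFif HP Hf Hg) => d; case: (P d). Qed.

Definition isnode (t : tree) : bool := if t is Node _ _ then true else false.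

Lemma PPnode f : PF f -> PP (fun d => isnode (f d)).
Proof. by move=> Hf; apply: PF_ext (PFif Hf PPtrue PFleaf) => d; case: (f d). Qed.

Ltac pf1 := first [ assumption | lazymatch goal with
  | |- PP (fun _ => true) => exact PPtrue
  | |- PP (fun _ => _ && _) => apply PPand
  | |- PP (fun _ => _ || _) => apply PPor
  | |- PP (fun _ => ~~ _) => apply PPnot
  | |- PP (fun _ => isnode _) => apply PPnode
  | |- PF (fun x => x) => exact PFid
  | |- PF (fun _ => Leaf) => exact PFleaf
  | |- PF hd_tree => exact PFhd_
  | |- PF tl_tree => exact PFtl_
  | |- PF (fun _ => hd_tree _) => apply PFhd
  | |- PF (fun _ => tl_tree _) => apply PFtl
  | |- PF (fun _ => Node _ _) => apply PFnode
  | |- PF (Node ?a) => refine (@PFnode (fun _ => a) (fun d => d) _ _)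
  | |- PF (fun _ => if _ then _ else _) => apply PFifb
  end ].
Ltac pf := repeat pf1.

Lemma PPhas (P : tree -> tree -> bool) l : PP (fun e => P (hd_tree e) (tl_tree e)) -> PF l ->
  PP (fun d => has (fun x => P x d) (lst (l d))).
Proof.
move=> HP Hl.
have E d s (b : bool) : foldl (fun acc x => if isnode acc || P x d then enc_bool true else Leaf) (enc_bool b) s
    = enc_bool (b || has (fun x => P x d) s).
  elim: s b => [|x s IH] b /=; first by rewrite orbF.
  have := IH (b || P x d); rewrite -orbA => <-; congr foldl.
  by case: b; case: (P x d).
have H : PF (fun d => foldl (fun acc x => if isnode acc || P x d then enc_bool true else Leaf) Leaf (lst (l d))).
  apply: (@PFfoldl (fun acc x d => if isnode acc || P x d then enc_bool true else Leaf) (fun=> Leaf) l (fun=> 3)) => //.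
  - apply: PFifb; last exact: PFleaf; last exact: PPtrue.
    apply: PPor; first by pf.
    by apply: (@PPcomp tl_tree (fun e => P (hd_tree e) (tl_tree e))) => //; pf.
  - exact: PFleaf.
  - exact: isP_const.
  - by move=> d k; rewrite (E d _ false); case: (_ || _).
by apply: PF_ext H => d; rewrite (E d _ false).
Qed.

Definition filt (P : tree -> bool) (t : tree) : tree :=
  foldl (fun acc x => if P x then Node x acc else acc) Leaf (lst t).

Lemma has_filt (P Q : tree -> bool) t : has Q (lst (filt P t)) = has (fun x => P x && Q x) (lst t).
Proof.
rewrite /filt -[RHS]/(has Q (lst Leaf) || _); elim: (lst t) Leaf => [|x s IH] a /=; first by rewrite orbF.
rewrite IH; case: (P x) => //=.
by rewrite orbA [Q x || _]orbC.
Qed.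

Lemma size_filt P t : size (lst (filt P t)) = count P (lst t).
Proof.
rewrite /filt -[RHS]/(size (lst Leaf) + _); elim: (lst t) Leaf => [|x s IH] a /=; first by rewrite addn0.
by rewrite IH; case: (P x) => /=; slia.
Qed.

Lemma filt_size P t : tree_size (filt P t) <= 1 + tree_size t * (1 + tree_size t).
Proof.
rewrite /filt -[lst t in X in X <= _]take_size; apply: foldl_size => acc x Hx.
by case: (P x) => /=; slia.
Qed.

Lemma PFfilt (P : tree -> tree -> bool) l : PP (fun e => P (hd_tree e) (tl_tree e)) -> PF l ->
  PF (fun d => filt (fun x => P x d) (l d)).
Proof.
move=> HP Hl; have [q Hq B] := PF_size Hl.
apply: (@PFfoldl (fun acc x d => if P x d then Node x acc else acc) (fun=> Leaf) l (fun n => 1 + q n * (1 + q n))) => //.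
- apply: PFifb; try by pf.
  by apply: (@PPcomp tl_tree (fun e => P (hd_tree e) (tl_tree e))) => //; pf.
- exact: PFleaf.
- by ispoly.
move=> d k; apply: leq_trans (foldl_size (c := 1 + tree_size (l d)) _ _ _) _.
  by move=> acc x Hx; case: (P x d) => /=; slia.
by rewrite leq_add2l leq_mul // leq_add2l.
Qed.

(** Numbers are unary, and every tree is read as the length of its list. So a list serves directly
    as its cardinality, and the list of rows of a graph as its number of vertices. *)
Definition val (t : tree) : nat := size (lst t).
Definition num (k : nat) : tree := enc_seq (nseq k Leaf).

Lemma val_num k : val (num k) = k.
Proof. by rewrite /val lst_enc size_nseq. Qed.

Lemma val_enc s : val (enc_seq s) = size s.
Proof. by rewrite /val lst_enc. Qed.

Definition app (t u : tree) : tree := foldl (fun acc x => Node x acc) u (lst t).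

Lemma val_app t u : val (app t u) = val t + val u.
Proof. by rewrite /val /app; elim: (lst t) u => //= x s IH u; rewrite IH /=; slia. Qed.

Lemma PFapp f g : PF f -> PF g -> PF (fun d => app (f d) (g d)).
Proof.
move=> Hf Hg; have [q Hq B] := PF_size Hf; have [r Hr C] := PF_size Hg.
apply: (@PFfoldl (fun acc x d => Node x acc) g f (fun n => r n + q n * (1 + q n))) => //; first by pf.
  by ispoly.
move=> d k; apply: leq_trans (foldl_size (c := 1 + tree_size (f d)) _ _ _) _.
  by move=> acc x Hx /=; slia.
by rewrite leq_add // leq_mul // leq_add2l.
Qed.

Definition dropt (t u : tree) : tree := foldl (fun acc _ => tl_tree acc) u (lst t).

Lemma lst_tl t : lst (tl_tree t) = behead (lst t). Proof. by case: t. Qed.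

Lemma lst_dropt t u : lst (dropt t u) = drop (val t) (lst u).
Proof.
rewrite /dropt /val; elim: (lst t) u => [|x s IH] u /=; first by rewrite drop0.
by rewrite IH lst_tl -drop1 drop_drop addn1.
Qed.

Lemma isnodeE t : isnode t = (0 < val t). Proof. by case: t. Qed.

Lemma PFdropt f g : PF f -> PF g -> PF (fun d => dropt (f d) (g d)).
Proof.
move=> Hf Hg; have [r Hr C] := PF_size Hg.
apply: (@PFfoldl (fun acc x d => tl_tree acc) g f r) => //; first by pf.
move=> d k; apply: leq_trans (foldl_size (c := 0) _ _ _) _.
  by move=> acc x _; rewrite addn0 tl_size.
by rewrite muln0 addn0.
Qed.

Lemma PPle f g : PF f -> PF g -> PP (fun d => val (f d) <= val (g d)).
Proof.
move=> Hf Hg; apply: PP_ext (PPnot (PPnode (PFdropt Hg Hf))) => d.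
by rewrite isnodeE /val lst_dropt size_drop /val; slia.
Qed.

Lemma PPeq f g : PF f -> PF g -> PP (fun d => val (f d) == val (g d)).
Proof. by move=> Hf Hg; apply: PP_ext (PPand (PPle Hf Hg) (PPle Hg Hf)) => d; rewrite -eqn_leq. Qed.

Definition mod4 (t : tree) : tree :=
  foldl (fun acc _ => if isnode (tl_tree (tl_tree acc)) then Leaf else Node Leaf acc) Leaf (lst t).

Lemma mod4E t : mod4 t = num (val t %% 4).
Proof.
have H s k : foldl (fun acc (_ : tree) => if isnode (tl_tree (tl_tree acc)) then Leaf else Node Leaf acc) (num (k %% 4)) s
   = num ((k + size s) %% 4); last exact: (H _ 0).
elim: s k => [|x s IH] k /=; first by rewrite addn0.
rewrite -addSnnS -IH; congr foldl.
have [E|[E|[E|E]]] : k %% 4 = 0 \/ k %% 4 = 1 \/ k %% 4 = 2 \/ k %% 4 = 3 by slia.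
- have E' : k.+1 %% 4 = 1 by slia.
  by rewrite E E'.
- have E' : k.+1 %% 4 = 2 by slia.
  by rewrite E E'.
- have E' : k.+1 %% 4 = 3 by slia.
  by rewrite E E'.
- have E' : k.+1 %% 4 = 0 by slia.
  by rewrite E E'.
Qed.

Lemma PPmod4 f : PF f -> PP (fun d => val (f d) %% 4 == 2).
Proof.
move=> Hf; have H : PF (fun d => mod4 (f d)).
  apply: (@PFfoldl (fun acc x d => if isnode (tl_tree (tl_tree acc)) then Leaf else Node Leaf acc) (fun=> Leaf) f (fun=> 8)) => //; try by pf.
    exact: isP_const.
  move=> d k; have := mod4E (enc_seq (take k (lst (f d)))); rewrite /mod4 lst_enc => ->.
  by move: (_ %% 4) (ltn_pmod (val (enc_seq (take k (lst (f d))))) (isT : 0 < 4)); do 4 case=> //.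
apply: PP_ext (PPeq H (PFnode PFleaf (PFnode PFleaf PFleaf))) => d.
by rewrite mod4E val_num.
Qed.

Fixpoint nums (k : nat) : tree := if k is k'.+1 then Node (num k') (nums k') else Leaf.

Lemma has_nums P k : has P (lst (nums k)) = [exists i : 'I_k, P (num i)].
Proof.
elim: k => [|k IH] /=; first by apply/esym/existsP => -[[]].
rewrite IH; apply/orP/existsP => [[H|/existsP[i Hi]]|[i Hi]].
- by exists ord_max.
- by exists (lift ord_max i); rewrite lift_max.
- have [ik|] := eqVneq (i : nat) k; first by left; rewrite -ik.
  move=> ne; have ik : i < k by have := ltn_ord i; slia.
  by right; apply/existsP; exists (Ordinal ik).
Qed.

Lemma size_num k : tree_size (num k) = k.*2.+1.
Proof. by elim: k => //= k; rewrite /num /= => ->; slia. Qed.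

Lemma size_nums k : tree_size (nums k) = 1 + k * k.+1.
Proof. by elim: k => //= k ->; rewrite size_num; nia. Qed.

Lemma nums_foldl s k : foldl (fun acc (_ : tree) => Node (if isnode acc then Node Leaf (hd_tree acc) else Leaf) acc) (nums k) s = nums (k + size s).
Proof.
elim: s k => [|x s IH] k /=; first by rewrite addn0.
by rewrite -addSnnS -IH; congr foldl; case: k.
Qed.

Lemma PFnums f : PF f -> PF (fun d => nums (val (f d))).
Proof.
move=> Hf; have [q Hq B] := PF_size Hf.
have H : PF (fun d => foldl (fun acc (_ : tree) => Node (if isnode acc then Node Leaf (hd_tree acc) else Leaf) acc) Leaf (lst (f d))).
  apply: (@PFfoldl (fun acc x d => Node (if isnode acc then Node Leaf (hd_tree acc) else Leaf) acc) (fun=> Leaf) f (fun n => 1 + q n * (1 + q n))) => //; try by pf.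
    by ispoly.
  move=> d k; rewrite (nums_foldl _ 0) add0n size_nums leq_add2l.
  have : size (take k (lst (f d))) <= q (tree_size d).
    by apply: leq_trans (B d); have := size_lst (f d); rewrite size_take; case: ifP; slia.
  by move=> H; apply: leq_mul => //; rewrite add1n.
by apply: PF_ext H => d; rewrite (nums_foldl _ 0).
Qed.

Definition prodt (t u : tree) : tree :=
  foldl (fun acc x => foldl (fun acc' y => Node (Node x y) acc') acc (lst u)) Leaf (lst t).

Lemma prodtE t u : lst (prodt t u) = rev [seq Node x y | x <- lst t, y <- lst u].
Proof.
have H x s a : lst (foldl (fun acc' y => Node (Node x y) acc') a s) = rev [seq Node x y | y <- s] ++ lst a.
  by elim: s a => //= y s IH a; rewrite IH rev_cons cat_rcons.
have K s a : lst (foldl (fun acc x => foldl (fun acc' y => Node (Node x y) acc') acc (lst u)) a s)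
    = rev [seq Node x y | x <- s, y <- lst u] ++ lst a; last by rewrite /prodt K cats0.
elim: s a => [|x s IH] a //=.
by rewrite IH H rev_cat catA.
Qed.

Lemma PFprodt f g : PF f -> PF g -> PF (fun d => prodt (f d) (g d)).
Proof.
move=> Hf Hg; have [q Hq B] := PF_size Hf; have [r Hr C] := PF_size Hg.
have bi acc x u k : tree_size (foldl (fun acc' y => Node (Node x y) acc') acc (take k (lst u)))
    <= tree_size acc + tree_size u * (2 + tree_size x + tree_size u).
  apply: foldl_size => acc' y Hy /=; slia.
apply: (@PFfoldl (fun acc x d => foldl (fun acc' y => Node (Node x y) acc') acc (lst (g d))) (fun=> Leaf) f
   (fun n => 1 + q n * (r n * (2 + q n + r n)))) => //; try by pf.
- apply: (@PFfoldl (fun acc y e => Node (Node (hd_tree (tl_tree e)) y) acc) hd_tree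
     (fun e => g (tl_tree (tl_tree e))) (fun n => n + r n * (2 + n + r n))).
  + by pf.
  + by pf.
  + by apply: (@PFcomp (fun e => tl_tree (tl_tree e))) => //; pf.
  + by ispoly.
  move=> e k; apply: leq_trans (bi _ _ _ _) _.
  have C' : tree_size (g (tl_tree (tl_tree e))) <= r (tree_size e).
    apply: leq_trans (C _) (isP_mono Hr _).
    by apply: leq_trans (tl_size _) (tl_size _).
  apply: leq_add; first exact: hd_size.
  apply: leq_mul => //; apply: leq_add => //; rewrite leq_add2l.
  by apply: leq_trans (hd_size _) (tl_size _).
- by ispoly.
move=> d k; apply: leq_trans (foldl_size (c := tree_size (g d) * (2 + tree_size (f d) + tree_size (g d))) _ _ _) _.
  move=> acc x Hx; have := bi acc x (g d) (size (lst (g d))); rewrite take_size => /leq_trans; apply.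
  by rewrite leq_add2l leq_mul // leq_add2r leq_add2l.
rewrite leq_add2l; do 2 (apply: leq_mul => //).
by rewrite leq_add // leq_add2l.
Qed.

Definition get (x : nat) (env : tree) : tree := hd_tree (iter x tl_tree env).

Fixpoint set (x : nat) (v env : tree) : tree :=
  if x is x'.+1 then Node (hd_tree env) (set x' v (tl_tree env)) else Node v (tl_tree env).

Lemma get_set x v env y : get y (set x v env) = if eqn x y then v else get y env.
Proof.
elim: x y env => [|x IH] [|y] env //=; rewrite /get ?iterSr //=.
exact: IH.
Qed.

Lemma PFget x f : PF f -> PF (fun d => get x (f d)).
Proof. by move=> Hf; apply: PFhd; elim: x => //= x; apply: PFtl. Qed.

Lemma PFset x f g : PF f -> PF g -> PF (fun d => set x (f d) (g d)).
Proof. by move=> Hf; elim: x g => [|x IH] g Hg /=; pf; apply: IH; pf. Qed.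

(** * Formulas over graphs *)

(* Formulas over a finite graph with two sorts of variables, vertices and numbers below
   the number of vertices.  [FMod l] says that the sum of the variables in [l] is 2
   modulo 4, and [FWalk x y f s t k] that some walk of length [k] leads from [s] to [t],
   with steps [x, y] satisfying [f]. *)
Inductive fm :=
  | FAdj of nat & nat
  | FEq of nat & nat
  | FSum of nat & nat & nat
  | FMod of seq nat
  | FNot of fm
  | FAnd of fm & fm
  | FEx of nat & fm
  | FExN of nat & fm
  | FWalk of nat & nat & fm & nat & nat & nat.

Definition upd (A : Type) x (v : A) (r : nat -> A) : nat -> A := fun y => if eqn x y then v else r y.

Section Program.
Variables (adjt eqt : tree -> tree -> tree -> bool) (univ : tree -> tree).

(** For [FWalk], the list of possible ends is updated once for each step, so no walk is ever
    enumerated. Each new list is filtered from [univ rt], which keeps its size polynomial. *)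
Fixpoint evt (rt ev en : tree) (f : fm) : bool :=
  match f with
  | FAdj x y => adjt (get x ev) (get y ev) rt
  | FEq x y => eqt (get x ev) (get y ev) rt
  | FSum i j k => val (get i en) + val (get j en) == val (get k en)
  | FMod l => (\sum_(i <- l) val (get i en)) %% 4 == 2
  | FNot f => ~~ evt rt ev en f
  | FAnd f g => evt rt ev en f && evt rt ev en g
  | FEx x f => has (fun v => evt rt (set x v ev) en f) (lst (univ rt))
  | FExN i f => has (fun v => evt rt ev (set i v en) f) (lst (nums (val (univ rt))))
  | FWalk x y f s t k => has (fun v => eqt v (get t ev) rt)
      (lst (foldl (fun acc _ =>
                     filt (fun v => has (fun u => evt rt (set y v (set x u ev)) en f) (lst acc)) (univ rt))
                  (Node (get s ev) Leaf) (lst (get k en))))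
  end.

Hypothesis HA : PP (fun e => adjt (hd_tree e) (hd_tree (tl_tree e)) (tl_tree (tl_tree e))).
Hypothesis HE : PP (fun e => eqt (hd_tree e) (hd_tree (tl_tree e)) (tl_tree (tl_tree e))).
Hypothesis HU : PF univ.

Lemma PP_evt f : PP (fun d => evt (tl_tree (tl_tree d)) (hd_tree d) (hd_tree (tl_tree d)) f).
Proof.
have HU' : PF (fun d => univ (tl_tree (tl_tree d))) by apply: (PFcomp (f := fun d => tl_tree (tl_tree d))) => //; pf.
have G x : PF (fun d => get x (hd_tree d)) by apply: PFget; pf.
have Gn x : PF (fun d => get x (hd_tree (tl_tree d))) by apply: PFget; pf.
elim: f => [x y|x y|i j k|l|f IH|f IHf g IHg|x f IH|i f IH|x y f IH s t k] /=.
- apply: (@PPcomp (fun d => Node (get x (hd_tree d)) (Node (get y (hd_tree d)) (tl_tree (tl_tree d)))) _ _ HA).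
  by pf.
- apply: (@PPcomp (fun d => Node (get x (hd_tree d)) (Node (get y (hd_tree d)) (tl_tree (tl_tree d)))) _ _ HE).
  by pf.
- by apply: PP_ext (PPeq (PFapp (Gn i) (Gn j)) (Gn k)) => d; rewrite val_app.
- have [g Hg Eg] : exists2 g, PF g & forall d, val (g d) = \sum_(i <- l) val (get i (hd_tree (tl_tree d))).
    elim: l => [|i l [g Hg Eg]]; first by exists (fun=> Leaf) => [|d]; [exact: PFleaf | rewrite big_nil].
    exists (fun d => app (get i (hd_tree (tl_tree d))) (g d)) => [|d]; first exact: PFapp.
    by rewrite val_app big_cons Eg.
  by apply: PP_ext (PPmod4 Hg) => d; rewrite Eg.
- exact: PPnot.
- exact: PPand.
- apply: (@PPhas (fun v d => evt (tl_tree (tl_tree d)) (set x v (hd_tree d)) (hd_tree (tl_tree d)) f)) => //.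
  apply: (@PPcomp (fun e => Node (set x (hd_tree e) (hd_tree (tl_tree e)))
    (Node (hd_tree (tl_tree (tl_tree e))) (tl_tree (tl_tree (tl_tree e))))) _ _ IH).
  by pf; apply: PFset; pf.
- apply: (@PPhas (fun v d => evt (tl_tree (tl_tree d)) (hd_tree d) (set i v (hd_tree (tl_tree d))) f)) => //; last exact: PFnums.
  apply: (@PPcomp (fun e => Node (hd_tree (tl_tree e))
    (Node (set i (hd_tree e) (hd_tree (tl_tree (tl_tree e)))) (tl_tree (tl_tree (tl_tree e))))) _ _ IH).
  by pf; apply: PFset; pf.
apply: (@PPhas (fun v d => eqt v (get t (hd_tree d)) (tl_tree (tl_tree d)))).
  apply: (@PPcomp (fun e => Node (hd_tree e) (Node (get t (hd_tree (tl_tree e))) (tl_tree (tl_tree (tl_tree e))))) _ _ HE).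
  by pf; apply: PFget; pf.
pose P v e := has (fun u => evt (tl_tree (tl_tree (tl_tree (tl_tree e)))) (set y v (set x u (hd_tree (tl_tree (tl_tree e)))))
  (hd_tree (tl_tree (tl_tree (tl_tree e)))) f) (lst (hd_tree e)).
have HP : PP (fun e => P (hd_tree e) (tl_tree e)).
  apply: (@PPhas (fun u e => evt (tl_tree (tl_tree (tl_tree (tl_tree (tl_tree e)))))
     (set y (hd_tree e) (set x u (hd_tree (tl_tree (tl_tree (tl_tree e))))))
     (hd_tree (tl_tree (tl_tree (tl_tree (tl_tree e))))) f) (fun e => hd_tree (tl_tree e))); last by pf.
  apply: (@PPcomp (fun e => Node (set y (hd_tree (tl_tree e)) (set x (hd_tree e) (hd_tree (tl_tree (tl_tree (tl_tree (tl_tree e)))))))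
    (Node (hd_tree (tl_tree (tl_tree (tl_tree (tl_tree (tl_tree e))))))
      (tl_tree (tl_tree (tl_tree (tl_tree (tl_tree (tl_tree e)))))))) _ _ IH).
  by apply: PFnode; [apply: PFset; [pf | apply: PFset; pf] | pf].
have [q Hq B] := PF_size HU'.
apply: (@PFfoldl (fun acc _ d => filt (fun v => has (fun u => evt (tl_tree (tl_tree d)) (set y v (set x u (hd_tree d)))
     (hd_tree (tl_tree d)) f) (lst acc)) (univ (tl_tree (tl_tree d)))) (fun d => Node (get s (hd_tree d)) Leaf) _
     (fun n => (n + 2) + (1 + q n * (1 + q n)))) => //.
- apply: (@PFfilt P (fun e => univ (tl_tree (tl_tree (tl_tree (tl_tree e)))))) => //.
  apply: (@PFcomp (fun e => tl_tree (tl_tree e)) (fun d => univ (tl_tree (tl_tree d)))) => //.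
  by pf.
- by pf.
- by ispoly.
move=> d k'; case: (lastP (take k' _)) => [|l z].
  rewrite /=; have : tree_size (get s (hd_tree d)) <= tree_size d; last by slia.
  apply: leq_trans (hd_size _) _; apply: leq_trans (hd_size d).
  by elim: (s) => //= m; apply: leq_trans (tl_size _).
rewrite foldl_rcons; apply: leq_trans (leq_addl _ _).
apply: leq_trans (filt_size _ _) _.
by rewrite leq_add2l leq_mul // leq_add2l.
Qed.

Section Meaning.
Variables (V : finType) (adj : rel V) (R : tree -> V -> Prop) (rt : tree).
Hypothesis adjE : forall t t' u v, R t u -> R t' v -> adjt t t' rt = adj u v.
Hypothesis eqE : forall t t' u v, R t u -> R t' v -> eqt t t' rt = (u == v).
Variables (enc : V -> tree) (sV : seq V).
Hypotheses (univE : lst (univ rt) = map enc sV) (encR : forall v, R (enc v) v)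
  (sVT : forall v, v \in sV) (sVn : size sV = #|V|).

Fixpoint sem (rv : nat -> V) (rn : nat -> nat) (f : fm) : bool :=
  match f with
  | FAdj x y => adj (rv x) (rv y)
  | FEq x y => rv x == rv y
  | FSum i j k => rn i + rn j == rn k
  | FMod l => (\sum_(i <- l) rn i) %% 4 == 2
  | FNot f => ~~ sem rv rn f
  | FAnd f g => sem rv rn f && sem rv rn g
  | FEx x f => [exists v, sem (upd x v rv) rn f]
  | FExN i f => [exists k : 'I_#|V|, sem rv (upd i (k : nat) rn) f]
  | FWalk x y f s t k => wkb (fun u v => sem (upd y v (upd x u rv)) rn f) (rn k) (rv s) (rv t)
  end.

Lemma has_univ P (p : pred V) : (forall t v, R t v -> P t = p v) -> has P (lst (univ rt)) = [exists v, p v].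
Proof.
move=> H; rewrite univE has_map; apply/hasP/existsP => [[v _ /=]|[v pv]].
  by rewrite (H _ v) //; exists v.
by exists v => //=; rewrite (H _ v).
Qed.

Lemma wkb_rcons (r : rel V) k s v : wkb r k.+1 s v = [exists u, wkb r k s u && r u v].
Proof.
apply/wkbP/existsP => [[x [x0 xk H]]|[u /andP[/wkbP[x [x0 xk H]] uv]]].
  exists (x k); rewrite -xk H // andbT; apply/wkbP; exists x; split=> // i ik; apply: H; slia.
exists (fun i => if i <= k then x i else v); split=> //; first by rewrite ltnn.
move=> i Hi; rewrite (ltac:(slia) : i <= k); case: ltnP => C; first exact: H.
have -> : i = k by slia.
by rewrite xk.
Qed.

(** Representation is a relation [R], not a function, because a vertex is represented by every tree
    with the right value, in particular by the [Leaf] read outside an environment. *)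
Lemma evt_sem f ev en rv rn : (forall x, R (get x ev) (rv x)) -> (forall i, val (get i en) = rn i) ->
  evt rt ev en f = sem rv rn f.
Proof.
have rs x t v ev' rv' : (forall x, R (get x ev') (rv' x)) -> R t v -> forall y, R (get y (set x t ev')) (upd x v rv' y).
  by move=> H tv y; rewrite get_set /upd; case: ifP.
elim: f ev en rv rn => [x y|x y|i j k|l|f IH|f IHf g IHg|x f IH|i f IH|x y f IH s t k] ev en rv rn Hv Hn /=.
- exact: adjE.
- exact: eqE.
- by rewrite !Hn.
- by under eq_bigr do rewrite Hn.
- by rewrite (IH ev en rv rn).
- by rewrite (IHf ev en rv rn) // (IHg ev en rv rn).
- by apply: has_univ => t v tv; apply: IH => //; apply: rs.
- rewrite has_nums /val univE size_map sVn; apply: eq_existsb => k; apply: IH => // j.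
  by rewrite get_set /upd; case: eqn; rewrite ?val_num.
pose stp := fun u v => sem (upd y v (upd x u rv)) rn f.
have H (l : seq tree) P (p : pred V) : (forall t v, R t v -> P t = p v) ->
   has P (lst (foldl (fun acc _ =>
     filt (fun v => has (fun u => evt rt (set y v (set x u ev)) en f) (lst acc)) (univ rt))
                  (Node (get s ev) Leaf) l)) = [exists v, wkb stp (size l) (rv s) v && p v].
  elim/last_ind: l P p => [|l z IHl] P p HP.
    rewrite /= (HP _ _ (Hv s)) orbF; apply/idP/existsP => [H|[v /andP[/eqP <-]] //].
    by exists (rv s); rewrite eqxx.
  rewrite foldl_rcons has_filt size_rcons.
  apply: has_univ => t' v tv; rewrite wkb_rcons (HP _ _ tv); congr (_ && _).
  by apply: IHl => t'' u tu; apply: IH => //; do 2 (apply: (rs) => //).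
rewrite (H _ _ (pred1 (rv t))); last by move=> t' v tv; apply: eqE.
rewrite -/(val _) Hn; apply/existsP/idP => [[v /andP[W /eqP <-]] //|W].
by exists (rv t); rewrite W /=.
Qed.

Lemma sem_ext f rv rv' rn rn' : rv =1 rv' -> rn =1 rn' -> sem rv rn f = sem rv' rn' f.
Proof.
have ue (A : Type) x (v : A) r r' : r =1 r' -> upd x v r =1 upd x v r' by move=> E y; rewrite /upd E.
elim: f rv rv' rn rn' => [x y|x y|i j k|l|f IH|f IHf g IHg|x f IH|i f IH|x y f IH s t k] rv rv' rn rn' Ev En /=;
  rewrite ?Ev ?En //.
- by under eq_bigr do rewrite En.
- by rewrite (IH rv rv' rn rn').
- by rewrite (IHf rv rv' rn rn') // (IHg rv rv' rn rn').
- by apply: eq_existsb => v; apply: IH => //; apply: ue.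
- by apply: eq_existsb => v; apply: IH => //; apply: ue.
- elim: (rn' k) (rv' s) => //= m IHm u; apply: eq_existsb => v; rewrite IHm; congr (_ && _).
  by apply: IH => //; do 2 apply: (ue).
Qed.

End Meaning.
End Program.

Definition FTrue := FEq 0 0.
Definition FOr f g := FNot (FAnd (FNot f) (FNot g)).
Definition FImp f g := FNot (FAnd f (FNot g)).
Definition FAll x f := FNot (FEx x (FNot f)).
Definition FAllN x f := FNot (FExN x (FNot f)).
Definition FBig (I : finType) (F : I -> fm) := foldr FAnd FTrue [seq F i | i <- enum I].
Definition FExs (l : seq nat) f := foldr FEx f l.
Definition FExNs (l : seq nat) f := foldr FExN f l.

Section Derived.
Variables (V : finType) (adj : rel V).
Notation sem := (sem adj).

Lemma sem_or rv rn f g : sem rv rn (FOr f g) = sem rv rn f || sem rv rn g.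
Proof. by rewrite /= negb_and !negbK. Qed.

Lemma sem_imp rv rn f g : sem rv rn (FImp f g) = (sem rv rn f ==> sem rv rn g).
Proof. by rewrite /= negb_and negbK implybE. Qed.

Lemma sem_all rv rn x f : sem rv rn (FAll x f) = [forall v, sem (upd x v rv) rn f].
Proof. by rewrite /= negb_exists; under eq_forallb do rewrite negbK. Qed.

Lemma sem_alln rv rn x f : sem rv rn (FAllN x f) = [forall k : 'I_#|V|, sem rv (upd x (k : nat) rn) f].
Proof. by rewrite /= negb_exists; under eq_forallb do rewrite negbK. Qed.

Lemma sem_big rv rn (I : finType) (F : I -> fm) : sem rv rn (FBig F) = [forall i, sem rv rn (F i)].
Proof.
have H s : sem rv rn (foldr FAnd FTrue [seq F i | i <- s]) = all (fun i => sem rv rn (F i)) s.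
  by elim: s => [|i s IH] /=; rewrite ?eqxx // IH.
rewrite /FBig H; apply/allP/forallP => [A i|A i _ //]; apply: A; exact: mem_enum.
Qed.

Lemma sem_exs l rv rn f : sem rv rn (FExs l f) <->
  exists2 rv', (forall y, y \notin l -> rv' y = rv y) & sem rv' rn f.
Proof.
elim: l rv => [|x l IH] rv /=.
  split=> [H|[rv' E]]; first by exists rv.
  by rewrite (@sem_ext _ adj f rv' rv rn rn) // => y; rewrite E.
split=> [/existsP[v /IH[rv' E H]]|[rv' E H]].
  exists rv' => // y; rewrite inE negb_or => /andP[yx yl]; rewrite E // /upd.
  by rewrite (_ : eqn x y = false) //; apply/negbTE; rewrite eq_sym in yx.
apply/existsP; exists (rv' x); apply/IH; exists rv' => // y yl; rewrite /upd; case: eqnP => [->//|xy].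
by apply: E; rewrite inE negb_or yl andbT; apply/eqP => yx; rewrite yx in xy.
Qed.

Lemma sem_exns l rv rn f : sem rv rn (FExNs l f) <->
  exists rn', [/\ forall y, y \notin l -> rn' y = rn y, forall y, y \in l -> rn' y < #|V| & sem rv rn' f].
Proof.
elim: l rn => [|x l IH] rn /=.
  split=> [H|[rn' [E _]]]; first by exists rn.
  by rewrite (@sem_ext _ adj f rv rv rn' rn) // => y; rewrite E.
split=> [/existsP[v /IH[rn' [E L H]]]|[rn' [E L H]]].
  exists rn'; split=> // y.
    rewrite inE negb_or => /andP[yx yl]; rewrite E // /upd.
    by rewrite (_ : eqn x y = false) //; apply/negbTE; rewrite eq_sym in yx.
  rewrite inE; have [yl _|yl] := boolP (y \in l); first exact: L.
  by rewrite orbF => /eqP yx; rewrite E // yx /upd (_ : eqn x x) ?ltn_ord //; apply/eqnP.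
have Lx : rn' x < #|V| by apply: L; rewrite inE eqxx.
apply/existsP; exists (Ordinal Lx); apply/IH; exists rn'; split=> // y yl.
  rewrite /upd /=; case: eqnP => [->//|xy].
  by apply: E; rewrite inE negb_or yl andbT; apply/eqP => yx; rewrite yx in xy.
by apply: L; rewrite inE yl orbT.
Qed.

End Derived.

(** * The formula for unbalanced holes *)

Lemma eq_wkb (T : finType) (R R' : rel T) k s t : R =2 R' -> wkb R k s t = wkb R' k s t.
Proof. by move=> E; elim: k s => //= k IH s; apply: eq_existsb => v; rewrite E IH. Qed.

Definition FNadj x y := FNot (FAdj x y).

Definition hexagon_fm : fm := FExs (iota 0 6)
  (FAnd (FAnd (FAdj 0 4) (FAnd (FAdj 0 5) (FAnd (FAdj 1 3) (FAnd (FAdj 1 5) (FAnd (FAdj 2 3) (FAdj 2 4))))))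
        (FAnd (FNadj 0 3) (FAnd (FNadj 1 4) (FNadj 2 5)))).

(* The temporary variables come first, so that updating them leaves the frame variables
   unchanged by mere computation. *)
Definition thr (b : bool) := b.+4.
Definition ths (i : 'I_3) (b : bool) := (2 * i + b).+4.+2.
Definition thm (i : 'I_3) (b : bool) := (2 * i + b).+4.+4.+4.
Definition thk (i : 'I_3) := i.+2.

Definition free_fm (i : 'I_3) v :=
  FAnd (FBig (fun c : bool => FNadj v (thr c)))
       (FBig (fun i' : 'I_3 => if i' == i then FTrue else FBig (fun c : bool => FNadj v (ths i' c)))).

Definition fwalk_fm i s t k := FWalk 2 3 (FAnd (FAdj 2 3) (free_fm i 3)) s t k.

Definition between_fm i b v := FExNs [:: 0; 1]
  (FAnd (FSum 0 1 (thk i)) (FAnd (fwalk_fm i (ths i b) v 0) (fwalk_fm i v (thm i b) 1))).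

Definition theta_frame_fm : fm :=
  FAnd (FNadj (thr false) (thr true))
  (FAnd (FBig (fun i => FBig (fun b => FAdj (thr b) (ths i b))))
  (FAnd (FBig (fun i => FAdj (thm i false) (thm i true)))
  (FAnd (FBig (fun i => FBig (fun b => fwalk_fm i (ths i b) (thm i b) (thk i))))
        (FBig (fun i => FBig (fun i' => FBig (fun b => FBig (fun b' =>
           if i == i' then FTrue else
           FAll 0 (FAll 1 (FImp (between_fm i b 0) (FImp (between_fm i' b' 1)
             (FAnd (FNot (FEq 0 1)) (FNadj 0 1))))))))))))).

(** Vertex variables 4 to 17 hold [r], [s] and [m]; number variables 2 to 4 hold [k]. *)
Definition theta_fm : fm := FExs (iota 4 14) (FExNs (iota 2 3) theta_frame_fm).

Definition comp_fm (x y : nat) (F : nat -> fm) r v : fm :=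
  FAnd (F r) (FExN 0 (FWalk x y (FAnd (FAdj x y) (FAnd (F x) (F y))) r v 0)).

Definition half_fm a b r (K : nat -> fm) : fm :=
  FOr (FAdj a b) (FAnd (FAdj a r) (FEx 0 (FAnd (K 0) (FAdj 0 b)))).

Definition tentF1_fm v : fm :=
  FAnd (FNadj v 6) (FAnd (FNadj v 7) (FAnd (FNadj v 8) (FAnd (FNadj v 9) (FAnd (FNadj v 13) (FNadj v 14))))).
Definition tentX1_fm v : fm := FOr (FEq v 10) (FOr (FEq v 11) (comp_fm 4 5 tentF1_fm 12 v)).
Definition tentF2_fm v : fm :=
  FAnd (FAnd (FNadj v 6) (FAnd (FNadj v 7) (FAnd (FNadj v 8) (FNadj v 9))))
       (FAll 1 (FImp (tentX1_fm 1) (FAnd (FNot (FEq 1 v)) (FNadj 1 v)))).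

Definition tent_frame_fm : fm :=
  FAnd (FAdj 6 7) (FAnd (FAnd (FAdj 6 10) (FAnd (FAdj 6 13) (FAnd (FAdj 8 10) (FAdj 8 13))))
  (FAnd (FAnd (FAdj 7 11) (FAnd (FAdj 7 14) (FAnd (FAdj 9 11) (FAdj 9 14))))
  (FAnd (FAnd (FNadj 8 9) (FAnd (FNadj 8 7) (FNadj 6 9)))
  (FAnd (half_fm 10 11 12 (comp_fm 4 5 tentF1_fm 12))
  (FAnd (half_fm 13 14 15 (comp_fm 2 3 tentF2_fm 15))
        (FAll 0 (FImp (tentX1_fm 0) (FAnd (FNot (FEq 0 13)) (FAnd (FNot (FEq 0 14))
           (FAnd (FNadj 0 13) (FNadj 0 14))))))))))).

(** Variables 6 to 15 are the ten vertices of the frame, in the order of the arguments of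
    [tent_frame]; 0 to 5 are left for bound variables. *)
Definition tent_fm : fm := FExs (iota 6 10) tent_frame_fm.

Definition hox (i : 'I_5) := i.+4.+4.+2.
Definition hoa (i : 'I_5) := i.+3.

Definition clean_fm v : fm :=
  FAnd (FImp (FAdj v 4) (FOr (FEq v 5) (FEq v 6))) (FImp (FAdj v 7) (FOr (FEq v 8) (FEq v 9))).

Definition cwalk_fm s t k := FWalk 2 3 (FAnd (FAdj 2 3) (FAnd (clean_fm 2) (clean_fm 3))) s t k.
Definition pos_fm k := FNot (FSum k k k).

Definition spot_fm (i : 'I_5) v := FExNs [:: 0; 1]
  (FAnd (FSum 0 1 (hoa i)) (FAnd (pos_fm 1) (FAnd (cwalk_fm (hox i) v 0) (cwalk_fm v (hox (ordS i)) 1)))).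

Definition hole_frame_fm : fm :=
  FAnd (FBig (fun i => FAnd (pos_fm (hoa i)) (cwalk_fm (hox i) (hox (ordS i)) (hoa i))))
  (FAnd (FBig (fun i => FAllN 0 (FAllN 1 (FImp (FAnd (FSum 0 1 (hoa i)) (pos_fm 1))
           (FNot (cwalk_fm (hox i) (hox (ordS i)) 0))))))
  (FAnd (FBig (fun i => FAll 0 (FAll 1 (FImp (spot_fm i 0) (FImp (spot_fm (ordS i) 1)
           (FAnd (FNot (FEq 0 1)) (FImp (FAdj 0 1) (FEq 1 (hox (ordS i))))))))))
  (FAnd (FBig (fun i => FAll 0 (FAll 1 (FImp (spot_fm i 0) (FImp (spot_fm (ordS (ordS i)) 1)
           (FAnd (FNot (FEq 0 1)) (FNadj 0 1)))))))
        (FMod (iota 3 5))))).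

(** Variables 4 to 9 hold the arguments of [clean] and 10 to 14 the five points; number variables 3
    to 7 hold the distances. *)
Definition hole_fm : fm := FExs (iota 4 11) (FExNs (iota 3 5) hole_frame_fm).

Definition unb_fm : fm := FOr hexagon_fm (FOr theta_fm (FOr tent_fm hole_fm)).

(** * The formulas express the four configurations *)

Section Meaning.
Variables (T : finType) (adj : rel T).
Notation sem := (sem adj).

Lemma sem_and rv rn f g : sem rv rn (FAnd f g) = sem rv rn f && sem rv rn g. Proof. by []. Qed.
Lemma sem_not rv rn f : sem rv rn (FNot f) = ~~ sem rv rn f. Proof. by []. Qed.
Lemma sem_sum rv rn i j k : sem rv rn (FSum i j k) = (rn i + rn j == rn k). Proof. by []. Qed.

Lemma sem_exn2 rv rn f : sem rv rn (FExNs [:: 0; 1] f) <->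
  exists j1 j2, [/\ j1 < #|T|, j2 < #|T| & sem rv (upd 1 j2 (upd 0 j1 rn)) f].
Proof.
split=> [/existsP[j1 /existsP[j2 H]]|[j1 [j2 [H1 H2 H]]]].
  by exists j1, j2; split=> //; apply: ltn_ord.
by apply/existsP; exists (Ordinal H1); apply/existsP; exists (Ordinal H2).
Qed.

Lemma sem_free rv rn i v :
  sem rv rn (free_fm i v) = free_of adj (fun b => rv (thr b)) (fun i b => rv (ths i b)) i (rv v).
Proof.
rewrite /free_fm /= !sem_big /free_of; congr (_ && _); apply: eq_forallb => i'.
by case: eqVneq => _ /=; [exact: eqxx | rewrite sem_big].
Qed.

Lemma sem_fwalk rv rn i s t k : sem rv rn (fwalk_fm i s t k) =
  wkb (fstep adj (fun b => rv (thr b)) (fun i b => rv (ths i b)) i) (rn k) (rv s) (rv t).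
Proof.
apply: eq_wkb => u v.
change (adj u v && sem (upd 3 v (upd 2 u rv)) rn (free_fm i 3) =
  fstep adj (fun b => rv (thr b)) (fun i b => rv (ths i b)) i u v).
by rewrite sem_free.
Qed.

Lemma sem_between rv rn i b v : rn (thk i) < #|T| -> sem rv rn (between_fm i b v) <->
  between adj (fun b => rv (thr b)) (fun i b => rv (ths i b)) (fun i b => rv (thm i b)) (fun i => rn (thk i)) i b (rv v).
Proof.
move=> kb; rewrite /between_fm sem_exn2; split=> [[j1 [j2 [_ _]]]|[j1 [j2 [E W1 W2]]]].
  by rewrite !sem_and !sem_fwalk => /and3P[/eqP E W1 W2]; exists j1, j2.
exists j1, j2; split; try by move: kb; rewrite -E; slia.
by rewrite !sem_and !sem_fwalk sem_sum; apply/and3P; split=> //; apply/eqP.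
Qed.

Lemma sem_theta_frame rv rn : (forall i, rn (thk i) < #|T|) -> sem rv rn theta_frame_fm <->
  theta_frame adj (fun b => rv (thr b)) (fun i b => rv (ths i b)) (fun i b => rv (thm i b)) (fun i => rn (thk i)).
Proof.
move=> kb.
pose B i b v := between adj (fun b => rv (thr b)) (fun i b => rv (ths i b)) (fun i b => rv (thm i b)) (fun i => rn (thk i)) i b v.
have B0 i b v v' : sem (upd 1 v' (upd 0 v rv)) rn (between_fm i b 0) <-> B i b v.
  exact: (sem_between (upd 1 v' (upd 0 v rv)) b 0 (kb i)).
have B1 i b v v' : sem (upd 1 v' (upd 0 v rv)) rn (between_fm i b 1) <-> B i b v'.
  exact: (sem_between (upd 1 v' (upd 0 v rv)) b 1 (kb i)).
rewrite /theta_frame_fm; split.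
  rewrite !sem_and !sem_big => /and5P[H1].
  move=> /forallP H2 /forallP H3 /forallP H4 /forallP H5; split=> //.
  - by move=> i b; have := H2 i; rewrite sem_big => /forallP/(_ b).
  - by move=> i b; have := H4 i; rewrite sem_big => /forallP /(_ b); rewrite sem_fwalk.
  move=> i i' b b' v v' ii' Bv Bv'.
  have := H5 i; rewrite sem_big => /forallP/(_ i'); rewrite sem_big => /forallP/(_ b).
  rewrite sem_big => /forallP/(_ b'); rewrite (negbTE ii').
  rewrite sem_all => /forallP/(_ v); rewrite sem_all => /forallP/(_ v').
  rewrite !sem_imp => /implyP/(_ (proj2 (B0 _ _ _ _) Bv)) /implyP/(_ (proj2 (B1 _ _ _ _) Bv')).
  by rewrite sem_and => /andP[].
move=> [H1 H2 H3 H4 H5]; rewrite !sem_and !sem_big; apply/and5P; split=> //; apply/forallP => i.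
- by rewrite sem_big; apply/forallP => b; apply: H2.
- exact: H3.
- by rewrite sem_big; apply/forallP => b; rewrite sem_fwalk.
rewrite sem_big; apply/forallP => i'; rewrite sem_big; apply/forallP => b; rewrite sem_big; apply/forallP => b'.
case: eqVneq => [_|ii']; first exact: eqxx.
rewrite sem_all; apply/forallP => v; rewrite sem_all; apply/forallP => v'.
rewrite !sem_imp; apply/implyP => /B0 Bv; apply/implyP => /B1 Bv'.
by rewrite sem_and; apply/andP; apply: (H5 i i' b b').
Qed.

Lemma ord3 (i : 'I_3) : [\/ i = inord 0, i = inord 1 | i = inord 2].
Proof.
case: i => [[|[|[|//]]] Hi]; [constructor 1 | constructor 2 | constructor 3];
  by apply/val_inj; rewrite /= inordK.
Qed.

Lemma sem_theta rv rn : sem rv rn theta_fm <->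
  exists r s m k, (forall i, k i < #|T|) /\ theta_frame adj r s m k.
Proof.
rewrite /theta_fm sem_exs; split=> [[rv' _ /sem_exns[rn' [_ L H]]]|[r [s [m [k [kb H]]]]]].
  have kb i : rn' (thk i) < #|T|.
    by apply: L; rewrite mem_iota /thk; have := ltn_ord i; slia.
  by do 4 eexists; split; last exact: (proj1 (sem_theta_frame _ kb) H).
pose l := [:: r false; r true; s (inord 0) false; s (inord 0) true; s (inord 1) false; s (inord 1) true;
  s (inord 2) false; s (inord 2) true; m (inord 0) false; m (inord 0) true; m (inord 1) false; m (inord 1) true;
  m (inord 2) false; m (inord 2) true].
exists (fun y => if y < 4 then rv y else nth (rv y) l (y - 4)).
  by move=> y; rewrite mem_iota => yl; case: ltnP => // y4; rewrite nth_default //= ; slia.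
apply/sem_exns; exists (fun y => if 2 <= y < 5 then k (inord (y - 2)) else rn y); split.
- by move=> y; rewrite mem_iota => yl; rewrite ifF //; slia.
- by move=> y; rewrite mem_iota => yl; rewrite ifT //; slia.
have ki : (fun i : 'I_3 => if 2 <= thk i < 5 then k (inord (thk i - 2)) else rn (thk i)) = k.
  apply: functional_extensionality => i; have := ltn_ord i; rewrite /thk => i3.
  rewrite ifT; last by slia.
  by congr k; apply/val_inj; rewrite /= inordK; slia.
apply/sem_theta_frame.
  by move=> i; have := kb i; rewrite -[in X in X -> _]ki.
rewrite ki.
have -> : (fun b => if thr b < 4 then rv (thr b) else nth (rv (thr b)) l (thr b - 4)) = r.
  by apply: functional_extensionality => -[].
have -> : (fun i b => if ths i b < 4 then rv (ths i b) else nth (rv (ths i b)) l (ths i b - 4)) = s.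
  by apply: functional_extensionality => i; apply: functional_extensionality => b;
    case: (ord3 i) => ->; rewrite /ths inordK //; case: b.
have -> : (fun i b => if thm i b < 4 then rv (thm i b) else nth (rv (thm i b)) l (thm i b - 4)) = m.
  by apply: functional_extensionality => i; apply: functional_extensionality => b;
    case: (ord3 i) => ->; rewrite /thm inordK //; case: b.
exact: H.
Qed.

(** [rv'] may differ from [rv] only below 6, where the bound variables are, so [F] keeps its meaning
    inside nested quantifiers and walks. The variable 1 is excluded because [tentF2_fm] binds it. *)
Definition sound (rv : nat -> T) (F : nat -> fm) (P : pred T) : Prop :=
  forall rv' rn z, (forall k, rv' k.+4.+2 = rv k.+4.+2) -> z != 1 -> sem rv' rn (F z) = P (rv' z).

Lemma sem_comp rv rv' rn F (P : pred T) x y r v : sound rv F P ->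
  (forall k, rv' k.+4.+2 = rv k.+4.+2) -> r != 1 -> 1 < x < y -> y < 6 ->
  sem rv' rn (comp_fm x y F r v) = comp adj P (rv' r) (rv' v).
Proof.
move=> HF E r1 xy y6; rewrite /comp /= (HF rv' rn r E r1); congr (_ && _).
have W k : wkb (fun u v => sem (upd y v (upd x u rv')) (upd 0 k rn) (FAnd (FAdj x y) (FAnd (F x) (F y)))) k (rv' r) (rv' v)
    = wkb (cstep adj P) k (rv' r) (rv' v).
  apply: eq_wkb => u w /=.
  have E' k' : upd y w (upd x u rv') k'.+4.+2 = rv k'.+4.+2.
    rewrite /upd; case: eqnP => [H|_]; first by slia.
    by case: eqnP => [H|_]; [slia | exact: E].
  rewrite !(HF _ _ _ E'); try slia.
  rewrite /cstep /upd.
  have -> : eqn y x = false by apply/eqnP; slia.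
  have -> : eqn x x by apply/eqnP.
  by have -> : eqn y y by apply/eqnP.
apply/existsP/idP => [[k]|/connect_wkb[k kT Hk]]; first by rewrite W => /wkb_connect.
by exists (Ordinal kT); rewrite W.
Qed.

Lemma sem_half rv rn a b r (K : nat -> fm) (P : pred T) :
  (forall v, sem (upd 0 v rv) rn (K 0) = P v) ->
  sem rv rn (half_fm a.+1 b.+1 r.+1 K) = half adj (rv a.+1) (rv b.+1) (rv r.+1) P.
Proof.
move=> H; rewrite sem_or /half; congr (_ || _); rewrite /=; congr (_ && _).
by apply: eq_existsb => v; rewrite H.
Qed.

Lemma sem_tent_frame rv rn : sem rv rn tent_frame_fm =
  tent_frame adj (rv 6) (rv 7) (rv 8) (rv 9) (rv 10) (rv 11) (rv 12) (rv 13) (rv 14) (rv 15).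
Proof.
pose F1 := tentF1 adj (rv 6) (rv 7) (rv 8) (rv 9) (rv 13) (rv 14).
pose X1 := tentX1 adj (rv 6) (rv 7) (rv 8) (rv 9) (rv 10) (rv 11) (rv 12) (rv 13) (rv 14).
pose F2 := tentF2 adj (rv 6) (rv 7) (rv 8) (rv 9) (rv 10) (rv 11) (rv 12) (rv 13) (rv 14).
have S1 : sound rv tentF1_fm F1.
  move=> rv' rn' z E _; rewrite /= /F1 /tentF1 !negb_or.
  by rewrite (E 0) (E 1) (E 2) (E 3) (E 7) (E 8).
have C1 rv' rn' z : (forall k, rv' k.+4.+2 = rv k.+4.+2) -> sem rv' rn' (comp_fm 4 5 tentF1_fm 12 z) = comp adj F1 (rv 12) (rv' z).
  by move=> E; rewrite (sem_comp rn' z S1 E) // -(E 6).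
have SX rv' rn' z : (forall k, rv' k.+4.+2 = rv k.+4.+2) -> sem rv' rn' (tentX1_fm z) = X1 (rv' z).
  by move=> E; rewrite /tentX1_fm !sem_or C1 // /X1 /tentX1 /= (E 4) (E 5).
have S2 : sound rv tentF2_fm F2.
  move=> rv' rn' z E z1; rewrite /tentF2_fm /F2 /tentF2.
  change (sem rv' rn' (FAnd (FNadj z 6) (FAnd (FNadj z 7) (FAnd (FNadj z 8) (FNadj z 9)))) &&
    sem rv' rn' (FAll 1 (FImp (tentX1_fm 1) (FAnd (FNot (FEq 1 z)) (FNadj 1 z)))) = F2 (rv' z)).
  rewrite sem_all; congr (_ && _); first by rewrite /= !negb_or (E 0) (E 1) (E 2) (E 3).
  apply: eq_forallb => u; rewrite sem_imp SX; last by move=> k; rewrite /upd /= E.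
  rewrite -/X1; congr (_ ==> _); rewrite /= /upd /=.
  by have -> : eqn 1 z = false by apply/eqnP => Z; rewrite -Z in z1.
have C2 rv' rn' z : (forall k, rv' k.+4.+2 = rv k.+4.+2) -> sem rv' rn' (comp_fm 2 3 tentF2_fm 15 z) = comp adj F2 (rv 15) (rv' z).
  by move=> E; rewrite (sem_comp rn' z S2 E) // -(E 9).
rewrite /tent_frame -/F1 -/F2.
rewrite -(@sem_half rv rn 9 10 11 (comp_fm 4 5 tentF1_fm 12)); last by move=> v; rewrite C1.
rewrite -(@sem_half rv rn 12 13 14 (comp_fm 2 3 tentF2_fm 15)); last by move=> v; rewrite C2.
rewrite -[in RHS](eq_forallb (P1 := fun v => sem (upd 0 v rv) rn
  (FImp (tentX1_fm 0) (FAnd (FNot (FEq 0 13)) (FAnd (FNot (FEq 0 14)) (FAnd (FNadj 0 13) (FNadj 0 14))))))).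
  by rewrite -sem_all.
by move=> v; rewrite sem_imp SX.
Qed.

Lemma sem_tent rv rn : sem rv rn tent_fm <->
  exists p1 p2 c1 c2 a1 b1 r1 a2 b2 r2, tent_frame adj p1 p2 c1 c2 a1 b1 r1 a2 b2 r2.
Proof.
rewrite /tent_fm sem_exs; split=> [[rv' _]|[p1 [p2 [c1 [c2 [a1 [b1 [r1 [a2 [b2 [r2 H]]]]]]]]]]].
  by rewrite sem_tent_frame => H; do 10 eexists; exact: H.
pose l := [:: p1; p2; c1; c2; a1; b1; r1; a2; b2; r2].
exists (fun y => if y < 6 then rv y else nth (rv y) l (y - 6)).
  by move=> y; rewrite mem_iota => yl; case: ltnP => // y4; rewrite nth_default //= ; slia.
by rewrite sem_tent_frame.
Qed.

Section Hole.
Variables (rv : nat -> T).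
Let A := clean adj (rv 4) (rv 5) (rv 6) (rv 7) (rv 8) (rv 9).

Lemma sem_clean rn v : sem rv rn (clean_fm v) = A (rv v).
Proof. by rewrite /clean_fm /= !negb_and !negbK -!implybE. Qed.
End Hole.

Lemma sem_cwalk rv rn s t k : sem rv rn (cwalk_fm s t k) =
  wkb (cstep adj (clean adj (rv 4) (rv 5) (rv 6) (rv 7) (rv 8) (rv 9))) (rn k) (rv s) (rv t).
Proof.
apply: eq_wkb => u v.
change (adj u v && (sem (upd 3 v (upd 2 u rv)) rn (clean_fm 2) && sem (upd 3 v (upd 2 u rv)) rn (clean_fm 3)) =
  cstep adj (clean adj (rv 4) (rv 5) (rv 6) (rv 7) (rv 8) (rv 9)) u v).
by rewrite !sem_clean.
Qed.

Lemma sem_pos rv rn k : sem rv rn (pos_fm k) = (0 < rn k).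
Proof. by rewrite /=; slia. Qed.

Lemma sem_spot rv rn i v : rn (hoa i) < #|T| -> sem rv rn (spot_fm i v) <->
  spot adj (clean adj (rv 4) (rv 5) (rv 6) (rv 7) (rv 8) (rv 9)) (fun i => rv (hox i)) (fun i => rn (hoa i)) i (rv v).
Proof.
move=> kb; rewrite /spot_fm sem_exn2; split=> [[j1 [j2 [_ _]]]|[j1 [j2 [E j0 W1 W2]]]].
  by rewrite !sem_and !sem_cwalk sem_pos => /and4P[/eqP E P W1 W2]; exists j1, j2.
exists j1, j2; split; try by move: kb; rewrite -E; slia.
by rewrite !sem_and !sem_cwalk sem_pos sem_sum; apply/and4P; split=> //; apply/eqP.
Qed.

Lemma sem_hole_frame rv rn : (forall i, rn (hoa i) < #|T|) -> sem rv rn hole_frame_fm <->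
  hole_frame adj (clean adj (rv 4) (rv 5) (rv 6) (rv 7) (rv 8) (rv 9)) (fun i => rv (hox i)) (fun i => rn (hoa i)).
Proof.
move=> kb.
have sE : \sum_(i <- iota 3 5) rn i = \sum_(i < 5) rn (hoa i).
  by rewrite -(big_mkord xpredT (fun i => rn i.+3)) /index_iota /= !big_cons !big_nil.
pose S i v := spot adj (clean adj (rv 4) (rv 5) (rv 6) (rv 7) (rv 8) (rv 9)) (fun i => rv (hox i)) (fun i => rn (hoa i)) i v.
have S0 i v v' : sem (upd 1 v' (upd 0 v rv)) rn (spot_fm i 0) <-> S i v.
  exact: (sem_spot (upd 1 v' (upd 0 v rv)) 0 (kb i)).
have S1 i v v' : sem (upd 1 v' (upd 0 v rv)) rn (spot_fm i 1) <-> S i v'.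
  exact: (sem_spot (upd 1 v' (upd 0 v rv)) 1 (kb i)).
rewrite /hole_frame_fm; split.
  rewrite !sem_and !sem_big => /and5P[].
  move=> /forallP H1 /forallP H2 /forallP H3 /forallP H4 /eqP; rewrite sE => H5; split=> //.
  - by move=> i; have := H1 i; rewrite sem_and sem_pos sem_cwalk => /andP[].
  - move=> i b ba; have := H2 i; rewrite sem_alln => /forallP/(_ (Ordinal (ltn_trans ba (kb i)))).
    (* Order is expressed by sums: [b] is less than [rn (hoa i)] when adding some positive number to
       it gives [rn (hoa i)], and this difference must itself be below the number of vertices. *)
    have cT : rn (hoa i) - b < #|T| by have := kb i; slia.
    rewrite sem_alln => /forallP/(_ (Ordinal cT)); rewrite sem_imp sem_and sem_not sem_pos sem_cwalk => /implyP; apply.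
    by rewrite sem_sum /upd /= (subnKC (ltnW ba)) eqxx subn_gt0.
  - move=> i v v' Sv Sv'; have := H3 i; rewrite sem_all => /forallP/(_ v); rewrite sem_all => /forallP/(_ v').
    rewrite sem_imp => /implyP/(_ (proj2 (S0 _ _ _) Sv)).
    rewrite sem_imp => /implyP/(_ (proj2 (S1 _ _ _) Sv')).
    by rewrite sem_and sem_imp => /andP[N /implyP M]; split=> // /M /eqP.
  - move=> i v v' Sv Sv'; have := H4 i; rewrite sem_all => /forallP/(_ v); rewrite sem_all => /forallP/(_ v').
    rewrite sem_imp => /implyP/(_ (proj2 (S0 _ _ _) Sv)).
    by rewrite sem_imp => /implyP/(_ (proj2 (S1 _ _ _) Sv')); rewrite sem_and => /andP[].
move=> [H1 H2 H3 H4 H5]; rewrite !sem_and; apply/and5P; split; last by apply/eqP; rewrite sE.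
- rewrite sem_big; apply/forallP => i; have [a0 W] := H1 i.
  by rewrite sem_and sem_pos sem_cwalk; apply/andP.
- rewrite sem_big; apply/forallP => i; rewrite sem_alln; apply/forallP => b.
  rewrite sem_alln; apply/forallP => c; rewrite sem_imp sem_and sem_not sem_sum sem_pos sem_cwalk.
  by apply/implyP => /andP[/eqP E P]; apply: H2; move: E P; rewrite /upd /= => <-; slia.
- rewrite sem_big; apply/forallP => i; rewrite sem_all; apply/forallP => v; rewrite sem_all; apply/forallP => v'.
  rewrite !sem_imp; apply/implyP => /S0 Sv; apply/implyP => /S1 Sv'.
  have [N M] := H3 i _ _ Sv Sv'; rewrite sem_and sem_imp; apply/andP; split=> //; apply/implyP => /M E.
  exact/eqP.
- rewrite sem_big; apply/forallP => i; rewrite sem_all; apply/forallP => v; rewrite sem_all; apply/forallP => v'.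
  rewrite !sem_imp; apply/implyP => /S0 Sv; apply/implyP => /S1 Sv'.
  by have [N M] := H4 i _ _ Sv Sv'; rewrite sem_and; apply/andP.
Qed.

Lemma ord5 (i : 'I_5) : [\/ i = inord 0, i = inord 1, i = inord 2 | i = inord 3 \/ i = inord 4].
Proof.
case: i => [[|[|[|[|[|//]]]]] Hi]; [constructor 1 | constructor 2 | constructor 3 | constructor 4; left | constructor 4; right];
  by apply/val_inj; rewrite /= inordK.
Qed.

Lemma sem_hole rv rn : sem rv rn hole_fm <->
  exists u um up v vm vp x a, (forall i, a i < #|T|) /\ hole_frame adj (clean adj u um up v vm vp) x a.
Proof.
rewrite /hole_fm sem_exs; split=> [[rv' _ /sem_exns[rn' [_ L H]]]|[u [um [up [v [vm [vp [x [a [kb H]]]]]]]]]].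
  have kb i : rn' (hoa i) < #|T|.
    by apply: L; rewrite mem_iota /hoa; have := ltn_ord i; slia.
  by do 8 eexists; split; last exact: (proj1 (sem_hole_frame _ kb) H).
pose l := [:: u; um; up; v; vm; vp; x (inord 0); x (inord 1); x (inord 2); x (inord 3); x (inord 4)].
exists (fun y => if y < 4 then rv y else nth (rv y) l (y - 4)).
  by move=> y; rewrite mem_iota => yl; case: ltnP => // y4; rewrite nth_default //= ; slia.
apply/sem_exns; exists (fun y => if 3 <= y < 8 then a (inord (y - 3)) else rn y); split.
- by move=> y; rewrite mem_iota => yl; rewrite ifF //; slia.
- by move=> y; rewrite mem_iota => yl; rewrite ifT //; slia.
have ki : (fun i : 'I_5 => if 3 <= hoa i < 8 then a (inord (hoa i - 3)) else rn (hoa i)) = a.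
  apply: functional_extensionality => i; have := ltn_ord i; rewrite /hoa => i3.
  rewrite ifT; last by slia.
  by congr a; apply/val_inj; rewrite /= inordK; slia.
apply/sem_hole_frame.
  by move=> i; have := kb i; rewrite -[in X in X -> _]ki.
rewrite ki.
have -> : (fun i => if hox i < 4 then rv (hox i) else nth (rv (hox i)) l (hox i - 4)) = x.
  apply: functional_extensionality => i.
  by case: (ord5 i) => [->|->|->|[->|->]]; rewrite /hox inordK.
exact: H.
Qed.

Variable side : T -> bool.
Hypothesis adjC : symmetric adj.
Hypothesis bip : forall x y, adj x y -> side x != side y.

Lemma sem_hexagon rv rn : sem rv rn hexagon_fm <-> exists c, phole adj c 6.
Proof.
rewrite /hexagon_fm sem_exs; split=> [[rv' _]|[c [P H]]].
  case/andP=> H1 H2; apply: (hexagon adjC bip (x1 := rv' 0) (x2 := rv' 1) (x3 := rv' 2)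
     (j1 := rv' 3) (j2 := rv' 4) (j3 := rv' 5)); first exact: H1.
  by rewrite !negb_or; exact: H2.
(* Alternate vertices of the hole come first; the vertex opposite to each of them stands three
   places later. *)
pose l := [:: c 0; c 2; c 4; c 3; c 5; c 1].
exists (fun y => nth (rv y) l y).
  by move=> y; rewrite mem_iota => yl; rewrite nth_default //=; slia.
have A i j : i < j < i + 6 -> adj (c i) (c j) = (j == i.+1) || (j.+1 == i + 6) by case/H.
by rewrite /= (adjC (c 2) (c 1)) (adjC (c 4) (c 3)) (adjC (c 4) (c 1)) !A.
Qed.

(** Each of the four tests is sound by itself. Conversely, if the first three fail, a smallest
    unbalanced hole has more than 6 vertices and the graph has no theta and no tent, which is what
    the fourth test requires. *)
Lemma sem_unb rv rn : sem rv rn unb_fm <-> unb adj.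
Proof.
rewrite /unb_fm !sem_or; split.
  case/or4P.
  - by move/sem_hexagon => [c Hc]; exists 6, c.
  - move/sem_theta => [r [s [m [k [_ /(theta_frame_sound adjC bip)[a [b [X [Y [Z]]]]]]]]]].
    exact: (theta_unb adjC bip).
  - by move/sem_tent => [p1 [p2 [c1 [c2 [a1 [b1 [r1 [a2 [b2 [r2 /(tent_frame_sound adjC bip)]]]]]]]]]].
  - by move/sem_hole => [u [um [up [v [vm [vp [x [a [_ /(hole_frame_sound adjC)]]]]]]]]].
move=> U; apply/negPn/negP; rewrite !negb_or => /and4P[N0 N1 N2 N3].
have TF : theta_free adj side.
  move=> a b X Y Z /(theta_frame_complete adjC bip) H; apply: H => r s m k kb H.
  by case/negP: N1; apply/sem_theta; exists r, s, m, k.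
have TNF : tent_free adj.
  move=> p1 p2 c1 c2 a1 b1 r1 a2 b2 r2; apply/negP => H.
  by case/negP: N2; apply/sem_tent; exists p1, p2, c1, c2, a1, b1, r1, a2, b2, r2.
have [n [c [n5 n4 Hc]]] := U.
have [N] := ubnP n; elim: N n c n5 n4 Hc => // N IH n c n5 n4 Hc nN.
have Cm : smallest adj c n.
  by split=> // m c' m5 m4 mn Hc'; apply: (IH m c') => //; slia.
have [n6|n6] := eqVneq n 6.
  by case/negP: N0; apply/sem_hexagon; exists c; rewrite -n6.
have [[[[[[u um] up] v] vm] vp] [x [a [kb H]]]] := hole_frame_complete adjC bip Cm (ltac:(slia) : 6 < n) TF TNF.
by case/negP: N3; apply/sem_hole; exists u, um, up, v, vm, vp, x, a.
Qed.

End Meaning.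

(** * The recognition algorithm *)

Definition cnb_fm x z := FOr (FEq x z) (FAdj x z).
Definition cl_fm x y z := FAnd (cnb_fm x z) (cnb_fm y z).
Definition good_fm x y := FAnd (FAdj x y)
  (FAll 0 (FAll 1 (FImp (cl_fm x y 0) (FImp (cl_fm x y 1) (FOr (FEq 0 1) (FAdj 0 1)))))).

Definition triangle_fm := FExs (iota 0 6)
  (FAnd (FAnd (FAdj 0 1) (FAnd (FAdj 1 2) (FAdj 0 2)))
  (FAnd (FAnd (cnb_fm 0 3) (FAnd (cnb_fm 1 3) (FNot (cnb_fm 2 3))))
  (FAnd (FAnd (cnb_fm 1 4) (FAnd (cnb_fm 2 4) (FNot (cnb_fm 0 4))))
        (FAnd (cnb_fm 0 5) (FAnd (cnb_fm 2 5) (FNot (cnb_fm 1 5))))))).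

Definition pair_adj_fm :=
  FOr (FAnd (FEq 2 3) (FAnd (good_fm 4 5) (cl_fm 4 5 2)))
      (FAnd (FEq 4 5) (FAnd (good_fm 2 3) (cl_fm 2 3 4))).
Definition same_fm := FAll 0 (FAnd (FImp (cl_fm 2 3 0) (cl_fm 4 5 0)) (FImp (cl_fm 4 5 0) (cl_fm 2 3 0))).
Definition central_fm := FAll 2 (FAll 3 (FImp (good_fm 2 3) (cl_fm 2 3 4))).

Section Formulas.
Variables (T : finType) (e : rel T).
Notation sem := (sem e).

Lemma sem_cnb rv rn x z : sem rv rn (cnb_fm x z) = cnb e (rv x) (rv z).
Proof. by rewrite sem_or. Qed.

Lemma sem_ncnb rv rn x z : sem rv rn (FNot (cnb_fm x z)) = ~~ cnb e (rv x) (rv z).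
Proof. by rewrite sem_not sem_cnb. Qed.

Lemma sem_cl rv rn x y z : sem rv rn (cl_fm x y z) = (rv z \in pair_clique e (rv x) (rv y)).
Proof. by rewrite sem_and !sem_cnb inE. Qed.

Lemma sem_good rv rn x y : sem rv rn (good_fm x.+2 y.+2) = good e (rv x.+2, rv y.+2).
Proof.
rewrite sem_and sem_all /good; congr (_ && _); apply/forallP/cliqueP => [H a b aC bC ab|H a].
  have := H a; rewrite sem_all => /forallP/(_ b); rewrite 2!sem_imp !sem_cl sem_or.
  by rewrite /= /upd /= aC bC (negbTE ab).
rewrite sem_all; apply/forallP => b; rewrite 2!sem_imp !sem_cl sem_or /= /upd /=.
apply/implyP => aC; apply/implyP => bC; case: eqVneq => //= ab; exact: H.
Qed.

Lemma sem_triangle rv rn : sem rv rn triangle_fm <-> extended_triangle e.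
Proof.
rewrite /triangle_fm sem_exs; split=> [[rv' _]|[x [y [z [a [b [c [H1 H2 H3 H4]]]]]]]].
  rewrite !sem_and !sem_ncnb !sem_cnb => /and4P[H1 H2 H3 H4].
  by exists (rv' 0), (rv' 1), (rv' 2), (rv' 3), (rv' 4), (rv' 5).
exists (fun k => nth (rv k) [:: x; y; z; a; b; c] k).
  by move=> k; rewrite mem_iota => kl; rewrite nth_default //=; slia.
by rewrite !sem_and !sem_ncnb !sem_cnb; apply/and4P.
Qed.

Lemma sem_pair_adj rv rn : sem rv rn pair_adj_fm = pair_adj e (rv 2, rv 3) (rv 4, rv 5).
Proof. by rewrite sem_or; congr (_ || _); rewrite 2!sem_and sem_good sem_cl. Qed.

Lemma sem_same rv rn : sem rv rn same_fm = (pair_clique e (rv 2) (rv 3) == pair_clique e (rv 4) (rv 5)).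
Proof.
rewrite sem_all; apply/forallP/eqP => [H|H z]; last by rewrite sem_and !sem_imp !sem_cl /upd /= H implybb.
apply/setP => z; have := H z; rewrite sem_and !sem_imp !sem_cl /upd /=.
by case: (z \in _); case: (z \in _).
Qed.

Lemma sem_central rv rn : sem rv rn central_fm = central e (rv 4).
Proof.
rewrite sem_all; apply/forallP/forallP => [H [x y]|H x].
  have := H x; rewrite sem_all => /forallP/(_ y); by rewrite sem_imp sem_good sem_cl.
rewrite sem_all; apply/forallP => y; have := H (x, y); by rewrite sem_imp sem_good sem_cl.
Qed.

End Formulas.

Definition adj1 (t t' rt : tree) : bool := isnode (hd_tree (dropt t' (hd_tree (dropt t rt)))).
Definition eq1 (t t' rt : tree) : bool := val t == val t'.
Definition univ1 (rt : tree) : tree := nums (val rt).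

Lemma PP_adj1 : PP (fun d => adj1 (hd_tree d) (hd_tree (tl_tree d)) (tl_tree (tl_tree d))).
Proof. by apply: PPnode; apply: PFhd; apply: PFdropt; [pf | apply: PFhd; apply: PFdropt; pf]. Qed.

Lemma PP_eq1 : PP (fun d => eq1 (hd_tree d) (hd_tree (tl_tree d)) (tl_tree (tl_tree d))).
Proof. by apply: PPeq; pf. Qed.

Lemma PF_univ1 : PF univ1.
Proof. exact: PFnums PFid. Qed.

Notation evt1 := (evt adj1 eq1 univ1).

Definition env4 (t t' : tree) : tree :=
  enc_seq [:: Leaf; Leaf; hd_tree t; tl_tree t; hd_tree t'; tl_tree t'].

Definition adj2 (t t' rt : tree) : bool := evt1 rt (env4 t t') Leaf pair_adj_fm.
Definition eq2 (t t' rt : tree) : bool := (val (hd_tree t) == val (hd_tree t')) && (val (tl_tree t) == val (tl_tree t')).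
Definition univ2 (rt : tree) : tree := prodt (univ1 rt) (univ1 rt).
Definition good2 (t rt : tree) : bool := evt1 rt (env4 t t) Leaf (good_fm 2 3).
Definition same2 (t t' rt : tree) : bool := evt1 rt (env4 t t') Leaf same_fm.
Definition central1 (t rt : tree) : bool := evt1 rt (env4 Leaf (Node t t)) Leaf central_fm.

Lemma PP_evt1 f a b rt : PF a -> PF b -> PF rt ->
  PP (fun d => evt1 (rt d) (env4 (a d) (b d)) Leaf f).
Proof.
move=> Ha Hb Hr; apply: (PPcomp (f := fun d => Node (env4 (a d) (b d)) (Node Leaf (rt d))) _ (PP_evt PP_adj1 PP_eq1 PF_univ1 f)).
by rewrite /env4 /=; pf.
Qed.

Lemma PP_adj2 : PP (fun d => adj2 (hd_tree d) (hd_tree (tl_tree d)) (tl_tree (tl_tree d))).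
Proof. by apply: PP_evt1; pf. Qed.

Lemma PP_eq2 : PP (fun d => eq2 (hd_tree d) (hd_tree (tl_tree d)) (tl_tree (tl_tree d))).
Proof. by apply: PPand; apply: PPeq; pf. Qed.

Lemma PF_univ2 : PF univ2.
Proof. exact: PFprodt PF_univ1 PF_univ1. Qed.

Notation evt2 := (evt adj2 eq2 univ2).

(** Different good pairs may give the same clique, so one representative of each clique is kept for
    counting. *)
Definition dedup (rt : tree) : tree :=
  foldl (fun acc t => if good2 t rt && ~~ has (fun t' => same2 t t' rt) (lst acc) then Node t acc else acc)
    Leaf (lst (univ2 rt)).

Lemma PF_dedup : PF dedup.
Proof.
have [q Hq B] := PF_size PF_univ2.
apply: (@PFfoldl (fun acc t rt => if good2 t rt && ~~ has (fun t' => same2 t t' rt) (lst acc) then Node t acc else acc)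
  (fun=> Leaf) univ2 (fun n => 1 + q n * (1 + q n))); try by pf.
- apply: PFifb; try by pf.
  apply: PPand; first by apply: PP_evt1; pf.
  apply: PPnot; apply: (@PPhas (fun t' e => same2 (hd_tree (tl_tree e)) t' (tl_tree (tl_tree e))) hd_tree); last by pf.
  by apply: PP_evt1; pf.
- exact: PF_univ2.
- by ispoly.
move=> d k; apply: leq_trans (foldl_size (c := 1 + tree_size (univ2 d)) _ _ _) _.
  by move=> acc x Hx; case: ifP => _ /=; slia.
by rewrite leq_add2l leq_mul // leq_add2l.
Qed.

(** The graph without vertices is accepted at once, because the semantics of the formulas needs a
    vertex as the initial value of the variables. *)
Definition decide (rt : tree) : bool :=
  ~~ isnode rt || [&& ~~ evt1 rt Leaf Leaf triangle_fm, ~~ evt2 rt Leaf Leaf unb_fm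
                    & val (dedup rt) <= val (filt (fun t => central1 t rt) (univ1 rt))].

Lemma PP_decide : PP decide.
Proof.
apply: PPor; first by apply: PPnot; apply: PPnode; pf.
apply: PPand; [|apply: PPand].
- apply: PPnot; apply: (PPcomp (f := fun d => Node Leaf (Node Leaf d)) _ (PP_evt PP_adj1 PP_eq1 PF_univ1 triangle_fm)).
  by pf.
- apply: PPnot; apply: (PPcomp (f := fun d => Node Leaf (Node Leaf d)) _ (PP_evt PP_adj2 PP_eq2 PF_univ2 unb_fm)).
  by pf.
apply: PPle; first exact: PF_dedup.
apply: PFfilt; last exact: PF_univ1.
by apply: PP_evt1; pf.
Qed.

(** * Correctness of the decision procedure *)

Section Correct.
Variables (n : nat) (e : rel 'I_n.+1).
Hypothesis eS : simple_graph e.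
Let rt := enc_graph e.

Lemma hd_dropt t u : hd_tree (dropt t u) = nth Leaf (lst u) (val t).
Proof.
have -> v : hd_tree v = nth Leaf (lst v) 0 by case: v.
by rewrite lst_dropt nth_drop addn0.
Qed.

Let R1 (t : tree) (x : 'I_n.+1) : Prop := val t = x.
Let R2 (t : tree) (p : 'I_n.+1 * 'I_n.+1) : Prop := R1 (hd_tree t) p.1 /\ R1 (tl_tree t) p.2.

Let adj1E t t' u v : R1 t u -> R1 t' v -> adj1 t t' rt = e u v.
Proof.
move=> tu tv; rewrite /adj1 hd_dropt hd_dropt tu tv /rt /enc_graph lst_enc.
rewrite (nth_map u) ?size_enum_ord // nth_ord_enum lst_enc (nth_map v) ?size_enum_ord // nth_ord_enum.
by case: (e u v).
Qed.

Let eq1E t t' u v : R1 t u -> R1 t' v -> eq1 t t' rt = (u == v).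
Proof. by move=> tu tv; rewrite /eq1 tu tv val_eqE. Qed.

Let enc1 (x : 'I_n.+1) : tree := num x.
Let s1 := rev (enum 'I_n.+1).

Let univ1E : lst (univ1 rt) = map enc1 s1.
Proof.
have -> : univ1 rt = nums n.+1 by rewrite /univ1 /rt val_enc size_map size_enum_ord.
have H k : lst (nums k) = map num (rev (iota 0 k)).
  by elim: k => // k IH; rewrite -addn1 iotaD rev_cat /= addn1 /= IH.
by rewrite H -val_enum_ord -map_rev -map_comp.
Qed.

Let enc1R x : R1 (enc1 x) x. Proof. exact: val_num. Qed.
Let s1T x : x \in s1. Proof. by rewrite mem_rev mem_enum. Qed.
Let s1n : size s1 = #|'I_n.+1|. Proof. by rewrite size_rev -cardE. Qed.

Let sem1 f ev en rv rn : (forall x, R1 (get x ev) (rv x)) -> (forall i, val (get i en) = rn i) ->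
  evt1 rt ev en f = sem e rv rn f.
Proof. exact: (evt_sem adj1E eq1E univ1E enc1R s1T s1n). Qed.

Let getL x : get x Leaf = Leaf.
Proof. by rewrite /get; have -> : iter x tl_tree Leaf = Leaf by elim: x => //= x ->. Qed.

Let rv4 (p q : 'I_n.+1 * 'I_n.+1) k := nth ord0 [:: ord0; ord0; p.1; p.2; q.1; q.2] k.

Let sem4 f t t' p q : R2 t p -> R2 t' q ->
  evt1 rt (env4 t t') Leaf f = sem e (rv4 p q) (fun=> 0) f.
Proof.
move=> [p1 p2] [q1 q2]; apply: sem1 => [x|i]; last by rewrite getL.
(* Beyond its six entries the environment yields [Leaf], which represents vertex 0, the default
   value in [rv4]. *)
do 6 (case: x => [//|x]).
have -> : get x.+4.+2 (env4 t t') = get x Leaf by rewrite /get !iterSr.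
by rewrite getL /rv4 /= nth_nil.
Qed.

Let adj2E t t' u v : R2 t u -> R2 t' v -> adj2 t t' rt = pair_adj e u v.
Proof. by move=> tu tv; rewrite /adj2 (sem4 _ tu tv) sem_pair_adj; case: u v tu tv => [? ?] [? ?]. Qed.

Let eq2E t t' u v : R2 t u -> R2 t' v -> eq2 t t' rt = (u == v).
Proof. by move=> [t1 t2] [t1' t2']; rewrite /eq2 t1 t2 t1' t2' !val_eqE -pair_eqE. Qed.

Let enc2 (p : 'I_n.+1 * 'I_n.+1) : tree := Node (enc1 p.1) (enc1 p.2).
Let s2 := rev [seq (x, y) | x <- s1, y <- s1].

Let univ2E : lst (univ2 rt) = map enc2 s2.
Proof.
rewrite /univ2 prodtE univ1E /s2 [RHS]map_rev; congr rev.
by rewrite map_allpairs allpairs_mapl; congr flatten; apply: eq_map => x; rewrite -map_comp.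
Qed.

Let enc2R p : R2 (enc2 p) p. Proof. by split; apply: enc1R. Qed.
Let s2T p : p \in s2.
Proof. by rewrite mem_rev; case: p => x y; apply/allpairsP; exists (x, y). Qed.
Let s2n : size s2 = #|{: 'I_n.+1 * 'I_n.+1}|.
Proof. by rewrite size_rev size_allpairs s1n card_prod. Qed.

Let clp (p : 'I_n.+1 * 'I_n.+1) := pair_clique e p.1 p.2.

Lemma val_dedup : val (dedup rt) = #|[set clp p | p : 'I_n.+1 * 'I_n.+1 & good e p]|.
Proof.
have goodE p : good2 (enc2 p) rt = good e p.
  by rewrite /good2 (sem4 _ (enc2R p) (enc2R p)) sem_good; case: p.
have sameE p q : same2 (enc2 p) (enc2 q) rt = (clp p == clp q).
  by rewrite /same2 (sem4 _ (enc2R p) (enc2R q)) sem_same.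
(* Invariant of the loop: the pairs in [L] have different cliques, and these are the cliques of the
   good pairs seen so far. *)
have [L [LE LU LI]] : exists L, [/\ lst (dedup rt) = map enc2 L, uniq (map clp L) &
    forall K, (K \in map clp L) = (K \in map clp (filter (good e) s2))].
  rewrite /dedup univ2E; elim/last_ind: s2 => [|s p [L [LE LU LI]]]; first by exists [::].
  rewrite map_rcons foldl_rcons filter_rcons; set acc := foldl _ _ _ in LE *.
  rewrite goodE LE has_map (eq_has (a2 := fun q => clp p == clp q)); last by move=> q; apply: sameE.
  have -> : has (fun q => clp p == clp q) L = (clp p \in map clp L).
    by rewrite -has_pred1 has_map; apply: eq_has => q /=; rewrite eq_sym.
  case: (boolP (good e p)) => gp /=; last by exists L.
  have [pL|pL] /= := boolP (clp p \in map clp L).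
    exists L; split=> // K; rewrite map_rcons mem_rcons inE LI.
    by case: eqVneq => // ->; rewrite -LI pL.
  exists (p :: L); split; [by rewrite /= LE | by rewrite /= pL | ].
  by move=> K; rewrite map_rcons mem_rcons !inE LI.
rewrite /val LE size_map -(size_map clp) -(card_uniqP LU); apply: eq_card => K.
rewrite LI; apply/mapP/imsetP => [[p]|[p]].
  by rewrite mem_filter => /andP[gp _] ->; exists p; rewrite ?inE.
by rewrite inE => gp ->; exists p => //; rewrite mem_filter gp s2T.
Qed.

Lemma decideE : decide rt <-> has_osf_split_root e.
Proof.
have -> : decide rt = [&& ~~ evt1 rt Leaf Leaf triangle_fm, ~~ evt2 rt Leaf Leaf unb_fm
                    & val (dedup rt) <= val (filt (fun t => central1 t rt) (univ1 rt))].
  rewrite /decide isnodeE; have -> : val rt = n.+1 by rewrite val_enc size_map size_enum_ord.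
  by [].
have -> : evt1 rt Leaf Leaf triangle_fm = sem e (fun=> ord0) (fun=> 0) triangle_fm.
  by apply: sem1 => x; rewrite getL.
have -> : evt2 rt Leaf Leaf unb_fm = sem (pair_adj e) (fun=> (ord0, ord0)) (fun=> 0) unb_fm.
  by apply: (evt_sem adj2E eq2E univ2E enc2R s2T s2n) => x; rewrite getL.
have -> : val (filt (fun t => central1 t rt) (univ1 rt)) = #|[set v | central e v]|.
  rewrite /val size_filt univ1E count_map.
  have cE x : central1 (enc1 x) rt = central e x.
    have L0 : R2 Leaf (ord0, ord0) by [].
    have X : R2 (Node (enc1 x) (enc1 x)) (x, x) by split; apply: enc1R.
    by rewrite /central1 (sem4 _ L0 X) sem_central.
  rewrite (eq_count (a2 := central e)); last exact: cE.
  rewrite /s1 count_rev -sum1_count big_enum_cond -sum1_card.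
  by apply: eq_bigl => x; rewrite !inE.
rewrite val_dedup osf_root_pairs //.
have ST := sem_triangle e (fun=> ord0) (fun=> 0).
have SU := sem_unb (@pair_adjC _ e) (pair_bip eS) (fun=> (ord0, ord0)) (fun=> 0).
split=> [/and3P[H1 H2 H3]|[H1 H2 H3]].
  by split=> // [/ST|/SU]; exact/negP.
by apply/and3P; split=> //; [apply/negP => /ST | apply/negP => /SU].
Qed.

End Correct.

Lemma enc_graph_size n (e : rel 'I_n) : tree_size (enc_graph e) <= 1 + n * (2 + n * 4).
Proof.
have H (s : seq tree) c : all (fun t => tree_size t <= c) s -> tree_size (enc_seq s) <= 1 + size s * (1 + c).
  by elim: s => //= t s IH /andP[tc /IH]; slia.
rewrite /enc_graph; apply: leq_trans (H _ (1 + n * 4) _) _; last by rewrite size_map size_enum_ord; slia.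
rewrite all_map; apply/allP => i _ /=; apply: leq_trans (H _ 3 _) _; last by rewrite size_map size_enum_ord.
by rewrite all_map; apply/allP => j _ /=; case: (e i j).
Qed.

Lemma recognizable : poly_time_recognizable (fun n (e : rel 'I_n) => has_osf_split_root e).
Proof.
have [c [m [p [_ Hp H]]]] := PP_decide.
have Hq : isP (fun n => p (1 + n * (2 + n * 4))) by apply: (isP_comp Hp); ispoly.
have [a [k B]] := isP_bound Hq.
exists c, a, k => n e eS; have [t [s [E O _ C _]]] := H (init_store (enc_graph e)).
exists t, s; split=> //.
  by apply: leq_trans C _; apply: leq_trans (B n); apply: isP_mono => //; apply: enc_graph_size.
have -> : s 0 <> Leaf <-> decide (enc_graph e).
  by rewrite O; change (init_store _ 0) with (enc_graph e); case: (decide _).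
(* For [n = 0] the answer is yes, and the criterion holds because there are no vertices for a sun
   and no clique with two vertices. *)
case: n e eS {E O C} => [|n] e eS; last exact: decideE.
have -> : decide (enc_graph e) = true by rewrite /enc_graph (size0nil (size_enum_ord 0)).
have [_ root] := osf_root_iff eS; split=> // _; apply: root; split.
  by move=> [l [u [_ [l3 _ _]]]]; have := u (Ordinal (ltac:(slia) : 0 < l)); case.
by rewrite (_ : edge_cliques e = set0) ?cards0 //; apply/setP => K; rewrite !inE; apply/negP => /andP[_ /card_gt1P[[]]].
Qed.

Theorem theorem11 :
  (forall (T : finType) (e : rel T), simple_graph e ->
     (has_connected_osf_split_root e <->
      balanced_graph e /\
      #|max_cliques e| <= #|\bigcap_(K in max_cliques e) K|)) /\
  poly_time_recognizable (fun n (e : rel 'I_n) => has_osf_split_root e).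
Proof. exact: (conj connected_root_iff recognizable). Qed.
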